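(* Let $0<\beta<1/2$. If $\{u_\varepsilon\}_{\varepsilon>0}\subset\mathcal{A}_\alpha$, with $w_\varepsilon(x):=u_\varepsilon(x)e^{-2\pi i\lfloor\varepsilon^{-\beta}\rfloor x}$, satisfies $$\tilde E_\varepsilon(u_\varepsilon)=F_\varepsilon(w_\varepsilon)\le C_0<\infty,$$ and, for a sequence $\varepsilon_\ell\to0$, $$\varepsilon_\ell^{-\beta}-\lfloor\varepsilon_\ell^{-\beta}\rfloor\to A,$$ then there exists a function $w\in H^1((0,1)\setminus J';S^1)$, where $J'$ is a finite, perhaps empty, set of points in $(0,1)$, such that along a subsequence (still denoted $\varepsilon_\ell\to0$) one has $$u_{\varepsilon_\ell}e^{-2\pi i\lfloor\varepsilon_\ell^{-\beta}\rfloor x}=w_{\varepsilon_\ell}\to w\quad\text{in }L^2\big((0,1);\mathbb{C}\big).$$ Furthermore, writing $w(x)=e^{i\theta(x)}$ for $\theta\in H^1((0,1)\setminus J')$, we have that for every compact set $K\subset\subset(0,1)\setminus J'$ there exists an $\varepsilon_0(K)>0$ such that for every $\varepsilon_\ell<\varepsilon_0$ one has $|u_{\varepsilon_\ell}|=|w_{\varepsilon_\ell}|>0$ on $K$ and there is a lifting whereby $u_{\varepsilon_\ell}(x)e^{-2\pi i\lfloor\varepsilon_\ell^{-\beta}\rfloor x}=w_{\varepsilon_\ell}(x)=\rho_{\varepsilon_\ell}(x)e^{i\theta_{\varepsilon_\ell}(x)}$ on $K$, with $$\theta_{\varepsilon_\ell}\rightharpoonup\theta\quad\text{weakly in }H^1_{loc}\big((0,1)\setminus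 J'\big).$$
   Context: Fix a constant $L>0$ and $\alpha\in[0,2\pi)$. Identify $\mathbb{R}^2$ with $\mathbb{C}$ when convenient; $\lfloor\cdot\rfloor$ is the integer part. Let $$\mathcal{A}_\alpha=\{u\in H^1((0,1);\mathbb{R}^2): u(0)=1,\ u(1)=e^{i\alpha}\}.$$ For $\varepsilon>0$ and $u=(u_1,u_2)\in\mathcal{A}_\alpha$ set $$\tilde E_\varepsilon(u)=\int_0^1 \frac{\varepsilon}{2}|u'|^2+\frac{1}{4\varepsilon}(|u|^2-1)^2+\frac{L}{2}(u_1u_2'-u_2u_1'-2\pi\varepsilon^{-\beta})^2\,dx.$$ In terms of $w(x)=u(x)e^{-2\pi i\lfloor\varepsilon^{-\beta}\rfloor x}$ (which satisfies the same boundary conditions), $\tilde E_\varepsilon(u)=F_\varepsilon(w)$ with $$F_\varepsilon(w)=\int_0^1\frac{\varepsilon}{2}\left|(we^{2\pi i\lfloor\varepsilon^{-\beta}\rfloor x})'\right|^2+\frac{1}{4\varepsilon}(|w|^2-1)^2+\frac{L}{2}\left(w_1w_2'-w_2w_1'+|w|^2\,2\pi\lfloor\varepsilon^{-\beta}\rfloor-2\pi\varepsilon^{-\beta}\right)^2dx.$$ Here $\rho_{\varepsilon_\ell}=|w_{\varepsilon_\ell}|$ and $C_0$ is independent of $\varepsilon$. *)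

(* Defs.v *)
From HB Require Import structures.
From mathcomp Require Import all_boot all_order all_algebra.
From mathcomp Require Import all_classical all_reals all_analysis.
From mathcomp Require Import complex.

Set Implicit Arguments.
Unset Strict Implicit.
Unset Printing Implicit Defensive.

Import Order.TTheory GRing.Theory Num.Theory.
Import numFieldNormedType.Exports.

Local Open Scope classical_set_scope.
Local Open Scope ring_scope.

Notation leb R := (@lebesgue_measure R).

Definition square_integrable (R : realType) (Om : set R) (f : R -> R) : Prop :=
  measurable_fun Om f /\ (\int[leb R]_(x in Om) (f x ^+ 2)%R%:E < +oo)%E.

Definition test_function (R : realType) (Om : set R) (phi : R -> R) : Prop :=
  [/\ forall (n : nat) (x : R), derivable (derive1n n phi) x 1,
      compact (closure [set x | phi x != 0]) &
      closure [set x | phi x != 0] `<=` Om].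

Definition weak_derivative (R : realType) (Om : set R) (f g : R -> R) : Prop :=
  forall phi : R -> R, test_function Om phi ->
    \int[leb R]_(x in Om) (f x * derive1 phi x)
      = - \int[leb R]_(x in Om) (g x * phi x).

Definition H1 (R : realType) (Om : set R) (f : R -> R) : Prop :=
  square_integrable Om f /\
  exists g : R -> R, square_integrable Om g /\ weak_derivative Om f g.

(* A representative of the weak derivative of [f] (unique up to null sets when
   [H1 Om f] holds; the zero function when there is none). *)
Definition wderiv (R : realType) (Om : set R) (f : R -> R) : R -> R :=
  xget (fun=> 0) [set g | square_integrable Om g /\ weak_derivative Om f g].

Definition H1_inner (R : realType) (Om : set R) (f g : R -> R) : R :=
  \int[leb R]_(x in Om) (f x * g x + wderiv Om f x * wderiv Om g x).

(* Weak convergence in the Hilbert space H^1(Om); the terms of the sequence are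
   only required to belong to H^1(Om) from some rank on. *)
Definition weak_cvg_H1 (R : realType) (Om : set R)
    (f : nat -> R -> R) (g : R -> R) : Prop :=
  [/\ \forall n \near \oo, H1 Om (f n),
      H1 Om g &
      forall psi : R -> R, H1 Om psi ->
        (fun n => H1_inner Om (f n) psi) @ \oo --> H1_inner Om g psi].

Definition weak_cvg_H1loc (R : realType) (Om : set R)
    (f : nat -> R -> R) (g : R -> R) : Prop :=
  forall U : set R, open U -> compact (closure U) -> closure U `<=` Om ->
    weak_cvg_H1 U f g.

Definition expi (R : realType) (t : R) : R[i] := Complex (cos t) (sin t).

Definition re_part (R : realType) (u : R -> R[i]) : R -> R :=
  fun x => complex.Re (u x).

Definition im_part (R : realType) (u : R -> R[i]) : R -> R :=
  fun x => complex.Im (u x).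

(* Real-valued; the norm [`|z|] of [R[i]] is valued in [R[i]]. *)
Definition modulus (R : realType) (z : R[i]) : R := Normc.normc z.

Definition H1C (R : realType) (Om : set R) (u : R -> R[i]) : Prop :=
  H1 Om (re_part u) /\ H1 Om (im_part u).

Definition H1S1 (R : realType) (Om : set R) (u : R -> R[i]) : Prop :=
  H1C Om u /\ {ae leb R, forall x, Om x -> modulus (u x) = 1}.

Definition cvg_L2C (R : realType) (Om : set R)
    (f : nat -> R -> R[i]) (g : R -> R[i]) : Prop :=
  (fun n => \int[leb R]_(x in Om) (modulus (f n x - g x) ^+ 2)%R%:E)%E
    @ \oo --> (0 : \bar R).

(* The boundary values are those of the continuous representative on [0, 1] of
   an H^1 function, so membership asks [u] to be that representative. *)
Definition admissible (R : realType) (alpha : R) (u : R -> R[i]) : Prop :=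
  [/\ H1C `]0, 1[ u,
      {within `[0, 1], continuous (re_part u)},
      {within `[0, 1], continuous (im_part u)},
      u 0 = 1 &
      u 1 = expi alpha].

Definition energy (R : realType) (L beta eps : R) (u : R -> R[i]) : \bar R :=
  let u1 := re_part u in
  let u2 := im_part u in
  let du1 := wderiv `]0, 1[ u1 in
  let du2 := wderiv `]0, 1[ u2 in
  let density := fun x : R =>
    eps / 2 * (du1 x ^+ 2 + du2 x ^+ 2)
    + (4 * eps)^-1 * (modulus (u x) ^+ 2 - 1) ^+ 2
    + L / 2 * (u1 x * du2 x - u2 x * du1 x - 2 * pi * eps `^ (- beta)) ^+ 2 in
  (\int[leb R]_(x in `]0%R, 1%R[) (density x)%:E)%E.

Definition winding (R : realType) (beta eps : R) : R :=
  (Num.floor (eps `^ (- beta)))%:~R.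

Definition unwind (R : realType) (beta eps : R) (u : R -> R[i]) : R -> R[i] :=
  fun x => u x * expi (- (2 * pi * winding beta eps * x)).

(* Main.v *)
(* Where |u|^2 drops to 1/4 the energy needs a fixed amount on an interval of
   length O(eps), so these points lie within O(eps) of boundedly many centres,
   which converge along a subsequence to a finite set P.  Away from P, write
   w = rho e^{i (H + S)}, where H is the integral of
   h = (u1 u2' - u2 u1') / |u|^2 - 2 pi N, cut off where |u|^2 <= 1/4, and where
   S = arg (w e^{-i H}) is locally constant.  The third term of the energy bounds
   h in L^2, because beta < 1/2 gives (2 pi eps^{-beta})^2 int (|u|^2 - 1)^2 = O(1).
   Hence H is equicontinuous and h converges weakly in L^2 along a subsequence,
   while S is bounded and eventually constant on each component far from P.  The
   jumps of lim S are the jumps of theta. *)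

Require Import Defs.
From HB Require Import structures.
From mathcomp Require Import all_boot all_order all_algebra.
From mathcomp Require Import all_classical all_reals all_analysis.
From mathcomp Require Import measurable_realfun complex.
From mathcomp Require Import ring lra.

Set Implicit Arguments.
Unset Strict Implicit.
Unset Printing Implicit Defensive.

Import Order.TTheory GRing.Theory Num.Theory.
Import numFieldNormedType.Exports.

Local Open Scope classical_set_scope.
Local Open Scope ring_scope.

(** The obstacle is that no fixed domain carries a lifting for all [l], since the zeros of [u] move
    with [l]. The pair [H], [S] is defined on all of [0, 1] for every map, so both are sequences of
    functions on one interval: [H] is absolutely continuous across the bad points, and every
    discontinuity goes into [S]. Absolute continuity is handled through the identity f y - f x =
    int_x^y g, whose product and chain rules follow from an estimate of the error by the square of a
    mass. The threshold 1/4 keeps 1 / |u|^2 at most 4, and the climb of |u| from 1/2 to 3/4 is what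
    costs the fixed amount of energy. For the L^2 convergence of w, the error due to the modulus is
    at most a multiple of (|u|^2 - 1)^2, whose integral is O(eps); what remains is bounded and tends
    to 0 off P, so dominated convergence applies. The weak limit of h is built from elements of
    nearly minimal norm in the hulls of the tails, and is identified through its primitive, the
    limit of H. *)

(** * Real-valued integrals *)

Notation rintegrable D f :=
  ((@lebesgue_measure _).-integrable D (EFin \o f)).

Section RealIntegrals.
Variable R : realType.
Implicit Types (D E : set R) (f g : R -> R) (a b c : R).
Local Notation mu := (@lebesgue_measure R).

Lemma rintegrable_measurable D f : rintegrable D f -> measurable_fun D f.
Proof. by move=> /measurable_int/measurable_EFinP. Qed.

Lemma rintegrableD D f g : measurable D -> rintegrable D f ->
  rintegrable D g -> rintegrable D (fun x => f x + g x).
Proof. by move=> mD; exact: integrableD. Qed.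

Lemma rintegrableB D f g : measurable D -> rintegrable D f ->
  rintegrable D g -> rintegrable D (fun x => f x - g x).
Proof. by move=> mD; exact: integrableB. Qed.

Lemma rintegrableZ D f c : measurable D -> rintegrable D f ->
  rintegrable D (fun x => c * f x).
Proof. by move=> mD; exact: integrableZl. Qed.

Lemma rintegrable_norm D f : rintegrable D f -> rintegrable D (fun x => `|f x|).
Proof. exact: integrable_norm. Qed.

Lemma eq_rintegrable D f g : measurable D -> {in D, f =1 g} ->
  rintegrable D f -> rintegrable D g.
Proof.
by move=> mD fg; apply: eq_integrable => // x xD /=; rewrite fg.
Qed.

Lemma le_rintegrable D f g : measurable D -> measurable_fun D f ->
  (forall x, D x -> `|f x| <= g x) -> rintegrable D g -> rintegrable D f.
Proof.
move=> mD mf fg ig; apply: le_integrable ig => //.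
  exact/measurable_EFinP.
move=> x Dx /=; rewrite lee_fin (le_trans (fg _ Dx))//.
exact: ler_norm.
Qed.

Lemma rintegrableS D E f : measurable D -> measurable E -> D `<=` E ->
  rintegrable E f -> rintegrable D f.
Proof. by move=> mD mE DE; exact: integrableS. Qed.

Lemma rintegrable_bounded D f c : measurable D -> (mu D < +oo)%E ->
  measurable_fun D f -> (forall x, D x -> `|f x| <= c) -> rintegrable D f.
Proof.
move=> mD Doo mf fc; apply: measurable_bounded_integrable => //.
exists c; split; first exact: num_real.
by move=> M cM x Dx /=; rewrite (le_trans (fc _ Dx))// ltW.
Qed.

Lemma rintegrableM D f g c : measurable D -> measurable_fun D f ->
  (forall x, D x -> `|f x| <= c) -> rintegrable D g ->
  rintegrable D (fun x => f x * g x).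
Proof.
move=> mD mf fc ig; apply: (le_rintegrable (g := fun x => c * `|g x|)) => //.
- by apply: measurable_funM => //; exact: rintegrable_measurable.
- by move=> x Dx; rewrite normrM ler_wpM2r// fc.
- exact/rintegrableZ/rintegrable_norm.
Qed.

Lemma rintegrable_patch D f : measurable D ->
  rintegrable D f -> rintegrable setT (f \_ D).
Proof.
move=> mD If; rewrite -restrict_EFin.
by apply/integrable_restrict => //; rewrite setTI.
Qed.

Lemma Rintegral_supp D E f : measurable D -> measurable E -> D `<=` E ->
  (forall x, E x -> ~ D x -> f x = 0) ->
  \int[mu]_(x in E) f x = \int[mu]_(x in D) f x.
Proof.
move=> mD mE DE f0.
rewrite Rintegral_mkcond [RHS]Rintegral_mkcond; apply: eq_Rintegral => x _.
rewrite !patchE; case: ifPn => [|xE].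
  rewrite inE => xE; case: ifPn => // /negP; rewrite inE.
  exact: f0.
by case: ifPn => //; rewrite inE => /DE xE'; rewrite notin_setE in xE.
Qed.

Lemma le_norm_Rintegral D f g : measurable D -> rintegrable D f ->
  rintegrable D g -> (forall x, D x -> `|f x| <= g x) ->
  `|\int[mu]_(x in D) f x| <= \int[mu]_(x in D) g x.
Proof.
move=> mD If Ig fg; apply: le_trans (le_normr_Rintegral (mu := mu) mD If) _.
by apply: le_Rintegral => //; exact: rintegrable_norm.
Qed.

Lemma le_Rintegral_subset D E f : measurable D -> measurable E -> D `<=` E ->
  rintegrable E f -> (forall x, E x -> 0 <= f x) ->
  \int[mu]_(x in D) f x <= \int[mu]_(x in E) f x.
Proof.
move=> mD mE DE If f0; rewrite /Rintegral fine_le//.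
- by apply: integrable_fin_num => //; exact: rintegrableS If.
- exact: integrable_fin_num.
- apply: ge0_subset_integral => //.
  by move/measurable_int : If.
Qed.

Lemma Rintegral_cc_split a b c f : a <= b -> b <= c ->
  rintegrable `[a, c] f ->
  \int[mu]_(x in `[a, c]) f x =
  \int[mu]_(x in `[a, b]) f x + \int[mu]_(x in `[b, c]) f x.
Proof.
move=> ab bc If.
have Ibc : rintegrable `]b, c] f.
  by apply: rintegrableS If => //; apply: subset_itvr; rewrite bnd_simp.
have := Rintegral_itvB (a := BLeft a) (b := BRight c) (x := b) If.
rewrite !bnd_simp => /(_ ab bc); rewrite Rintegral_itv_obnd_cbnd// => <-.
by rewrite addrC subrK.
Qed.

Lemma Rintegral_cc_cst a b c : a <= b ->
  \int[mu]_(x in `[a, b]) c = c * (b - a).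
Proof.
move=> ab; rewrite Rintegral_cst//= lebesgue_measure_itv/= lte_fin.
by case: ltP ab => [//|ba ab]; rewrite (@le_anti _ _ a b) ?ab// subrr.
Qed.

(** Every function is measurable on a singleton and singletons are null, so the values of [f] at the
    endpoints are arbitrary. For [b <= a] the closed interval has at most one point. *)
Lemma rintegrable_oo_cc a b f : rintegrable `]a, b[ f -> rintegrable `[a, b] f.
Proof.
move=> If; have [ba|ab] := leP b a.
  apply: (@rintegrableS _ [set a]) => //.
    move=> x /=; rewrite in_itv/= => /andP[ax xb].
    by apply/eqP; rewrite eq_le ax (le_trans xb).
  apply/integrableP; split; last by rewrite integral_set1 ltry.
  by apply/measurable_EFinP; exact: measurable_fun_set1.
have m1 : measurable_fun `]a, b] f.
  rewrite -(setUitv1 true) ?bnd_simp//.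
  by rewrite measurable_funU//; split; [exact: rintegrable_measurable|exact: measurable_fun_set1].
have m2 : measurable_fun `[a, b] f.
  rewrite -(setU1itv false) ?bnd_simp ?(ltW ab)//.
  by rewrite measurable_funU//; split; [exact: measurable_fun_set1|].
apply/integrableP; split; first exact/measurable_EFinP.
have /integrableP[mf foo] := If.
have m3 : measurable_fun `]a, b] (fun x => `|f x|%:E).
  by apply/measurable_EFinP; exact: measurableT_comp.
have m4 : measurable_fun `]a, b[ (fun x => `|f x|%:E).
  by apply/measurable_EFinP; apply: measurableT_comp => //; exact: rintegrable_measurable.
by rewrite -integral_itv_obnd_cbnd// -integral_itv_bndo_bndc.
Qed.

Lemma Rintegral_oo_cc a b f : rintegrable `]a, b[ f ->
  \int[mu]_(x in `]a, b[) f x = \int[mu]_(x in `[a, b]) f x.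
Proof.
move=> If; have [ab|ba] := leP a b; last first.
  by rewrite !set_itv_ge ?Rintegral_set0// bnd_simp -?leNgt -?ltNge// ltW.
move: ab; rewrite le_eqVlt => /predU1P[<-|ab].
  by rewrite set_itvoo0 ?set_itv1 ?Rintegral_set0 ?Rintegral_set1.
rewrite Rintegral_itv_bndo_bndc// Rintegral_itv_obnd_cbnd//.
apply: (@rintegrableS _ `[a, b]) => //; last exact: rintegrable_oo_cc.
exact: subset_itv_oc_cc.
Qed.

Lemma continuous_rintegrable a b f : {within `[a, b], continuous f} ->
  rintegrable `[a, b] f.
Proof.
by move=> cf; apply: continuous_compact_integrable => //; exact: segment_compact.
Qed.

Lemma Rintegral_FTC2 a b f F : a <= b -> {within `[a, b], continuous f} ->
  (forall x : R, is_derive x 1 F (f x)) ->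
  \int[mu]_(x in `[a, b]) f x = F b - F a.
Proof.
move=> + cf dF; case: ltgtP => // [ab _|-> _]; last first.
  by rewrite set_itv1 Rintegral_set1 subrr.
rewrite /Rintegral (continuous_FTC2 ab cf (F := F))//.
  split.
  - by move=> x _; have [] := dF x.
  - apply: cvg_at_right_filter.
    by apply: differentiable_continuous; apply/derivable1_diffP; have [] := dF a.
  - apply: cvg_at_left_filter.
    by apply: differentiable_continuous; apply/derivable1_diffP; have [] := dF b.
by move=> x _; rewrite derive1E; have [_ ->] := dF x.
Qed.

Lemma continuous_measurable D f : measurable D -> continuous f ->
  measurable_fun D f.
Proof. by move=> mD cf; apply: measurable_funTS; exact: continuous_measurable_fun. Qed.

Lemma derive1_val f (x df : R) : is_derive x 1 f df -> derive1 f x = df.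
Proof. by case=> _ <-; rewrite derive1E. Qed.

Lemma measurable_EFin D f : measurable_fun D f ->
  measurable_fun D (fun x => (f x)%:E).
Proof. by move=> mf; exact/measurable_EFinP. Qed.

Lemma measurable_fun_if_on D f g (b : R -> bool) : measurable D ->
  measurable_fun D b -> measurable_fun D f -> measurable_fun D g ->
  measurable_fun D (fun x => if b x then f x else g x).
Proof.
move=> mD mb mf mg; apply: measurable_fun_if => //.
- by apply: measurable_funS mf => //; exact: subIsetl.
- by apply: measurable_funS mg => //; exact: subIsetl.
Qed.

Lemma dominated_Rintegral D (f_ : nat -> R -> R) f g : measurable D ->
  (forall n, measurable_fun D (f_ n)) -> measurable_fun D f ->
  (forall x, D x -> (f_ ^~ x) @ \oo --> f x) ->
  rintegrable D g -> (forall n x, D x -> `|f_ n x| <= g x) ->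
  (fun n => \int[mu]_(x in D) f_ n x) @ \oo --> \int[mu]_(x in D) f x.
Proof.
move=> mD mf_ mf ff Ig fg.
have mf_' n : measurable_fun D (EFin \o f_ n) by exact/measurable_EFinP.
have [|||||If _] := @dominated_convergence _ _ _ mu D mD
  (fun n => EFin \o f_ n) (EFin \o f) (EFin \o g).
- exact: mf_'.
- exact/measurable_EFinP.
- apply: aeW => x Dx; apply/fine_cvgP; split; first exact: nearW.
  exact: ff.
- exact: Ig.
- by apply: aeW => x n Dx /=; rewrite lee_fin fg.
move=> cv; apply: fine_cvg; rewrite fineK; last exact: integrable_fin_num.
exact: cv.
Qed.

End RealIntegrals.

(** * Smooth cut-off functions *)

(** The recursion is on the derivative, so closure under sums, products and affine changes of
    variable is one induction on [n], with no formula for higher derivatives. *)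
Fixpoint differentiable_upto (R : realType) n (f : R -> R) : Prop :=
  if n is m.+1 then
    (forall x, derivable f x 1) /\ differentiable_upto m (derive1 f)
  else True.

Definition smooth (R : realType) (f : R -> R) :=
  forall n, differentiable_upto n f.

Section Smooth.
Variable R : realType.
Implicit Types (f g : R -> R) (p : {poly R}).
Local Notation mu := (@lebesgue_measure R).

Lemma smooth_derivable1n f : smooth f ->
  forall n x, derivable (derive1n n f) x 1.
Proof.
move=> + n; elim: n f => [|n IH] f sf x; first by have [] := sf 1.
rewrite /derive1n iterSr; apply: IH => m.
by have [] := sf m.+1.
Qed.

Lemma differentiable_uptoS n f :
  differentiable_upto n.+1 f -> differentiable_upto n f.
Proof.
elim: n f => [|n IH] f //= [df [df' sf]]; split => //.
by apply: IH; split.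
Qed.

Lemma differentiable_uptoD n f g : differentiable_upto n f ->
  differentiable_upto n g -> differentiable_upto n (fun x => f x + g x).
Proof.
elim: n f g => [|n IH] f g //= [df sf] [dg sg].
split; first by move=> x; exact: derivableD.
rewrite (_ : derive1 _ = fun x => (derive1 f) x + (derive1 g) x); first exact: IH.
by apply/funext => x; rewrite !derive1E deriveD.
Qed.

Lemma differentiable_uptoM n f g : differentiable_upto n f ->
  differentiable_upto n g -> differentiable_upto n (fun x => f x * g x).
Proof.
elim: n f g => [|n IH] f g sf sg //; have [df sf'] := sf; have [dg sg'] := sg.
split; first by move=> x; exact: derivableM.
rewrite (_ : derive1 _ = fun x => (derive1 f) x * g x + f x * (derive1 g) x).
  by apply: differentiable_uptoD; apply: IH => //; exact: differentiable_uptoS.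
apply/funext => x; rewrite !derive1E deriveM// addrC.
by congr (_ + _); rewrite /GRing.scale/= mulrC.
Qed.

Lemma derive1_affine f a b x : derivable f (a * x + b) 1 ->
  is_derive x 1 (fun x => f (a * x + b)) (a * (derive1 f) (a * x + b)).
Proof.
move=> df.
have d1 : is_derive x 1 (fun x : R => a * x + b) a.
  apply: is_derive_eq.
  rewrite /GRing.scale/=; ring.
rewrite mulrC derive1E.
apply: (@is_derive1_comp _ f (fun x => a * x + b)).
exact: DeriveDef.
Qed.

Lemma differentiable_upto_cst n (c : R) : differentiable_upto n (fun=> c).
Proof.
elim: n c => [//|n IH] c /=; split=> [x|]; first exact: derivable_cst.
rewrite (_ : derive1 _ = fun=> 0) //; apply/funext => x.
by rewrite derive1_cst.
Qed.

Lemma differentiable_upto_affine n f a b : differentiable_upto n f ->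
  differentiable_upto n (fun x => f (a * x + b)).
Proof.
elim: n f => [|n IH] f //= [df sf]; split.
  by move=> x; have [] := derive1_affine (df (a * x + b)).
rewrite (_ : derive1 _ = fun x => a * (derive1 f) (a * x + b)).
  by apply: differentiable_uptoM; [exact: differentiable_upto_cst|exact: IH].
by apply/funext => x; rewrite derive1E; have [_ ->] := derive1_affine (df (a * x + b)).
Qed.

(** Carrying the polynomial [p] makes these flat functions stable under differentiation, so that
    their smoothness is an induction over all [p] at once. *)
Definition flat p (x : R) : R := if 0 < x then p.[x^-1] * expR (- x^-1) else 0.

(** Each monomial satisfies y^i <= i! e^y, by the expansion of the exponential; the witness collects
    these bounds. *)
Lemma bounded_horner_expRN p :
  exists C : R, forall y : R, 0 <= y -> `|p.[y] * expR (- y)| <= C.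
Proof.
exists (\sum_(i < size p) `|p`_i| * i`!%:R) => y y0.
rewrite horner_coef mulr_suml (le_trans (ler_norm_sum _ _ _))//.
apply: ler_sum => i _; rewrite !normrM -mulrA ler_wpM2l//.
rewrite (ger0_norm (expR_ge0 _)) normrX (ger0_norm y0).
rewrite expRN ler_pdivrMr ?expR_gt0//.
case: (nat_of_ord i) => [|k].
  by rewrite expr0 fact0 mul1r (le_trans _ (expR_ge1Dx _))// lerDl.
rewrite -ler_pdivrMl ?ltr0n ?fact_gt0// mulrC.
by rewrite (le_trans _ (expR_ge1Dxn k y0))// lerDr.
Qed.

(** Dividing [flat p] by x^2 gives [flat (p * 'X^2)], which is bounded. A quadratic bound is what
    makes the derivative at 0 exist and vanish. *)
Lemma flat_quadratic p : exists C : R, forall x : R, `|flat p x| <= C * x ^+ 2.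
Proof.
have [C hC] := bounded_horner_expRN (p * 'X^2).
have C0 : 0 <= C by apply: le_trans (hC 0 (lexx _)).
exists C => x; rewrite /flat; case: ifPn => [x0|_]; last first.
  by rewrite normr0 mulr_ge0// sqr_ge0.
have x20 : 0 < x ^+ 2 by rewrite exprn_gt0.
rewrite -ler_pdivrMr//; apply: le_trans (hC x^-1 _); last by rewrite invr_ge0 ltW.
have nx : `|(x^-1 : R) ^+ 2| = x^-1 ^+ 2 by rewrite ger0_norm ?exprn_ge0// invr_ge0 ltW.
by rewrite hornerM hornerXn mulrAC [in leRHS]normrM nx exprVn.
Qed.

Lemma is_derive0_quadratic f C : f 0 = 0 ->
  (forall x, `|f x| <= C * x ^+ 2) -> is_derive (0 : R) 1 f 0.
Proof.
move=> f0 fC.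
have C0 : 0 <= C by have := fC 1; rewrite expr1n mulr1; exact: le_trans.
have cv : h^-1 *: (f (h *: (1 : R) + 0) - f 0) @[h --> 0^'] --> (0 : R).
  apply/cvgr0Pnorm_le => e e0.
  have d0 : 0 < e / (C + 1) by rewrite divr_gt0// ltr_wpDl.
  near=> h.
  have hn0 : h != 0 by near: h; exact: nbhs_dnbhs_neq.
  rewrite f0 subr0 addr0 /GRing.scale/= mulr1 normrM normfV.
  rewrite ler_pdivrMl ?normr_gt0//; apply: (le_trans (fC _)).
  rewrite -normr_id -(real_normK (num_real h)) normr_id expr2 mulrA mulrC ler_wpM2l//.
  have : `|h| <= e / (C + 1) by near: h; exact: dnbhs0_le.
  rewrite ler_pdivlMr ?ltr_wpDl// mulrC => he; apply: le_trans he.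
  by rewrite ler_wpM2r// lerDl.
by apply: DeriveDef; [apply/cvg_ex; exists 0 | exact/cvg_lim].
Unshelve. all: by end_near. Qed.

Lemma is_derive_flat p (x : R) : is_derive x 1 (flat p) (flat ('X^2 * (p - p^`()%R)) x).
Proof.
have [x0|x0|->] := ltgtP x 0.
- rewrite {2}/flat ltNge (ltW x0)/=.
  apply: (near_eq_is_derive (f := cst 0)) => //.
  near=> y; rewrite /flat ltNge.
  suff /ltW -> : y < 0 by [].
  by near: y; exact: lt_nbhsl.
- rewrite {2}/flat x0.
  have xn0 : x != 0 by rewrite gt_eqF.
  apply: (near_eq_is_derive (f := fun y : R => p.[y^-1] * expR (- y^-1))); last first.
  + have dV : is_derive x (1:R) (fun y : R => y^-1) (- x ^- 2).
      apply: (is_derive_eq (is_deriveV _ _)) => //.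
      by rewrite /GRing.scale/= mulr1.
    have dp : is_derive x (1:R) (fun y : R => p.[y^-1]) (p^`()%R.[x^-1] * - x ^- 2).
      exact: (@is_derive1_comp _ (horner p) (fun y : R => y^-1)).
    have de : is_derive x (1:R) (fun y : R => expR (- y^-1)) (expR (- x^-1) * x ^- 2).
      apply: (@is_derive1_comp _ expR (fun y : R => - y^-1)).
      by apply: is_derive_eq; rewrite opprK.
    apply: is_derive_eq; rewrite /GRing.scale/= hornerM hornerXn hornerD hornerN.
    by field.
  + near=> y; rewrite /flat.
    suff -> : 0 < y by [].
    by near: y; exact: lt_nbhsr.
- rewrite {2}/flat ltxx.
  have [C hC] := flat_quadratic p.
  by apply: is_derive0_quadratic hC; rewrite /flat ltxx.
Unshelve. all: by end_near. Qed.

Lemma smooth_flat p : smooth (flat p).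
Proof.
move=> n; elim: n p => [|n IH] p //=; split.
  by move=> x; have [] := is_derive_flat p x.
rewrite (_ : derive1 _ = flat ('X^2 * (p - p^`()%R))); first exact: IH.
by apply/funext => x; rewrite derive1E; have [_ ->] := is_derive_flat p x.
Qed.

Definition bump (x : R) := flat 1 x * flat 1 (1 - x).

Lemma flat1_ge0 x : 0 <= flat 1 x.
Proof. by rewrite /flat; case: ifP => // _; rewrite hornerC mul1r expR_ge0. Qed.

Lemma bump_ge0 x : 0 <= bump x.
Proof. by rewrite mulr_ge0// flat1_ge0. Qed.

Lemma bump_gt0 x : 0 < x < 1 -> 0 < bump x.
Proof.
move=> /andP[x0 x1]; rewrite /bump /flat x0 subr_gt0 x1 !hornerC !mul1r.
by rewrite mulr_gt0// expR_gt0.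
Qed.

Lemma bump_eq0 x : ~~ (0 < x < 1) -> bump x = 0.
Proof.
rewrite negb_and /bump /flat subr_gt0 => /orP[/negbTE->|/negbTE->].
  by rewrite mul0r.
by rewrite mulr0.
Qed.

Lemma smooth_bump : smooth bump.
Proof.
move=> n; apply: differentiable_uptoM; first exact: smooth_flat.
rewrite (_ : (fun x => _) = fun x => flat 1 (-1 * x + 1)).
  exact: (differentiable_upto_affine _ _ (smooth_flat 1 n)).
by apply/funext => x; rewrite mulN1r addrC.
Qed.

Lemma continuous_bump : continuous bump.
Proof.
move=> x; have [+ _] := smooth_bump 1 => /(_ x).
by move=> /derivable1_diffP/differentiable_continuous.
Qed.

Lemma bump_rintegrable (D : set R) : measurable D -> rintegrable D bump.
Proof.
move=> mD; apply: (@rintegrableS _ _ setT) => //.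
have -> : bump = bump \_ `[0, 1]%classic.
  apply/funext => x; rewrite patchE; case: ifPn => // /negP xI.
  rewrite bump_eq0//; apply/negP => /andP[x0 x1]; apply: xI.
  by rewrite inE/= in_itv/= !ltW.
have : rintegrable (setT `&` `[0, 1]%classic) bump.
  rewrite setTI; apply: continuous_rintegrable.
  exact/continuous_subspaceT/continuous_bump.
by move/(integrable_restrict mu); rewrite restrict_EFin; exact.
Qed.

(** A smooth transition from 0 on the negative half-line to 1 beyond 1. Integrating from -oo gives
    one formula for every [x]. *)
Definition step (x : R) : R :=
  (\int[mu]_(t in `]-oo, x]) bump t) / (\int[mu]_(t in `]-oo, 1%R]) bump t).

Let is_derive_int_bump (x : R) :
  is_derive x 1 (fun x => \int[mu]_(t in `]-oo, x]) bump t) (bump x).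
Proof.
have [|d1 d2] := @continuous_FTC1 R bump -oo%O x (x + 1)
  (ltr_pwDr ltr01 (lexx x)) (bump_rintegrable (measurable_itv _)) _
  (continuous_bump (x := x)).
  by rewrite ltNyr.
by apply: DeriveDef; [exact: d1|rewrite -derive1E d2].
Qed.

Let int_bump_le0 (x : R) : x <= 0 -> \int[mu]_(t in `]-oo, x]) bump t = 0.
Proof.
move=> x0; rewrite (@Rintegral_supp _ set0)// ?Rintegral_set0// => t /=.
rewrite in_itv/= => tx _; rewrite bump_eq0// negb_and -!leNgt.
by rewrite (le_trans tx).
Qed.

Let int_bump1_gt0 : 0 < \int[mu]_(t in `]-oo, 1%R]) bump t.
Proof.
pose F (x : R) := \int[mu]_(t in `]-oo, x]) bump t.
have cF : continuous F.
  move=> x; apply: differentiable_continuous; apply/derivable1_diffP.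
  by have [] := is_derive_int_bump x.
(* The mean value theorem turns the total mass into a value of [bump] inside (0, 1), which is
   positive. *)
have [x x01 e] := @MVT R F bump 0 1 ltr01 (fun x _ => is_derive_int_bump x)
  (continuous_subspaceT cF).
move: e; rewrite /F [X in _ - X]int_bump_le0// !subr0 mulr1 => ->.
by apply: bump_gt0; move: x01; rewrite in_itv.
Qed.

Lemma is_derive_step (x : R) : is_derive x 1 step
  (bump x / \int[mu]_(t in `]-oo, 1%R]) bump t).
Proof.
pose c := (\int[mu]_(t in `]-oo, 1%R]) bump t)^-1.
have -> : step = fun x => c * (\int[mu]_(t in `]-oo, x]) bump t).
  by apply/funext => y; rewrite mulrC.
rewrite mulrC; exact: (is_deriveZ c (is_derive_int_bump x)).
Qed.

Lemma derive1_step : derive1 step =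
  fun x => bump x / \int[mu]_(t in `]-oo, 1%R]) bump t.
Proof.
by apply/funext => x; rewrite derive1E; have [_ ->] := is_derive_step x.
Qed.

Lemma smooth_step : smooth step.
Proof.
move=> [//|n]; split; first by move=> x; have [] := is_derive_step x.
rewrite derive1_step; apply: differentiable_uptoM; first exact: smooth_bump.
exact: differentiable_upto_cst.
Qed.

Lemma step_le0 x : x <= 0 -> step x = 0.
Proof. by move=> x0; rewrite /step int_bump_le0// mul0r. Qed.

Lemma step_ge1 x : 1 <= x -> step x = 1.
Proof.
move=> x1; rewrite /step (@Rintegral_supp _ `]-oo, 1] `]-oo, x])//.
- by rewrite divff// gt_eqF.
- by apply: subset_itvl; rewrite bnd_simp.
- move=> t _ /=; rewrite in_itv/= => /negP; rewrite -ltNge => t1.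
  by rewrite bump_eq0// negb_and orbC -leNgt ltW.
Qed.

Lemma derive1_step_ge0 x : 0 <= derive1 step x.
Proof. by rewrite derive1_step divr_ge0 ?bump_ge0// ltW. Qed.

Lemma step_homo : {homo step : x y / x <= y}.
Proof.
move=> x y xy; apply: ler_wpM2r; first by rewrite invr_ge0 ltW.
apply: le_Rintegral_subset => //.
- by apply: subset_itvl; rewrite bnd_simp.
- exact: bump_rintegrable.
- by move=> t _; exact: bump_ge0.
Qed.

Lemma continuous_derive1_step : continuous (derive1 step).
Proof.
move=> x; have [_ [+ _]] := smooth_step 2 => /(_ x).
by move=> /derivable1_diffP/differentiable_continuous.
Qed.

Lemma derive1_step_eq0 x : ~~ (0 < x < 1) -> derive1 step x = 0.
Proof. by move=> x01; rewrite derive1_step bump_eq0// mul0r. Qed.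

End Smooth.

(** * Cut-offs as tests for weak derivatives *)

Section Cutoff.
Variable R : realType.
Implicit Types (f g : R -> R) (a k t x y e v : R) (D Om : set R).
Local Notation mu := (@lebesgue_measure R).

(** When k (y - x) >= 1, it rises from 0 to 1 on [x, x + 1/k] and falls back on [y - 1/k, y]; the +
    1 keeps the descent inside [x, y]. *)
Definition cutoff k x y t := step (k * (t - x)) - step (k * (t - y) + 1).

(** An approximate Dirac mass on [a, a + 1/k]; the derivative of a cutoff is the difference of two
    of them. *)
Definition mollifier k a t := k * derive1 (@step R) (k * (t - a)).

Let is_derive_step_affine k a b t :
  is_derive t 1 (fun t => step (k * (t - a) + b))
    (k * derive1 (@step R) (k * (t - a) + b)).
Proof.
have -> : (fun t => step (k * (t - a) + b)) =
    fun t => step (k * t + (b - k * a)).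
  by apply/funext => u; congr step; ring.
have -> : k * (t - a) + b = k * t + (b - k * a) by ring.
by apply: derive1_affine; have [+ _] := smooth_step R 1; exact.
Qed.

Lemma is_derive_step_mollifier k a t :
  is_derive t 1 (fun t => step (k * (t - a))) (mollifier k a t).
Proof.
have := is_derive_step_affine k a 0 t; rewrite /mollifier addr0.
by under eq_fun do rewrite addr0.
Qed.

Lemma is_derive_cutoff k x y t : k != 0 ->
  is_derive t 1 (cutoff k x y)
    (mollifier k x t - mollifier k (y - k^-1) t).
Proof.
move=> k0; apply: is_deriveB; first exact: is_derive_step_mollifier.
have := is_derive_step_affine k y 1 t.
rewrite /mollifier; congr (is_derive _ _ _ (k * derive1 _ _)).
by field.
Qed.

Lemma mollifier_ge0 k a t : 0 < k -> 0 <= mollifier k a t.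
Proof. by move=> k0; rewrite mulr_ge0 ?derive1_step_ge0// ltW. Qed.

Lemma mollifier_eq0 k a t : 0 < k -> t \notin `[a, a + k^-1] ->
  mollifier k a t = 0.
Proof.
move=> k0 ta; rewrite /mollifier derive1_step_eq0 ?mulr0//.
apply: contra ta => /andP[]; rewrite pmulr_rgt0// subr_gt0 => at_.
rewrite -ltr_pdivlMl// mulr1 ltrBlDl => tk.
by rewrite in_itv/= !ltW.
Qed.

Lemma continuous_mollifier k a : continuous (mollifier k a).
Proof.
move=> t; apply: cvgM; first exact: cvg_cst.
apply: (@continuous_comp _ _ _ (fun t => k * (t - a)) (derive1 (@step R))).
  by apply: cvgM; [exact: cvg_cst|apply: cvgB; [exact: cvg_id|exact: cvg_cst]].
exact: continuous_derive1_step.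
Qed.

Lemma measurable_mollifier k a (D : set R) : measurable D ->
  measurable_fun D (mollifier k a).
Proof.
by move=> mD; apply: continuous_measurable => //; exact: continuous_mollifier.
Qed.

Lemma int_mollifier k a : 0 < k ->
  \int[mu]_(t in `[a, a + k^-1]) mollifier k a t = 1.
Proof.
move=> k0; have -> := @Rintegral_FTC2 _ _ _ _ (fun t => step (k * (t - a)))
  _ _ (is_derive_step_mollifier k a).
- by rewrite subrr mulr0 addrAC subrr add0r divff ?gt_eqF// step_ge1// step_le0// subr0.
- by rewrite lerDl invr_ge0 ltW.
- exact/continuous_subspaceT/continuous_mollifier.
Qed.

Lemma mollifier_bounded k a : exists M, forall t, `|mollifier k a t| <= M.
Proof.
have /compact_bounded[M [_ hM]] := continuous_compact (continuous_subspaceT (@continuous_derive1_step R)) (@segment_compact R 0 1).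
exists (`|k| * (`|M| + 1)) => t; rewrite normrM ler_wpM2l//.
have [t01|t01] := boolP (0 < k * (t - a) < 1).
  apply: (hM (`|M| + 1)); first by rewrite (le_lt_trans (ler_norm _))// ltrDl.
  exists (k * (t - a)) => //=; rewrite in_itv/=.
  by case/andP : t01 => /ltW -> /ltW ->.
by rewrite derive1_step_eq0// normr0 addr_ge0.
Qed.

Lemma rintegrable_mul_mollifier D f k a : measurable D -> rintegrable D f ->
  rintegrable D (fun t => f t * mollifier k a t).
Proof.
move=> mD If; have [M hM] := mollifier_bounded k a.
under eq_fun do rewrite mulrC.
by apply: (@rintegrableM _ _ _ _ M) => //; exact: measurable_mollifier.
Qed.

(** The mollifier is nonnegative with mass one, so the integral is an average of the values of [f]
    just to the right of [a]. *)
Lemma mollifier_approx D f k a e v : 0 < k -> measurable D ->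
  `[a, a + k^-1]%classic `<=` D -> rintegrable D f ->
  (forall t, t \in `[a, a + k^-1] -> `|f t - v| <= e) ->
  `|\int[mu]_(t in D) (f t * mollifier k a t) - v| <= e.
Proof.
move=> k0 mD aD If fv; set I := `[a, a + k^-1]%classic.
have mI : measurable I by exact: measurable_itv.
have IIf : rintegrable I f by apply: rintegrableS If.
have Im : rintegrable I (mollifier k a).
  exact/continuous_rintegrable/continuous_subspaceT/continuous_mollifier.
have Ifm := rintegrable_mul_mollifier k a mI IIf.
rewrite (@Rintegral_supp _ I)//; last first.
  by move=> t _ /negP tI; rewrite mollifier_eq0 ?mulr0.
rewrite -[v in X in `|X|]mulr1 -(int_mollifier a k0) -RintegralZl//.
rewrite -RintegralB//; last exact: rintegrableZ.
rewrite -[leRHS]mulr1 -(int_mollifier a k0) -RintegralZl//.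
apply: le_norm_Rintegral => //.
- by apply: rintegrableB => //; exact: rintegrableZ.
- exact: rintegrableZ.
- move=> t It; rewrite -mulrBl normrM (ger0_norm (mollifier_ge0 _ _ k0)).
  by rewrite ler_wpM2r ?mollifier_ge0// fv.
Qed.

Lemma step_ge0 x : 0 <= step x.
Proof.
have [x0|/ltW x0] := leP x 0; first by rewrite step_le0.
by rewrite -(step_le0 (lexx 0)) step_homo.
Qed.

Lemma step_le1 x : step x <= 1.
Proof.
have [x0|/ltW x0] := leP 1 x; first by rewrite step_ge1.
by rewrite -(step_ge1 (lexx 1)) step_homo.
Qed.

Lemma cutoff_le1 k x y t : cutoff k x y t <= 1.
Proof. by rewrite lerBlDr ler_wpDr ?step_ge0 ?step_le1. Qed.

Lemma cutoff_eq0 k x y t : 0 < k -> 1 <= k * (y - x) -> t \notin `]x, y[ ->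
  cutoff k x y t = 0.
Proof.
move=> k0 kyx; rewrite in_itv/= negb_and -!leNgt => /orP[tx|yt].
  rewrite /cutoff !step_le0 ?subrr//.
    have -> : k * (t - y) + 1 = k * (t - x) + (1 - k * (y - x)) by ring.
    by rewrite -[leRHS]addr0 lerD ?subr_le0// pmulr_rle0// subr_le0.
  by rewrite pmulr_rle0// subr_le0.
rewrite /cutoff !step_ge1 ?subrr//.
  by rewrite lerDr pmulr_rge0// subr_ge0.
by rewrite (le_trans kyx)// ler_wpM2l ?(ltW k0)// lerD2r.
Qed.

Lemma cutoff_test k x y Om : 0 < k -> 1 <= k * (y - x) ->
  `[x, y]%classic `<=` Om -> test_function Om (cutoff k x y).
Proof.
move=> k0 kyx xyO.
have cxy : closure [set t | cutoff k x y t != 0] `<=` `[x, y]%classic.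
  rewrite [X in _ `<=` X](closure_id _).1; last exact: interval_closed.
  apply: closureS => t /= /eqP ct; apply: contrapT => /negP tI.
  apply: ct; apply: cutoff_eq0 => //; apply: contra tI.
  exact: subset_itv_oo_cc.
split.
- apply: smooth_derivable1n => n.
  rewrite (_ : cutoff _ _ _ = fun t => step (k * t + - (k * x)) +
      (-1) * step (k * t + (1 - k * y))).
    apply: differentiable_uptoD.
      by apply: differentiable_upto_affine; exact: smooth_step.
    apply: differentiable_uptoM; first exact: differentiable_upto_cst.
    by apply: differentiable_upto_affine; exact: smooth_step.
  apply/funext => t; rewrite mulN1r; congr (step _ - step _); ring.
- apply: subclosed_compact cxy; last exact: segment_compact.
  exact: closed_closure.
- exact: subset_trans xyO.
Qed.

Lemma cvg_cutoff x y t : x < t < y -> cutoff n%:R x y t @[n --> \oo] --> (1 : R).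
Proof.
move=> /andP[xt ty].
apply: cvg_near_cst; near=> n; rewrite /cutoff step_ge1 ?step_le0 ?subr0//.
  have : (y - t)^-1 <= n%:R by near: n; exact: nbhs_infty_ger.
  rewrite -[X in X <= _ -> _]mul1r ler_pdivrMr ?subr_gt0// => h.
  by rewrite -opprB mulrN addrC subr_le0.
have : (t - x)^-1 <= n%:R by near: n; exact: nbhs_infty_ger.
by rewrite -[X in X <= _ -> _]mul1r ler_pdivrMr ?subr_gt0.
Unshelve. all: by end_near. Qed.

Lemma continuous_cutoff k x y : continuous (cutoff k x y).
Proof.
have cs a b : continuous (fun t => step (k * (t - a) + b)).
  move=> t; apply: differentiable_continuous; apply/derivable1_diffP.
  by have [] := is_derive_step_affine k a b t.
move=> t; apply: cvgB; last exact: cs.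
have := cs x 0 t.
by under eq_fun do rewrite addr0.
Qed.

Lemma cvg_int_cutoff Om g x y : measurable Om -> rintegrable Om g ->
  x < y -> `[x, y]%classic `<=` Om ->
  (fun n => \int[mu]_(t in Om) (g t * cutoff n%:R x y t)) @ \oo -->
  \int[mu]_(t in `[x, y]) g t.
Proof.
move=> mO Ig xy xyO.
have Ig' : rintegrable `]x, y[ g.
  by apply: rintegrableS Ig => //; apply: subset_trans xyO; exact: subset_itv_oo_cc.
rewrite -Rintegral_oo_cc//.
have mc n : measurable_fun `]x, y[ (cutoff n%:R x y).
  by apply: continuous_measurable => //; exact: continuous_cutoff.
have c1 n t : `|cutoff n%:R x y t| <= 1.
  rewrite ler_norml cutoff_le1 andbT lerBrDl.
  by rewrite (le_trans _ (step_ge0 _))// subr_le0 step_le1.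
have : (fun n => \int[mu]_(t in `]x, y[) (g t * cutoff n%:R x y t)) @ \oo -->
    \int[mu]_(t in `]x, y[) g t.
  apply: (dominated_Rintegral (g := fun t => `|g t|)) => //.
  - by move=> n; apply: measurable_funM => //; exact: rintegrable_measurable.
  - exact: rintegrable_measurable.
  - move=> t /=; rewrite in_itv/= => txy; rewrite -[X in _ --> X]mulr1.
    by apply: cvgM; [exact: cvg_cst|exact: cvg_cutoff].
  - exact: rintegrable_norm.
  - by move=> n t _; rewrite normrM ler_piMr.
apply: cvg_trans; apply: near_eq_cvg; near=> n.
apply/esym; apply: Rintegral_supp => //.
  by apply: subset_trans xyO; exact: subset_itv_oo_cc.
move=> t _ /negP txy; rewrite cutoff_eq0 ?mulr0//.
  by rewrite ltr0n; near: n; exists 1%N.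
rewrite -ler_pdivrMr ?subr_gt0// mul1r.
by near: n; exact: nbhs_infty_ger.
Unshelve. all: by end_near. Qed.

(** Testing with [cutoff n%:R x y] turns the left side of the weak formulation into an average of
    [f] near [x] minus one near [y], and the right side tends to the negated integral of [g] over
    [x, y]. *)
Lemma weak_derivative_primitive Om f g x y : measurable Om ->
  rintegrable Om f -> rintegrable Om g -> weak_derivative Om f g ->
  x < y -> `[x, y]%classic `<=` Om ->
  {for x, continuous f} -> {for y, continuous f} ->
  f y - f x = \int[mu]_(t in `[x, y]) g t.
Proof.
move=> mO If Ig wfg xy xyO cx cy.
have close e : 0 < e -> \forall n \near \oo,
    `|\int[mu]_(t in Om) (g t * cutoff n%:R x y t) - (f y - f x)| <= e.
  move=> e0; have e20 : 0 < e / 2 by rewrite divr_gt0.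
  have /nbhs_ballP[d1 /= d10 h1] : \forall t \near x, `|f t - f x| <= e / 2.
    by move/cvgr_dist_le: cx => /(_ _ e20); apply: filterS => t; rewrite distrC.
  have /nbhs_ballP[d2 /= d20 h2] : \forall t \near y, `|f t - f y| <= e / 2.
    by move/cvgr_dist_le: cy => /(_ _ e20); apply: filterS => t; rewrite distrC.
  near=> n; set k : R := n%:R.
  have k0 : 0 < k by rewrite ltr0n; near: n; exists 1%N.
  have kN0 : k != 0 by rewrite gt_eqF.
  have kxy : k^-1 <= y - x.
    rewrite -[leRHS]invrK lef_pV2 ?posrE ?invr_gt0 ?subr_gt0//.
    by rewrite /k; near: n; exact: nbhs_infty_ger.
  have kd1 : k^-1 < d1.
    rewrite -[ltRHS]invrK ltf_pV2 ?posrE ?invr_gt0//.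
    by rewrite /k; near: n; exact: nbhs_infty_gtr.
  have kd2 : k^-1 < d2.
    rewrite -[ltRHS]invrK ltf_pV2 ?posrE ?invr_gt0//.
    by rewrite /k; near: n; exact: nbhs_infty_gtr.
  have kyx : 1 <= k * (y - x) by rewrite -ler_pdivrMl// mulr1.
  have sub a : x <= a -> a + k^-1 <= y -> `[a, a + k^-1]%classic `<=` Om.
    move=> xa ay; apply: subset_trans xyO; apply: subset_itv; by rewrite bnd_simp.
  have sx : `[x, x + k^-1]%classic `<=` Om.
    by apply: sub => //; rewrite -lerBrDl.
  have sy : `[y - k^-1, (y - k^-1) + k^-1]%classic `<=` Om.
    by apply: sub; rewrite ?subrK// lerBrDr -lerBrDl.
  have := wfg _ (cutoff_test k0 kyx xyO).
  under eq_Rintegral => t _ do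
    rewrite (derive1_val (is_derive_cutoff x y t kN0)) mulrBr.
  rewrite RintegralB//; [|exact: rintegrable_mul_mollifier..].
  move=> /esym/eqP; rewrite eqr_oppLR opprB => /eqP ->.
  have b1 : `|\int[mu]_(t in Om) (f t * mollifier k x t) - f x| <= e / 2.
    apply: mollifier_approx => // t; rewrite in_itv/= => /andP[xt tk].
    apply: h1; rewrite /ball/= ltr_distlC (lt_le_trans _ xt) ?ltrBlDr ?ltrDl//=.
    by rewrite (le_lt_trans tk)// ltrD2l.
  have b2 : `|\int[mu]_(t in Om) (f t * mollifier k (y - k^-1) t) - f y| <= e / 2.
    apply: mollifier_approx => // t; rewrite in_itv/= subrK => /andP[yt ty].
    apply: h2; rewrite /ball/= ltr_distlC (le_lt_trans ty) ?ltrDl//= andbT.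
    by rewrite (lt_le_trans _ yt)// ltrD2l ltrN2.
  have tri (p q fx fy h : R) : `|p - fx| <= h -> `|q - fy| <= h ->
      `|q - p - (fy - fx)| <= h + h by rewrite !ler_norml; lra.
  by rewrite [leRHS]splitr tri.
have c1 := cvg_int_cutoff mO Ig xy xyO.
apply/esym/(cvg_unique _ c1) => //.
by apply/cvgrPdist_le => e /close; apply: filterS => n; rewrite distrC.
Unshelve. all: by end_near. Qed.

(** The primitive of [g] extended by 0 is constant near each point of [Om], and Lebesgue
    differentiation recovers [g] from it almost everywhere. *)
Lemma int_itv_eq0_ae Om g : open Om -> rintegrable Om g ->
  (forall x y, x < y -> `[x, y]%classic `<=` Om ->
    \int[mu]_(t in `[x, y]) g t = 0) ->
  {ae mu, forall x, Om x -> g x = 0}.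
Proof.
move=> oO Ig g0; have mO := open_measurable oO.
have Ih : rintegrable setT (g \_ Om).
  exact: rintegrable_patch.
have := FTC1Ny (fun y => rintegrableS (measurable_itv _) (measurableT) (@subsetT _ _) Ih)
  (open_integrable_locally (@openT R) Ih).
apply: filterS; first exact: (ae_filter_ringOfSetsType mu).
move=> x [_ Fx] Ox.
have [d /= d0 dO] : nbhs_ball x Om by apply/nbhs_ballP; move: oO; rewrite openE; exact.
have Fxy y z : x - d < y -> y < z -> z < x + d ->
    \int[mu]_(t in `]-oo, z]) (g \_ Om) t = \int[mu]_(t in `]-oo, y]) (g \_ Om) t.
  move=> xy yz zx; apply/eqP; rewrite -subr_eq0 Rintegral_itvB//=; last 2 first.
  - by apply: rintegrableS Ih.
  - by rewrite bnd_simp ltW.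
  have sub : `[y, z]%classic `<=` Om.
    move=> t /=; rewrite in_itv/= => /andP[yt tz]; apply: dO.
    rewrite /ball/= ltr_distlC (lt_le_trans xy yt)/= (le_lt_trans tz)//.
  rewrite Rintegral_itv_obnd_cbnd; last by apply: rintegrableS Ih.
  rewrite -(g0 _ _ yz sub); apply/eqP; apply: eq_Rintegral => t tyz.
  by rewrite patchE mem_set//; apply: sub; rewrite -inE.
move: Fx; rewrite patchE mem_set// => <-.
rewrite -(derive1_cst (\int[mu]_(t in `]-oo, x]) (g \_ Om) t : R) x) !derive1E.
apply: near_eq_derive; near=> y.
have /andP[xy yx] : x - d < y < x + d.
  by rewrite -ltr_distlC; near: y; apply/nbhs_ballP; exists d.
have [yltx|xlty|->//] := ltgtP y x.
  by rewrite (Fxy y x)// ltrDl.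
by rewrite (Fxy x y)// ltrBlDr ltrDl.
Unshelve. all: by end_near. Qed.

(** The fundamental lemma of the calculus of variations: cutoffs converge boundedly to indicators of
    intervals. *)
Lemma test_function_eq0_ae Om g : open Om -> rintegrable Om g ->
  (forall phi, test_function Om phi -> \int[mu]_(t in Om) (g t * phi t) = 0) ->
  {ae mu, forall x, Om x -> g x = 0}.
Proof.
move=> oO Ig g0; apply: int_itv_eq0_ae => // x y xy xyO.
have c1 := cvg_int_cutoff (open_measurable oO) Ig xy xyO.
apply/(cvg_unique _ c1) => //.
apply: cvg_near_cst; near=> n; apply: g0; apply: cutoff_test => //.
  by rewrite ltr0n; near: n; exists 1%N.
rewrite -ler_pdivrMr ?subr_gt0// mul1r.
by near: n; exact: nbhs_infty_ger.
Unshelve. all: by end_near. Qed.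

End Cutoff.

(** * Absolutely continuous functions *)

(* [f] is absolutely continuous on [[a, b]] with derivative [g]. *)
Definition primitive_on (R : realType) (a b : R) (f g : R -> R) :=
  rintegrable `[a, b] g /\
  forall x y, a <= x -> x <= y -> y <= b ->
    f y - f x = \int[@lebesgue_measure R]_(t in `[x, y]) g t.

Section AbsolutelyContinuous.
Variable R : realType.
Implicit Types (f g F G k : R -> R) (a b x y C : R).
Local Notation mu := (@lebesgue_measure R).

Lemma subset_itvcc a b x y : a <= x -> y <= b ->
  `[x, y]%classic `<=` `[a, b]%classic.
Proof. by move=> ax yb; apply: subset_itv; rewrite bnd_simp. Qed.

Lemma rintegrable_subitv a b x y f : a <= x -> y <= b ->
  rintegrable `[a, b] f -> rintegrable `[x, y] f.
Proof.
move=> ax yb; apply: rintegrableS; [exact: measurable_itv..|].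
exact: subset_itvcc.
Qed.

Lemma primitive_on_sub a b x y f g : a <= x -> y <= b ->
  primitive_on a b f g -> primitive_on x y f g.
Proof.
move=> ax yb [Ig fg]; split; first exact: rintegrable_subitv Ig.
move=> u v xu uv vy; apply: fg => //; first exact: le_trans ax xu.
exact: le_trans vy yb.
Qed.

Lemma primitive_on_int a b g : rintegrable `[a, b] g ->
  primitive_on a b (fun x => \int[mu]_(t in `[a, x]) g t) g.
Proof.
move=> Ig; split=> // x y ax xy yb.
rewrite (@Rintegral_cc_split _ a x y)//; last exact: rintegrable_subitv Ig.
by rewrite addrC addKr.
Qed.

Lemma primitive_on_itv a b f g x : primitive_on a b f g -> a <= x -> x <= b ->
  f x = f a + \int[mu]_(t in `[a, x]) g t.
Proof. by move=> [_ fg] ax xb; rewrite -fg// addrC subrK. Qed.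

Lemma primitive_on_continuous a b f g : a <= b -> primitive_on a b f g ->
  {within `[a, b], continuous f}.
Proof.
move=> ab fg.
have : {within `[a, b], continuous
    (fun x => f a + \int[mu]_(t in `[a, x]) g t)}.
  move=> x; apply: cvgD; first exact: cvg_cst.
  exact: (parameterized_integral_continuous ab fg.1).
apply: subspace_eq_continuous => x; rewrite inE/= in_itv/= => /andP[ax xb].
by rewrite /from_subspace -(primitive_on_itv fg ax xb).
Qed.

Lemma primitive_on_dist a b f g x y : primitive_on a b f g ->
  a <= x -> x <= y -> y <= b ->
  `|f y - f x| <= \int[mu]_(t in `[x, y]) `|g t|.
Proof.
move=> [Ig fg] ax xy yb; rewrite fg//; apply: le_normr_Rintegral => //.
exact: rintegrable_subitv Ig.
Qed.

(** The intermediate value theorem applied to the continuous primitive of [k]. *)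
Lemma Rintegral_halves a b k : a <= b -> rintegrable `[a, b] k ->
  (forall t, 0 <= k t) ->
  exists c, [/\ a <= c, c <= b,
    \int[mu]_(t in `[a, c]) k t = (\int[mu]_(t in `[a, b]) k t) / 2 &
    \int[mu]_(t in `[c, b]) k t = (\int[mu]_(t in `[a, b]) k t) / 2].
Proof.
move=> ab Ik k0; set T := \int[mu]_(t in `[a, b]) k t.
have T0 : 0 <= T by apply: Rintegral_ge0 => t _; exact: k0.
have ct : {within `[a, b], continuous (fun x => \int[mu]_(t in `[a, x]) k t)}.
  exact: parameterized_integral_continuous.
have [|c] := IVT (v := T / 2) ab ct.
  rewrite set_itv1 Rintegral_set1 -/T.
  rewrite (min_idPl T0) (max_idPr T0) divr_ge0//= ler_pdivrMr//.
  by rewrite ler_peMr// ler1n.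
rewrite in_itv/= => /andP[ac cb] e; exists c; split => //.
have := Rintegral_cc_split ac cb Ik; rewrite -/T e => /eqP.
by rewrite {1}[T]splitr (inj_eq (addrI _)) => /eqP.
Qed.

(* Bisecting [[x, y]] into two parts of equal [k]-mass halves the bound
   [C (int k)^2], so the bound can be improved to [0]. *)
Lemma primitive_on_quadratic a b F G k C :
  rintegrable `[a, b] G -> rintegrable `[a, b] k -> (forall t, 0 <= k t) ->
  (forall x y, a <= x -> x <= y -> y <= b ->
    `|F y - F x - \int[mu]_(t in `[x, y]) G t| <=
      C * (\int[mu]_(t in `[x, y]) k t) ^+ 2) ->
  primitive_on a b F G.
Proof.
move=> IG Ik k0 FG; split=> // x y ax xy yb.
have bisect m : forall x y, a <= x -> x <= y -> y <= b ->
    `|F y - F x - \int[mu]_(t in `[x, y]) G t| <=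
      C * (\int[mu]_(t in `[x, y]) k t) ^+ 2 / 2 ^+ m.
  elim: m => [|m IH] u v au uv vb; first by rewrite expr0 divr1 FG.
  have [c [uc cv e1 e2]] := Rintegral_halves uv (rintegrable_subitv au vb Ik) k0.
  rewrite (Rintegral_cc_split uc cv); last exact: rintegrable_subitv IG.
  have h1 := IH _ _ au uc (le_trans cv vb).
  have h2 := IH _ _ (le_trans au uc) cv vb.
  move: h1 h2; rewrite e1 e2.
  set P := \int[mu]_(t in `[u, c]) G t; set Q := \int[mu]_(t in `[c, v]) G t.
  set T := \int[mu]_(t in `[u, v]) k t.
  have -> : C * T ^+ 2 / 2 ^+ m.+1 =
      C * (T / 2) ^+ 2 / 2 ^+ m + C * (T / 2) ^+ 2 / 2 ^+ m.
    rewrite (exprSr 2 m); have : (2 : R) ^+ m != 0 by rewrite expf_neq0.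
    by move: (2 ^+ m) => q q0; field.
  move: (C * _ / _) (F c) (F u) (F v) P Q => e fc fu fv p q.
  by rewrite !ler_norml; lra.
apply/eqP; rewrite -subr_eq0 -normr_le0.
set B := C * (\int[mu]_(t in `[x, y]) k t) ^+ 2.
have cv : (fun m => B / 2 ^+ m) @ \oo --> (0 : R).
  have := @cvg_geometric R B 2^-1; rewrite ger0_norm// invf_lt1// ltr1n => /(_ isT).
  rewrite (_ : geometric _ _ = fun m => B / 2 ^+ m)//.
  by apply/funext => m; rewrite /geometric/= exprVn.
apply: (ler_cvg_to (cvg_cst _) cv); apply: nearW => m; exact: bisect.
Qed.

Lemma continuous_bounded_itv a b f : {within `[a, b], continuous f} ->
  exists2 M : R, 0 <= M & forall x, a <= x -> x <= b -> `|f x| <= M.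
Proof.
move=> cf; have /compact_bounded[M [_ hM]] :=
  continuous_compact cf (@segment_compact R a b).
exists (`|M| + 1) => [|x ax xb]; first by rewrite addr_ge0.
apply: (hM (`|M| + 1)); first by rewrite (le_lt_trans (ler_norm _))// ltrDl.
by exists x => //=; rewrite in_itv/= ax.
Qed.

Lemma continuous_measurable_itv a b f : {within `[a, b], continuous f} ->
  measurable_fun `[a, b] f.
Proof.
by move=> cf; apply: subspace_continuous_measurable_fun => //; exact: measurable_itv.
Qed.

Lemma rintegrable_continuousM a b f g : {within `[a, b], continuous f} ->
  rintegrable `[a, b] g -> rintegrable `[a, b] (fun x => f x * g x).
Proof.
move=> cf Ig; have [M _ hM] := continuous_bounded_itv cf.
apply: (@rintegrableM _ _ _ _ M) => //; first exact: continuous_measurable_itv.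
by move=> x /=; rewrite in_itv/= => /andP[ax xb]; exact: hM.
Qed.

Lemma primitive_onD a b f1 g1 f2 g2 : primitive_on a b f1 g1 ->
  primitive_on a b f2 g2 ->
  primitive_on a b (fun x => f1 x + f2 x) (fun x => g1 x + g2 x).
Proof.
move=> [I1 p1] [I2 p2]; split.
  by apply: rintegrableD => //; exact: measurable_itv.
move=> x y ax xy yb; rewrite RintegralD; last 3 first.
- exact: measurable_itv.
- exact: rintegrable_subitv I1.
- exact: rintegrable_subitv I2.
by rewrite -p1// -p2//; ring.
Qed.

Lemma primitive_onZ a b f g c : primitive_on a b f g ->
  primitive_on a b (fun x => c * f x) (fun x => c * g x).
Proof.
move=> [Ig p]; split; first by apply: rintegrableZ => //; exact: measurable_itv.
move=> x y ax xy yb; rewrite RintegralZl; last 2 first.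
- exact: measurable_itv.
- exact: rintegrable_subitv Ig.
by rewrite -p// mulrBr.
Qed.

Lemma primitive_on_cst a b c : primitive_on a b (fun=> c) (fun=> 0).
Proof.
split; first exact/continuous_rintegrable/continuous_subspaceT/cst_continuous.
by move=> x y _ xy _; rewrite Rintegral_cc_cst// subrr mul0r.
Qed.

Lemma primitive_on_C1 a b F G : continuous G ->
  (forall x : R, is_derive x 1 F (G x)) -> primitive_on a b F G.
Proof.
move=> cG dF; split; first exact/continuous_rintegrable/continuous_subspaceT.
move=> x y _ xy _; rewrite (Rintegral_FTC2 xy _ dF)//.
exact: continuous_subspaceT.
Qed.

Lemma le_Rintegral_subitv x y u v k : x <= u -> v <= y ->
  rintegrable `[x, y] k -> (forall t, 0 <= k t) ->
  \int[mu]_(t in `[u, v]) k t <= \int[mu]_(t in `[x, y]) k t.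
Proof.
move=> xu vy Ik k0; apply: le_Rintegral_subset => //; exact: subset_itvcc.
Qed.

(** Freezing the coefficient [H] at [x] costs its oscillation times the mass of [g]. Such errors are
    quadratic in the mass, as [primitive_on_quadratic] asks. *)
Let int_varying_coef x y H g (m : R) k : rintegrable `[x, y] g -> rintegrable `[x, y] k ->
  x <= y ->
  (forall t, `|g t| <= k t) -> 0 <= m ->
  rintegrable `[x, y] (fun t => H t * g t) ->
  (forall t, x <= t -> t <= y -> `|H t - H x| <= m) ->
  `|\int[mu]_(t in `[x, y]) (H t * g t) - H x * \int[mu]_(t in `[x, y]) g t|
    <= m * \int[mu]_(t in `[x, y]) k t.
Proof.
move=> Ig Ik xy gk m0 IHg hH.
have mI : measurable (`[x, y]%classic : set R) by exact: measurable_itv.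
rewrite -RintegralZl// -RintegralB//; last exact: rintegrableZ.
rewrite -RintegralZl//; apply: le_norm_Rintegral => //.
- by apply: rintegrableB => //; exact: rintegrableZ.
- exact: rintegrableZ.
- move=> t /=; rewrite in_itv/= => /andP[xt ty].
  by rewrite -mulrBl normrM ler_pM// hH.
Qed.

(** With T the [k]-mass of [x, y], the error splits into the product of the two increments and two
    frozen-coefficient errors, each at most T^2; hence the constant 3. *)
Lemma primitive_onM a b f1 g1 f2 g2 : a <= b -> primitive_on a b f1 g1 ->
  primitive_on a b f2 g2 ->
  primitive_on a b (fun x => f1 x * f2 x) (fun x => f1 x * g2 x + f2 x * g1 x).
Proof.
move=> ab p1 p2; have [I1 h1] := p1; have [I2 h2] := p2.
have mI (x y : R) : measurable (`[x, y]%classic : set R) by exact: measurable_itv.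
have c1 := primitive_on_continuous ab p1; have c2 := primitive_on_continuous ab p2.
have I12 := rintegrable_continuousM c1 I2.
have I21 := rintegrable_continuousM c2 I1.
pose k (t : R) : R := `|g1 t| + `|g2 t|.
have k0 t : 0 <= k t by rewrite addr_ge0.
have Ik : rintegrable `[a, b] k.
  by apply: rintegrableD => //; exact: rintegrable_norm.
apply: (primitive_on_quadratic (k := k) (C := 3)) => //.
  exact: rintegrableD.
move=> x y ax xy yb; set T := \int[mu]_(t in `[x, y]) k t.
have Ikxy := rintegrable_subitv ax yb Ik.
have T0 : 0 <= T by apply: Rintegral_ge0 => t _; exact: k0.
have osc f g t : primitive_on a b f g -> (forall t, `|g t| <= k t) ->
    x <= t -> t <= y -> `|f t - f x| <= T.
  move=> p gk xt ty.
  have h := primitive_on_dist p ax xt (le_trans ty yb).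
  have Igt : rintegrable `[x, t] (fun t => `|g t|).
    by apply: rintegrable_norm; apply: rintegrable_subitv p.1 => //; exact: le_trans yb.
  apply: (le_trans h); apply: (@le_trans _ _ (\int[mu]_(t in `[x, t]) k t)).
    by apply: le_Rintegral => //; apply: rintegrable_subitv Ikxy.
  exact: le_Rintegral_subitv.
have g1k t : `|g1 t| <= k t by rewrite lerDl.
have g2k t : `|g2 t| <= k t by rewrite lerDr.
rewrite RintegralD//; [|exact: rintegrable_subitv I12|exact: rintegrable_subitv I21].
have e1 := @int_varying_coef x y f1 g2 T k (rintegrable_subitv ax yb I2) Ikxy xy
  g2k T0 (rintegrable_subitv ax yb I12) (fun t => osc _ _ t p1 g1k).
have e2 := @int_varying_coef x y f2 g1 T k (rintegrable_subitv ax yb I1) Ikxy xy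
  g1k T0 (rintegrable_subitv ax yb I21) (fun t => osc _ _ t p2 g2k).
have d1 := osc _ _ _ p1 g1k xy (lexx y); have d2 := osc _ _ _ p2 g2k xy (lexx y).
have d12 : `|(f1 y - f1 x) * (f2 y - f2 x)| <= T * T by rewrite normrM ler_pM.
move: e1 e2 d12; rewrite -h1// -h2// -/T expr2.
move: (Rintegral _ _ _) (Rintegral _ _ _) => Q P.
have -> : f1 y * f2 y - f1 x * f2 x - (P + Q) =
  (f1 y - f1 x) * (f2 y - f2 x) - (P - f1 x * (f2 y - f2 x))
   - (Q - f2 x * (f1 y - f1 x)) by ring.
move: ((f1 y - f1 x) * _) (P - _) (Q - _) (T * T) => p q r s.
by rewrite !ler_norml; lra.
Qed.

(** [F] is controlled only along the values of [f], so the rule also covers t^{-1/2}, which is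
    regular only away from 0. The Taylor remainder and the freezing of [F'] each cost C times the
    squared mass, hence C + C. *)
Lemma primitive_on_comp a b F F' f g C : a <= b -> primitive_on a b f g ->
  0 <= C ->
  (forall x y, a <= x -> x <= b -> a <= y -> y <= b ->
    `|F (f y) - F (f x) - F' (f x) * (f y - f x)| <= C * (f y - f x) ^+ 2 /\
    `|F' (f y) - F' (f x)| <= C * `|f y - f x|) ->
  primitive_on a b (F \o f) (fun x => F' (f x) * g x).
Proof.
move=> ab p C0 hF; have [Ig h] := p.
have mI (x y : R) : measurable (`[x, y]%classic : set R) by exact: measurable_itv.
have cf := primitive_on_continuous ab p.
have cF' : {within `[a, b], continuous (F' \o f)}.
  apply/subspace_continuousP => x xab.
  have /andP[ax xb] : a <= x <= b by move: xab; rewrite /= in_itv.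
  have /subspace_continuousP/(_ _ xab)/cvgrPdist_le cfx := cf.
  apply/cvgrPdist_le => e e0.
  have e'0 : 0 < e / (C + 1) by rewrite divr_gt0// ltr_wpDl.
  near=> t.
  have tab : `[a, b]%classic t by near: t; exact: withinT.
  have /andP[at_ tb] : a <= t <= b by move: tab; rewrite /= in_itv.
  have : `|f x - f t| <= e / (C + 1) by near: t; exact: cfx.
  rewrite ler_pdivlMr ?ltr_wpDl// => h1.
  have [_ h2] := hF _ _ at_ tb ax xb.
  rewrite (le_trans h2)// (le_trans _ h1)// mulrC ler_wpM2l// lerDl//.
have IFg := rintegrable_continuousM cF' Ig.
pose k (t : R) : R := `|g t|.
have k0 t : 0 <= k t by rewrite /k.
have Ik : rintegrable `[a, b] k by exact: rintegrable_norm.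
apply: (primitive_on_quadratic (k := k) (C := C + C)) => //.
move=> x y ax xy yb; set T := \int[mu]_(t in `[x, y]) k t.
have Ikxy := rintegrable_subitv ax yb Ik.
have T0 : 0 <= T by apply: Rintegral_ge0 => t _; exact: k0.
have xb := le_trans xy yb; have ay := le_trans ax xy.
have osc t : x <= t -> t <= y -> `|f t - f x| <= T.
  move=> xt ty; apply: (le_trans (primitive_on_dist p ax xt (le_trans ty yb))).
  exact: le_Rintegral_subitv.
have [e1 _] := hF _ _ ax xb ay yb.
have e2 : `|\int[mu]_(t in `[x, y]) ((F' \o f) t * g t) -
    (F' \o f) x * \int[mu]_(t in `[x, y]) g t| <= (C * T) * T.
  apply: int_varying_coef => //.
  - exact: rintegrable_subitv Ig.
  - exact: mulr_ge0.
  - exact: rintegrable_subitv IFg.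
  - move=> t xt ty; have at_ := le_trans ax xt; have tb := le_trans ty yb.
    have [_ /le_trans] := hF _ _ ax xb at_ tb; apply.
    by rewrite ler_wpM2l// osc.
have e3 : C * (f y - f x) ^+ 2 <= C * T * T.
  rewrite -mulrA ler_wpM2l// -(real_normK (num_real _)) expr2.
  by rewrite ler_pM// osc.
have {e1 e3} := le_trans e1 e3; move: e2; rewrite -h//=.
rewrite expr2 mulrDl mulrA.
move: (Rintegral _ _ _) (F' (f x) * _) (C * T * T) (F (f y)) (F (f x)) => p1 q r s u.
by rewrite !ler_norml; lra.
Unshelve. all: by end_near. Qed.

End AbsolutelyContinuous.

(** * Weak derivatives *)

Definition locally_constant (R : realType) (Om : set R) (s : R -> R) :=
  forall x, Om x -> \forall y \near x, s y = s x.

Section WeakDerivatives.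
Variable R : realType.
Implicit Types (f g s phi : R -> R) (a b x y : R) (Om U : set R).
Local Notation mu := (@lebesgue_measure R).

Lemma locally_constant_continuous Om s : locally_constant Om s ->
  forall x, Om x -> {for x, continuous s}.
Proof.
by move=> lc x Ox; apply: cvg_near_cst; exact: lc.
Qed.

Lemma locally_constant_comp Om s (F : R -> R) : locally_constant Om s ->
  locally_constant Om (F \o s).
Proof. by move=> lc x Ox; apply: filterS (lc x Ox) => y /= ->. Qed.

Lemma test_function_derivable Om phi : test_function Om phi ->
  forall x, is_derive x (1 : R) phi (derive1 phi x).
Proof.
by move=> [sm _ _] x; apply: DeriveDef; [exact: (sm 0 x)|rewrite derive1E].
Qed.

Lemma test_function_continuous_derive1 Om phi : test_function Om phi ->
  continuous (derive1 phi).
Proof.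
move=> [sm _ _] x; apply: differentiable_continuous; apply/derivable1_diffP.
exact: (sm 1 x).
Qed.

Lemma test_function_near0 Om phi x : test_function Om phi -> ~ Om x ->
  \forall y \near x, phi y = 0.
Proof.
move=> [_ _ sO] Ox.
have cx : ~ closure [set x | phi x != 0] x by move=> /sO.
have oC : open (~` closure [set x | phi x != 0]).
  exact/closed_openC/closed_closure.
have : nbhs x (~` closure [set x | phi x != 0]) by exact: open_nbhs_nbhs.
apply: filterS => y ny; apply: contrapT => /eqP py; apply: ny.
exact: subset_closure.
Qed.

Lemma test_function_eq0 Om phi x : test_function Om phi -> ~ Om x -> phi x = 0.
Proof. by move=> tp /(test_function_near0 tp)/nbhs_singleton. Qed.

Lemma test_function_derive1_near0 Om phi x : test_function Om phi -> ~ Om x ->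
  \forall y \near x, derive1 phi y = 0.
Proof.
move=> tp /(test_function_near0 tp) n0.
have := near_join n0; apply: filterS => y ny.
by rewrite -(derive1_cst (0 : R) y) !derive1E; exact: near_eq_derive.
Qed.

(** [s] is uncontrolled outside [Om], but [phi] vanishes near every such point, so the product is
    C^1 on the whole line. A single integration by parts can then cross the jumps of [s]. *)
Lemma primitive_on_test Om s phi a b : locally_constant Om s ->
  test_function Om phi ->
  primitive_on a b (fun x => s x * phi x) (fun x => s x * derive1 phi x).
Proof.
move=> lc tp; have cdp := test_function_continuous_derive1 tp.
apply: primitive_on_C1 => x; have [Ox|Ox] := pselect (Om x).
- apply: cvgM; [exact: locally_constant_continuous Ox|exact: cdp].
- have d0 := test_function_derive1_near0 tp Ox.
  rewrite /continuous_at (nbhs_singleton d0) mulr0; apply: cvg_near_cst.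
  by apply: filterS d0 => y ->; rewrite mulr0.
- apply: (near_eq_is_derive (f := s x \*: phi)).
    by apply: filterS (lc x Ox) => y ->.
  exact: (is_deriveZ (s x) (test_function_derivable tp x)).
- have d0 := test_function_derive1_near0 tp Ox.
  rewrite (nbhs_singleton d0) mulr0.
  apply: (near_eq_is_derive (f := cst 0)).
  by apply: filterS (test_function_near0 tp Ox) => y ->; rewrite mulr0.
Qed.

(** The product rule on [a, b] applied to [f] and [s * phi]; the boundary terms vanish because
    neither endpoint lies in [Om]. *)
Lemma primitive_on_weak_derivative a b f g s Om phi : a <= b ->
  primitive_on a b f g -> locally_constant Om s -> open Om ->
  Om `<=` `]a, b[%classic -> test_function Om phi ->
  [/\ rintegrable Om (fun x => f x * s x * derive1 phi x),
      rintegrable Om (fun x => g x * s x * phi x) &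
      \int[mu]_(x in Om) (f x * s x * derive1 phi x) =
      - \int[mu]_(x in Om) (g x * s x * phi x)].
Proof.
move=> ab p lc oO Oab tp.
have mO := open_measurable oO.
have mI : measurable (`[a, b]%classic : set R) by exact: measurable_itv.
have Occ : Om `<=` `[a, b]%classic.
  by apply: subset_trans Oab _; exact: subset_itv_oo_cc.
have pt := primitive_on_test a b lc tp.
have If := rintegrable_continuousM (primitive_on_continuous ab p) pt.1.
have Ig := rintegrable_continuousM (primitive_on_continuous ab pt) p.1.
have IfO := rintegrableS mO mI Occ If.
have IgO := rintegrableS mO mI Occ Ig.
have ef : (fun x => f x * s x * derive1 phi x) =
    (fun x => f x * (s x * derive1 phi x)).
  by apply/funext => x; rewrite mulrA.
have eg : (fun x => g x * s x * phi x) = (fun x => s x * phi x * g x).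
  by apply/funext => x; ring.
rewrite ef eg; split => //; apply/eqP; rewrite eq_sym -subr_eq0 -opprD oppr_eq0.
rewrite addrC -(Rintegral_supp mO mI Occ (f := fun x => f x * _)); last first.
  by move=> x _ Ox; rewrite (nbhs_singleton (test_function_derive1_near0 tp Ox)) !mulr0.
rewrite -(Rintegral_supp mO mI Occ (f := fun x => _ * g x)); last first.
  by move=> x _ Ox; rewrite (test_function_eq0 tp Ox) !mulr0 mul0r.
have [_ pp] := primitive_onM ab p pt.
rewrite -RintegralD// -pp// !(test_function_eq0 tp) ?mulr0 ?subrr//.
- by move=> /Oab/=; rewrite in_itv/= ltxx.
- by move=> /Oab/=; rewrite in_itv/= ltxx andbF.
Qed.

(** Two terms, because the addition formulas write cos (H + s) and sin (H + s) as two products of an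
    absolutely continuous factor and a locally constant one. *)
Lemma weak_derivative_combination a b f1 g1 s1 f2 g2 s2 Om : a <= b ->
  primitive_on a b f1 g1 -> locally_constant Om s1 ->
  primitive_on a b f2 g2 -> locally_constant Om s2 -> open Om ->
  Om `<=` `]a, b[%classic ->
  weak_derivative Om (fun x => f1 x * s1 x + f2 x * s2 x)
    (fun x => g1 x * s1 x + g2 x * s2 x).
Proof.
move=> ab p1 l1 p2 l2 oO Oab phi tp.
have mO := open_measurable oO.
have [I1 J1 e1] := primitive_on_weak_derivative ab p1 l1 oO Oab tp.
have [I2 J2 e2] := primitive_on_weak_derivative ab p2 l2 oO Oab tp.
under eq_Rintegral do rewrite mulrDl.
under [in RHS]eq_Rintegral do rewrite mulrDl.
by rewrite !RintegralD// e1 e2 opprD.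
Qed.

Let integral_abs_sqr Om f :
  (\int[mu]_(x in Om) `|(EFin \o (fun x => f x ^+ 2)%R) x| =
   \int[mu]_(x in Om) (f x ^+ 2)%:E)%E.
Proof. by apply: eq_integral => x _ /=; rewrite ger0_norm ?sqr_ge0. Qed.

Lemma square_integrable_sqr Om f : measurable Om -> square_integrable Om f ->
  rintegrable Om (fun x => f x ^+ 2).
Proof.
move=> _ [mf foo]; apply/integrableP; split.
  by apply/measurable_EFinP; exact: measurable_funX.
by rewrite integral_abs_sqr.
Qed.

Lemma sqr_square_integrable Om f : measurable_fun Om f ->
  rintegrable Om (fun x => f x ^+ 2) -> square_integrable Om f.
Proof.
by move=> mf /integrableP[_]; rewrite integral_abs_sqr.
Qed.

Lemma le_square_integrable Om f g : measurable Om -> measurable_fun Om f ->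
  (forall x, Om x -> f x ^+ 2 <= g x) -> rintegrable Om g -> square_integrable Om f.
Proof.
move=> mO mf fg Ig; apply: sqr_square_integrable => //.
apply: le_rintegrable Ig => //; first exact: measurable_funX.
by move=> x Ox; rewrite ger0_norm ?sqr_ge0// fg.
Qed.

Lemma square_integrableS Om U f : measurable Om -> measurable U -> U `<=` Om ->
  square_integrable Om f -> square_integrable U f.
Proof.
move=> mO mU UO sf; apply: sqr_square_integrable.
  by apply: measurable_funS sf.1.
exact: rintegrableS (square_integrable_sqr mO sf).
Qed.

Lemma square_integrableM_rintegrable Om f g : measurable Om ->
  square_integrable Om f -> square_integrable Om g ->
  rintegrable Om (fun x => f x * g x).
Proof.
move=> mO sf sg; apply: (le_rintegrable (g := fun x => f x ^+ 2 + g x ^+ 2)) => //.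
- exact: measurable_funM sf.1 sg.1.
- move=> x _; rewrite normrM -(real_normK (num_real (f x))) -(real_normK (num_real (g x))).
  have := sqr_ge0 (`|f x| - `|g x|); have := normr_ge0 (f x).
  have := normr_ge0 (g x); nra.
- by apply: rintegrableD => //; exact: square_integrable_sqr.
Qed.

Lemma square_integrable_bounded Om f c : measurable Om -> (mu Om < +oo)%E ->
  measurable_fun Om f -> (forall x, Om x -> `|f x| <= c) -> square_integrable Om f.
Proof.
move=> mO Ooo mf fc; apply: sqr_square_integrable => //.
apply: (@rintegrable_bounded _ _ _ (c ^+ 2)) => //; first exact: measurable_funX.
by move=> x Ox; rewrite normrX lerXn2r ?nnegrE ?fc// (le_trans _ (fc _ Ox)).
Qed.

Lemma square_integrable_rintegrable Om f : measurable Om -> (mu Om < +oo)%E ->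
  square_integrable Om f -> rintegrable Om f.
Proof.
move=> mO Ooo sf; have s1 : square_integrable Om (fun=> 1).
  by apply: (@square_integrable_bounded _ _ 1) => // x _; rewrite normr1.
have := square_integrableM_rintegrable mO sf s1.
by under eq_fun do rewrite mulr1.
Qed.

Lemma square_integrableM_bounded Om f s c : measurable Om ->
  square_integrable Om f -> measurable_fun Om s ->
  (forall x, Om x -> `|s x| <= c) -> square_integrable Om (fun x => s x * f x).
Proof.
move=> mO sf ms sc.
apply: (le_square_integrable (g := fun x => c ^+ 2 * f x ^+ 2)) => //.
- exact: measurable_funM ms sf.1.
- move=> x Ox; rewrite exprMn ler_wpM2r ?sqr_ge0//.
  by rewrite -(real_normK (num_real _)) lerXn2r ?nnegrE ?sc// (le_trans _ (sc _ Ox)).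
- exact/rintegrableZ/square_integrable_sqr.
Qed.

Lemma square_integrableD Om f g : measurable Om ->
  square_integrable Om f -> square_integrable Om g ->
  square_integrable Om (fun x => f x + g x).
Proof.
move=> mO sf sg.
apply: (le_square_integrable (g := fun x => 2 * (f x ^+ 2 + g x ^+ 2))) => //.
- exact: measurable_funD sf.1 sg.1.
- by move=> x _; have := sqr_ge0 (f x - g x); nra.
- by apply/rintegrableZ/rintegrableD => //; exact: square_integrable_sqr.
Qed.

Lemma square_integrableZ Om f c : measurable Om -> square_integrable Om f ->
  square_integrable Om (fun x => c * f x).
Proof.
by move=> mO sf; apply: (@square_integrableM_bounded _ _ (fun=> c) `|c|).
Qed.

Lemma square_integrableB Om f g : measurable Om ->
  square_integrable Om f -> square_integrable Om g ->
  square_integrable Om (fun x => f x - g x).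
Proof.
move=> mO sf sg; under eq_fun do rewrite -mulN1r.
by apply: square_integrableD => //; exact: square_integrableZ.
Qed.

Lemma wderivP Om f : H1 Om f ->
  square_integrable Om (wderiv Om f) /\ weak_derivative Om f (wderiv Om f).
Proof. by move=> [_ gP]; exact: (@xgetPex _ (fun=> 0)
  [set g | square_integrable Om g /\ weak_derivative Om f g] gP). Qed.

(** Two weak derivatives differ by a function orthogonal to every test function. This allows the
    representative picked by [wderiv] to be replaced by an explicit one. *)
Lemma wderiv_ae Om f g : open Om -> (mu Om < +oo)%E ->
  square_integrable Om f -> square_integrable Om g -> weak_derivative Om f g ->
  {ae mu, forall x, Om x -> wderiv Om f x = g x}.
Proof.
move=> oO Ooo sf sg wg; have mO := open_measurable oO.
have [sw ww] : square_integrable Om (wderiv Om f) /\ weak_derivative Om f (wderiv Om f).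
  by apply: wderivP; split => //; exists g.
have tb phi : test_function Om phi -> square_integrable Om phi.
  move=> tp; have cp : continuous phi.
    move=> x; apply: differentiable_continuous; apply/derivable1_diffP.
    by have [] := test_function_derivable tp x.
  have [_ cK KO] := tp.
  have /compact_bounded[M [_ hM]] := continuous_compact (continuous_subspaceT cp) cK.
  apply: (@square_integrable_bounded _ _ (`|M| + 1)) => //.
    exact: continuous_measurable.
  move=> x _; have [->|px] := eqVneq (phi x) 0; first by rewrite normr0 addr_ge0.
  apply: (hM (`|M| + 1)); first by rewrite (le_lt_trans (ler_norm _))// ltrDl.
  by exists x => //; exact: subset_closure.
have : {ae mu, forall x, Om x -> wderiv Om f x - g x = 0}.
  apply: test_function_eq0_ae => //.
    apply: rintegrableB => //; exact: square_integrable_rintegrable.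
  move=> phi tp; under eq_Rintegral do rewrite mulrBl.
  rewrite RintegralB//; [|exact: square_integrableM_rintegrable (tb _ tp)..].
  apply/eqP; rewrite subr_eq0 -eqr_opp.
  by rewrite -(ww _ tp) -(wg _ tp).
apply: filterS; first exact: (ae_filter_ringOfSetsType mu).
by move=> x h /h /eqP; rewrite subr_eq0 => /eqP.
Qed.

End WeakDerivatives.

(** * Weak compactness in L^2 *)

(** Midpoints stand for convex combinations: they are what the parallelogram law uses, and
    properties of the hull follow by structural induction. *)
Inductive midpoint_hull (R : realType) (P : (R -> R) -> Prop) :
    (R -> R) -> Prop :=
| hull_base v : P v -> midpoint_hull P v
| hull_midpoint u v : midpoint_hull P u -> midpoint_hull P v ->
    midpoint_hull P (fun x => 2^-1 * (u x + v x)).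

Section L2.
Variable R : realType.
Implicit Types (f g h : R -> R) (Om : set R).
Local Notation mu := (@lebesgue_measure R).

Lemma fatou_le Om (F : nat -> R -> R) H (e : \bar R) : measurable Om ->
  (forall k, measurable_fun Om (F k)) -> (forall k x, Om x -> 0 <= F k x) ->
  (forall x, Om x -> F ^~ x @ \oo --> H x) ->
  (\forall k \near \oo, (\int[mu]_(x in Om) (F k x)%:E <= e)%E) ->
  (\int[mu]_(x in Om) (H x)%:E <= e)%E.
Proof.
move=> mO mF F0 FH Fe.
have mF' k : measurable_fun Om (EFin \o F k) by exact/measurable_EFinP.
have := @fatou _ _ _ mu Om mO (fun k => EFin \o F k) mF'
  (fun k x Ox => F0 k x Ox).
rewrite [X in (X <= _)%E -> _](_ : _ = \int[mu]_(x in Om) (H x)%:E)%E; last first.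
  apply: eq_integral => x; rewrite inE => Ox.
  have cv : (fun k => (F k x)%:E) @ \oo --> (H x)%:E.
    by apply: cvg_EFin; [exact: nearW|exact: FH].
  by rewrite is_cvg_limn_einfE; [exact/cvg_lim|apply/cvg_ex; exists (H x)%:E].
move=> /le_trans; apply; rewrite limn_einf_lim; apply: lime_le.
  exact: is_cvg_einfs.
apply: filterS Fe => k; apply: le_trans.
by apply: ereal_inf_lbound; exists k => /=.
Qed.

Lemma Rintegral_sqr_EFin Om f : measurable Om -> square_integrable Om f ->
  (\int[mu]_(x in Om) (f x ^+ 2)%:E =
    (\int[mu]_(x in Om) (f x ^+ 2))%R%:E)%E.
Proof.
move=> mO sf; rewrite /Rintegral fineK//; apply: integrable_fin_num => //.
exact: square_integrable_sqr.
Qed.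

Lemma le_square_integral Om f (C : R) : measurable Om -> measurable_fun Om f ->
  (\int[mu]_(x in Om) (f x ^+ 2)%:E <= C%:E)%E ->
  square_integrable Om f /\ \int[mu]_(x in Om) (f x ^+ 2) <= C.
Proof.
move=> mO mf fC; have sf : square_integrable Om f.
  by split => //; rewrite (le_lt_trans fC)// ltry.
by split => //; rewrite -lee_fin -Rintegral_sqr_EFin.
Qed.

Lemma summable_cvg (v : nat -> R) :
  (\sum_(0 <= k <oo) `|v k.+1 - v k|%:E < +oo)%E -> cvgn v.
Proof.
move=> voo.
have cn : cvgn [normed (series (fun k => v k.+1 - v k))].
  apply: nondecreasing_is_cvgn.
    by apply: nondecreasing_series => k _ /=.
  exists (fine (\sum_(0 <= k <oo) `|v k.+1 - v k|%:E)%E) => _ [n _ <-].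
  rewrite -lee_fin fineK; last first.
    by rewrite ge0_fin_numE// nneseries_ge0// => k _; rewrite lee_fin.
  rewrite /series/= -sumEFin.
  by apply: nneseries_lim_ge => k _ _; rewrite lee_fin.
have /cvg_ex[l cl] := normed_cvg cn.
apply/cvg_ex; exists (l + v 0%N).
have cv : (fun n => series (fun k => v k.+1 - v k) n + v 0%N) @ \oo --> l + v 0%N.
  by apply: cvgD; [exact: cl|exact: cvg_cst].
suff e : (fun n => series (fun k => v k.+1 - v k) n + v 0%N) = v by rewrite e in cv.
by apply/funext => n; rewrite /series/= telescope_sumr// subrK.
Qed.

(** Riesz-Fischer: a subsequence with squared gaps at most 8^-k has increments summable in L^1, so
    it converges off a null set, and Fatou passes the Cauchy bounds to the limit. *)
Lemma L2_complete Om (v : nat -> R -> R) : measurable Om -> (mu Om < +oo)%E ->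
  (forall n, square_integrable Om (v n)) ->
  (forall e : R, 0 < e -> exists N, forall m n, (N <= m)%N -> (N <= n)%N ->
    \int[mu]_(x in Om) ((v m x - v n x) ^+ 2) <= e) ->
  exists2 h, square_integrable Om h &
    forall e : R, 0 < e -> exists N, forall n, (N <= n)%N ->
      \int[mu]_(x in Om) ((v n x - h x) ^+ 2) <= e.
Proof.
move=> mO Ooo sv cau.
have mv n : measurable_fun Om (v n) by have [] := sv n.
have e8 k : (0 : R) < (8^-1) ^+ k by rewrite exprn_gt0.
have ex k : exists N, forall m n, (N <= m)%N -> (N <= n)%N ->
  \int[mu]_(x in Om) ((v m x - v n x) ^+ 2) <= (8^-1) ^+ k by exact: cau.
have [N hN] := choice ex.
(* The sum dominates every [N i] with i <= k and is monotone in k. *)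
pose s k := (\sum_(i < k.+1) N i)%N.
have sN k : (N k <= s k)%N by rewrite /s big_ord_recr/= leq_addl.
have sS k : (s k <= s k.+1)%N by rewrite /s [leqRHS]big_ord_recr/= leq_addr.
have s_homo : {homo s : m n / (m <= n)%N} by exact: homo_leq leq_trans sS.
pose d k x := v (s k.+1) x - v (s k) x.
have sd k : square_integrable Om (d k) by exact: square_integrableB.
have d8 k : \int[mu]_(x in Om) (d k x ^+ 2) <= (8^-1) ^+ k.
  by apply: hN => //; exact: leq_trans (sS k).
pose M := fine (mu Om).
have M0 : 0 <= M by rewrite fine_ge0.
(* By |d| <= 2^k d^2 + 2^-k, the integral is at most 4^-k + M 2^-k. *)
have d1 k : (\int[mu]_(x in Om) `|d k x|%:E <= ((1 + M) * (2^-1) ^+ k)%:E)%E.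
  have Id : rintegrable Om (d k) by exact: square_integrable_rintegrable.
  have Id2 := square_integrable_sqr mO (sd k).
  have I1 : rintegrable Om (fun=> (2^-1 : R) ^+ k).
    apply: (@rintegrable_bounded _ _ _ `|(2^-1) ^+ k|) => //.
  have -> : (\int[mu]_(x in Om) `|d k x|%:E =
      (\int[mu]_(x in Om) `|d k x|)%R%:E)%E.
    by rewrite /Rintegral fineK//; apply: integrable_fin_num => //; exact: rintegrable_norm.
  rewrite lee_fin.
  have p2 : 0 < (2 : R) ^+ k by rewrite exprn_gt0.
  apply: (@le_trans _ _ (\int[mu]_(x in Om) (2 ^+ k * d k x ^+ 2 + (2^-1) ^+ k))).
    apply: le_Rintegral => //.
    - exact: rintegrable_norm.
    - by apply: rintegrableD => //; exact: rintegrableZ.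
    - move=> x _; rewrite exprVn -(real_normK (num_real (d k x))).
      rewrite -(ler_pM2l p2) mulrDr divff ?gt_eqF//.
      have := sqr_ge0 (2 ^+ k * `|d k x| - 1).
      have := normr_ge0 (d k x); move: `|d k x| (2 ^+ k) p2 => y q q0 y0.
      nra.
  rewrite RintegralD//; last exact: rintegrableZ.
  rewrite RintegralZl// Rintegral_cst// -/M mulrDl mul1r lerD//; last by rewrite mulrC.
  rewrite -ler_pdivlMl// (le_trans (d8 k))// -exprVn -exprMn.
  by rewrite lerXn2r ?nnegrE//; lra.
pose G x := (\sum_(0 <= k <oo) `|d k x|%:E)%E.
have mabs k : measurable_fun Om (fun x => `|d k x|%:E).
  by apply/measurable_EFinP; apply: measurableT_comp => //; have [] := sd k.
have G0 x : (0 <= G x)%E by apply: nneseries_ge0 => k _ _; rewrite lee_fin.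
have mG : measurable_fun Om G.
  exact: ge0_emeasurable_sum.
have IG : mu.-integrable Om G.
  apply/integrableP; split => //.
  under eq_integral do rewrite gee0_abs//.
  rewrite integral_nneseries//.
  apply: (@le_lt_trans _ _ (\sum_(0 <= k <oo) ((1 + M) * (2^-1) ^+ k)%:E)%E).
    apply: lee_nneseries => // k *; apply: integral_ge0 => x _.
    by rewrite lee_fin.
  have := @cvg_geometric_series R (1 + M) 2^-1.
  rewrite ger0_norm// invf_lt1// ltr1n => /(_ isT) cg.
  have : (fun n => (\sum_(0 <= k < n) ((1 + M) * (2^-1) ^+ k)%:E)%E) @ \oo -->
      ((1 + M) / (1 - 2^-1))%:E.
    under eq_fun do rewrite sumEFin.
    by apply: cvg_EFin; [exact: nearW|exact: cg].
  by move/cvg_lim => -> //; rewrite ltry.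
(* The value 0 where the increments are not summable, a null part of [Om], makes [F] converge at
   every point. *)
pose F k x := if (G x < +oo)%E then v (s k) x else 0.
have mF k : measurable_fun Om (F k).
  by apply: measurable_fun_if_on => //; exact: measurable_fun_lte.
have cF x : cvgn (F ^~ x).
  have [Gx|/negbTE Gx] := boolP (G x < +oo)%E.
    rewrite (_ : F ^~ x = fun k => v (s k) x); last by apply/funext => k; rewrite /F Gx.
    exact: (@summable_cvg (fun k => v (s k) x)).
  rewrite (_ : F ^~ x = fun=> 0); last by apply/funext => k; rewrite /F Gx.
  exact: is_cvg_cst.
pose h x := limn (F ^~ x).
have Fh x : F ^~ x @ \oo --> h x by [].
have mh : measurable_fun Om h by apply: (measurable_fun_cvg mF) => x _.
have aeF k n : (\int[mu]_(x in Om) ((F k x - v n x) ^+ 2)%:E =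
    \int[mu]_(x in Om) ((v (s k) x - v n x) ^+ 2)%:E)%E.
  apply: ae_eq_integral => //.
  - exact: (measurable_EFin (measurable_funX 2 (measurable_funB (mF k) (mv n)))).
  - exact: (measurable_EFin (measurable_funX 2 (measurable_funB (mv (s k)) (mv n)))).
  - have := integrable_ae (mu := mu) mO IG.
    case=> N1 [mN1 N10 sN1]; exists N1; split => // x /= nP.
    apply: sN1 => /= fG; apply: nP => Ox.
    by move: (fG Ox); rewrite /F ge0_fin_numE// => ->.
exists h => [|e e0].
  have : (\int[mu]_(x in Om) ((h x - v (s 0%N) x) ^+ 2)%:E <= 1%:E)%E.
    apply: (fatou_le (F := fun k x => (F k x - v (s 0%N) x) ^+ 2)) => //.
    - by move=> k; apply: measurable_funX; exact: measurable_funB.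
    - by move=> k x _; exact: sqr_ge0.
    - by move=> x _; rewrite !expr2; apply: cvgM; apply: cvgB => //; exact: cvg_cst.
    - apply: nearW => k; rewrite aeF Rintegral_sqr_EFin//; last exact: square_integrableB.
      by rewrite lee_fin -(expr0 8^-1) hN// (leq_trans (sN 0%N))// s_homo.
  move/(le_square_integral mO (measurable_funB mh (mv _))) => [sh _].
  have := square_integrableD mO sh (sv (s 0%N)).
  by under eq_fun do rewrite subrK.
have : (fun k => (8^-1 : R) ^+ k) @ \oo --> (0 : R).
  by apply: cvg_expr; rewrite ger0_norm// invf_lt1// ltr1n.
move=> /cvgr0Pnorm_le/(_ e e0) [K _ hK].
have {}hK : (8^-1 : R) ^+ K <= e.
  by rewrite (le_trans _ (hK K (leqnn _)))// ler_norm.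
exists (N K) => n Nn; under eq_Rintegral do rewrite -sqrrN opprB.
suff /(le_square_integral mO (measurable_funB mh (mv _))) [_] :
  (\int[mu]_(x in Om) ((h x - v n x) ^+ 2)%:E <= e%:E)%E by [].
apply: (fatou_le (F := fun k x => (F k x - v n x) ^+ 2)) => //.
- by move=> k; apply: measurable_funX; exact: measurable_funB.
- by move=> k x _; exact: sqr_ge0.
- by move=> x _; rewrite !expr2; apply: cvgM; apply: cvgB => //; exact: cvg_cst.
- exists K => // k /= Kk; rewrite aeF Rintegral_sqr_EFin//; last exact: square_integrableB.
  by rewrite lee_fin (le_trans _ hK)// hN// (leq_trans (sN K))// s_homo.
Qed.

(** Young's inequality with a free weight; smallness of the whole comes from the choice of [t]. *)
Lemma Rintegral_mul_le Om f g (t : R) : measurable Om -> 0 < t ->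
  square_integrable Om f -> square_integrable Om g ->
  `|\int[mu]_(x in Om) (f x * g x)| <=
    t * \int[mu]_(x in Om) (f x ^+ 2) + t^-1 * \int[mu]_(x in Om) (g x ^+ 2).
Proof.
move=> mO t0 sf sg.
have If := square_integrable_sqr mO sf; have Ig := square_integrable_sqr mO sg.
rewrite -!RintegralZl// -RintegralD//; [|exact: rintegrableZ..].
apply: le_norm_Rintegral => //.
- exact: square_integrableM_rintegrable.
- by apply: rintegrableD => //; exact: rintegrableZ.
- move=> x _; rewrite normrM -(real_normK (num_real (f x))) -(real_normK (num_real (g x))).
  rewrite -(ler_pM2l t0) mulrDr [t * (t^-1 * _)]mulrA divff ?gt_eqF// mul1r.
  have := sqr_ge0 (t * `|f x| - `|g x|); have := normr_ge0 (f x).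
  have := normr_ge0 (g x); move: `|f x| `|g x| => y z; nra.
Qed.

Lemma parallelogram_Rintegral Om f g : measurable Om ->
  square_integrable Om f -> square_integrable Om g ->
  \int[mu]_(x in Om) ((f x - g x) ^+ 2) =
    2 * \int[mu]_(x in Om) (f x ^+ 2) + 2 * \int[mu]_(x in Om) (g x ^+ 2)
    - 4 * \int[mu]_(x in Om) ((2^-1 * (f x + g x)) ^+ 2).
Proof.
move=> mO sf sg.
have If := square_integrable_sqr mO sf; have Ig := square_integrable_sqr mO sg.
have Ih := square_integrable_sqr mO (square_integrableZ 2^-1 mO (square_integrableD mO sf sg)).
rewrite -!RintegralZl// -RintegralD//; [|exact: rintegrableZ..].
rewrite -RintegralB//; [|apply: rintegrableD => //; exact: rintegrableZ|exact: rintegrableZ].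
by apply: eq_Rintegral => x _; field.
Qed.

(** Elements of nearly minimal norm in the hulls of the tails form a Cauchy sequence, by the
    parallelogram law and because the infima increase to a limit. An element of a late hull pairs
    with [psi i] to nearly [c i], so their strong limit [h] does so exactly. One [h] serves all the
    tests, however many indices [I] has. *)
Lemma weak_L2_limit (I : Type) (psi : I -> R -> R) (c : I -> R)
    (u : nat -> R -> R) (C : R) Om : measurable Om -> (mu Om < +oo)%E ->
  (forall n, square_integrable Om (u n)) ->
  (forall n, \int[mu]_(x in Om) (u n x ^+ 2) <= C) ->
  (forall i, square_integrable Om (psi i)) ->
  (forall i, (fun n => \int[mu]_(x in Om) (u n x * psi i x)) @ \oo --> c i) ->
  exists2 h, square_integrable Om h &
    forall i, \int[mu]_(x in Om) (h x * psi i x) = c i.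
Proof.
move=> mO Ooo su uC spsi cu.
pose V n := midpoint_hull (fun v => exists2 l, (n <= l)%N & v = u l).
pose q (v : R -> R) := \int[mu]_(x in Om) (v x ^+ 2).
have q0 v : 0 <= q v by apply: Rintegral_ge0 => x _; exact: sqr_ge0.
have sV n v : V n v -> square_integrable Om v.
  elim=> {v} [v [l _ ->]//|v w _ sv _ sw].
  by apply: square_integrableZ => //; exact: square_integrableD.
have Vhomo m n v : (m <= n)%N -> V n v -> V m v.
  move=> mn; elim=> {v} [v [l nl ->]|v w _ sv _ sw]; last exact: hull_midpoint.
  by apply: hull_base; exists l => //; exact: leq_trans mn nl.
have Vu n : V n (u n) by apply: hull_base; exists n.
pose Q n := inf [set q v | v in V n].
have infQ n : has_inf [set q v | v in V n].
  by split; [exists (q (u n)), (u n)|exists 0 => _ [v _ <-]].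
have Qle n v : V n v -> Q n <= q v.
  by move=> Vv; apply: ge_inf; [exact: (infQ n).2|exists v].
have Q_nd : nondecreasing_seq Q.
  move=> m n mn; apply: lb_le_inf; first exact: (infQ n).1.
  by move=> _ [v Vv <-]; apply: Qle; exact: Vhomo Vv.
have QC n : Q n <= C by exact: le_trans (Qle _ _ (Vu n)) (uC n).
have /cvg_ex[L QL] : cvgn Q.
  by apply: nondecreasing_is_cvgn => //; exists C => _ [n _ <-].
have cQ : cvgn Q by apply/cvg_ex; exists L.
have QleL n : Q n <= L.
  by rewrite -(cvg_lim (@Rhausdorff R) QL); exact: nondecreasing_cvgn_le.
have ex n : exists v : R -> R, V n v /\ q v <= Q n + n.+1%:R^-1.
  have n0 : (0 : R) < n.+1%:R^-1 by rewrite invr_gt0.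
  have [_ [v Vv <-] /ltW qv] := inf_adherent n0 (infQ n).
  by exists v.
have [v hv] := choice ex.
have sv n : square_integrable Om (v n) by exact: sV (hv n).1.
have [|h sh hh] := L2_complete mO Ooo sv.
  move=> e e0.
  (* The parallelogram law will give at most 4 (L + e/8) - 4 (L - e/8) = e. *)
  have e16 : 0 < e / 8 by rewrite divr_gt0.
  have [K1 _ hK1] : \forall n \near \oo, L - Q n <= e / 8.
    move/cvgrPdist_le: QL => /(_ _ e16); apply: filterS => n; apply: le_trans.
    exact: ler_norm.
  have [K2 _ hK2] : \forall n \near \oo, (n.+1%:R^-1 : R) <= e / 8.
    near=> n; rewrite -[leRHS]invrK lef_pV2 ?posrE ?invr_gt0//.
    by rewrite (@le_trans _ _ n%:R)// ?ler_nat//; near: n; exact: nbhs_infty_ger.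
  exists (maxn K1 K2) => m n; rewrite !geq_max => /andP[K1m K2m] /andP[K1n K2n].
  rewrite parallelogram_Rintegral//.
  have mid := Qle K1 _ (hull_midpoint (Vhomo _ _ _ K1m (hv m).1) (Vhomo _ _ _ K1n (hv n).1)).
  have := hK1 K1 (leqnn _); have := hK2 _ K2m; have := hK2 _ K2n.
  move: (hv m).2 (hv n).2 mid (QleL m) (QleL n); rewrite /q /=.
  have arith (a b p qm qn qk l im jn : R) : a <= qm + im -> b <= qn + jn ->
      qk <= p -> qm <= l -> qn <= l -> jn <= e / 8 -> im <= e / 8 ->
      l - qk <= e / 8 -> 2 * a + 2 * b - 4 * p <= e by lra.
  exact: arith.
exists h => // i.
have cvi (e : R) : 0 < e -> \forall n \near \oo,
    `|\int[mu]_(x in Om) (v n x * psi i x) - c i| <= e.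
  move=> e0; have /cvgrPdist_le/(_ e e0)[K _ hK] := cu i.
  exists K => // n /= Kn.
  elim: (hv n).1 => {v hv sv hh} [v [l nl ->]|v w Vv hv Vw hw].
    by rewrite distrC; apply: hK => /=; exact: leq_trans nl.
  have Iv := square_integrableM_rintegrable mO (sV _ _ Vv) (spsi i).
  have Iw := square_integrableM_rintegrable mO (sV _ _ Vw) (spsi i).
  under eq_Rintegral do rewrite -mulrA mulrDl.
  rewrite RintegralZl//; last exact: rintegrableD.
  rewrite RintegralD//; move: hv hw.
  by move: (Rintegral _ _ _) (Rintegral _ _ _) => p r; rewrite !ler_norml; lra.
have cvh (e : R) : 0 < e -> \forall n \near \oo,
    `|\int[mu]_(x in Om) (v n x * psi i x) - \int[mu]_(x in Om) (h x * psi i x)| <= e.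
  move=> e0.
  pose B := \int[mu]_(x in Om) (psi i x ^+ 2).
  have B0 : 0 <= B by apply: Rintegral_ge0 => x _; exact: sqr_ge0.
  (* This weight makes B / t at most e / 2; the + 1 keeps it positive when B = 0. *)
  pose t := 2 * (B + 1) / e.
  have t0 : 0 < t by rewrite divr_gt0// mulr_gt0// ltr_wpDl.
  have et0 : 0 < e / 2 / t by rewrite divr_gt0// divr_gt0.
  have [K hK] := hh _ et0; exists K => // n /= Kn.
  have Iv := square_integrableM_rintegrable mO (sv n) (spsi i).
  have Ih := square_integrableM_rintegrable mO sh (spsi i).
  rewrite -RintegralB//; under eq_Rintegral do rewrite -mulrBl.
  apply: (le_trans (Rintegral_mul_le mO t0 (square_integrableB mO (sv n) sh) (spsi i))).
  rewrite [leRHS]splitr lerD//; first by rewrite -ler_pdivlMl// mulrC hK.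
  rewrite -/B /t invf_div mulrAC ler_pdivrMr ?mulr_gt0 ?ltr_wpDl//.
  rewrite [leRHS](_ : _ = e * (B + 1)); last by field.
  by rewrite ler_pM2l// lerDl.
apply: (cvg_unique (@Rhausdorff R) (F := (fun n => \int[mu]_(x in Om) (v n x * psi i x)) @ \oo)).
  by apply/cvgrPdist_le => e /cvh; apply: filterS => n; rewrite distrC.
by apply/cvgrPdist_le => e /cvi; apply: filterS => n; rewrite distrC.
Unshelve. all: by end_near. Qed.

Lemma increasing_seq_ge (s : nat -> nat) : increasing_seq s -> forall n, (n <= s n)%N.
Proof.
move=> si; elim=> // n IH; apply: (leq_ltn_trans IH).
by rewrite ltnNge -leEnat si -ltnNge.
Qed.

Lemma increasing_seqP (s : nat -> nat) : (forall n, (s n < s n.+1)%N) -> increasing_seq s.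
Proof.
move=> sS m n; have sl : {homo s : m n / (m < n)%N} by exact: homo_ltn ltn_trans sS.
by rewrite leEnat; exact: (leq_mono sl).
Qed.

Lemma diagonal_subsequence (f : nat -> nat -> R) :
  (forall k, bounded_fun (f k)) ->
  exists2 s : nat -> nat, increasing_seq s & forall k, cvgn (f k \o s).
Proof.
move=> bf.
have ext (sk : (nat -> nat) * nat) : exists t : nat -> nat,
    increasing_seq t /\ cvgn (f sk.2 \o sk.1 \o t).
  have [|t ti ct] := bolzano_weierstrass (u_ := f sk.2 \o sk.1); last by exists t.
  have [M [Mr hM]] := bf sk.2; exists M; split => // x /hM {}hM n _.
  exact: hM.
have [T hT] := choice ext.
pose sg := fix sg k := if k is k'.+1 then sg k' \o T (sg k', k') else id.
have sgi k : increasing_seq (sg k).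
  by elim: k => [//|k IH] m n /=; rewrite IH -leEnat (hT (sg k, k)).1.
have sgle k n x : (k <= n)%N -> exists2 y, (x <= y)%N & sg n x = sg k y.
  move=> kn; rewrite -(subnK kn); elim: (n - k)%N x => [|d IH] x; first by exists x.
  rewrite addSn; have [y xy /= ->] := IH (T (sg (d + k)%N, (d + k)%N) x).
  exists y => //; apply: leq_trans xy; apply: increasing_seq_ge.
  exact: (hT (sg (d + k)%N, (d + k)%N)).1.
(* From rank k + 1 on, the diagonal runs inside [sg k.+1], along which [f k] converges. *)
exists (fun n => sg n n).
  apply: increasing_seqP => n /=.
  apply: (@leq_trans (sg n n.+1)); first by rewrite ltnNge -leEnat sgi -ltnNge.
  by rewrite -leEnat sgi; apply: increasing_seq_ge; exact: (hT (sg n, n)).1.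
move=> k; have [_ /cvg_ex[l cl]] := hT (sg k, k).
apply/cvg_ex; exists l; apply/cvgrPdist_le => e e0.
move/cvgrPdist_le: cl => /(_ e e0)[N _ hN].
exists (maxn N k.+1) => // n /=; rewrite geq_max => /andP[Nn kn].
have [y ny ->] := sgle k.+1 n n kn.
by apply: hN => /=; exact: leq_trans ny.
Qed.

End L2.

(** * Points where the modulus is small *)

Section BadPoints.
Variable R : realType.
Implicit Types (f g r : R -> R) (a b p q t x y z : R) (X : seq R).
Local Notation mu := (@lebesgue_measure R).

(** The witness is the infimum of the set where [r] is at least [c]; continuity puts it in that
    set. *)
Lemma first_hitting r x y c : x <= y ->
  (forall t, x <= t -> t <= y -> {for t, continuous r}) -> c <= r y ->
  exists q, [/\ x <= q, q <= y, c <= r q & forall t, x <= t -> t < q -> r t < c].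
Proof.
move=> xy cr cy.
pose S := [set t | [/\ x <= t, t <= y & c <= r t]].
have iS : has_inf S by split; [exists y|exists x => t []].
have xq : x <= inf S by apply: lb_le_inf; [exact: iS.1|move=> t []].
have qy : inf S <= y by apply: ge_inf; [exact: iS.2|split].
exists (inf S); split => //.
- rewrite leNgt; apply/negP => rq.
  have /nbhs_ballP[d /= d0 hd] : \forall t \near inf S, r t < c.
    exact: (cvgr_lt _ (cr _ xq qy)).
  have [t [xt ty ct] td] := inf_adherent d0 iS.
  have : S t by split.
  move=> /(ge_inf iS.2) qt; have : r t < c.
    apply: hd; rewrite /ball/= ltr_distlC td andbT.
    by rewrite ltrBlDr (le_lt_trans qt)// ltrDl.
  by rewrite ltNge ct.
- move=> t xt tq; rewrite ltNge; apply/negP => ct.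
  have : S t by split => //; exact: le_trans (ltW tq) qy.
  by move=> /(ge_inf iS.2); rewrite leNgt tq.
Qed.

Lemma last_hitting r x y c : x <= y ->
  (forall t, x <= t -> t <= y -> {for t, continuous r}) -> c <= r x ->
  exists p, [/\ x <= p, p <= y, c <= r p & forall t, p < t -> t <= y -> r t < c].
Proof.
move=> xy cr cx.
have [||//|q [yq qx cq hq]] := @first_hitting (r \o -%R) (- y) (- x) c.
- by rewrite lerN2.
- move=> t yt tx; apply: continuous_comp; first exact: opp_continuous.
  by apply: cr; [rewrite lerNr|rewrite lerNl].
- by rewrite /= opprK.
exists (- q); rewrite lerNr lerNl; split => // t pt ty.
by rewrite -[t]opprK; apply: hq; rewrite ?lerN2// ltrNl.
Qed.

(** The vectors have norms at most 1/2 and at least 3/4, hence are 1/4 apart, and the sum norm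
    dominates the Euclidean one. *)
Lemma dist_transition (a1 a2 b1 b2 : R) : a1 ^+ 2 + a2 ^+ 2 <= 4^-1 ->
  9 / 16 <= b1 ^+ 2 + b2 ^+ 2 -> 4^-1 <= `|b1 - a1| + `|b2 - a2|.
Proof.
move=> ha hb; rewrite leNgt; apply/negP => hd.
have h1 : `|a1| <= 2^-1.
  by rewrite ler_norml; have := sqr_ge0 a2; move=> ?; apply/andP; split; nra.
have h2 : `|a2| <= 2^-1.
  by rewrite ler_norml; have := sqr_ge0 a1; move=> ?; apply/andP; split; nra.
have k1 : a1 * (b1 - a1) <= 2^-1 * `|b1 - a1|.
  by rewrite (le_trans (ler_norm _))// normrM ler_wpM2r.
have k2 : a2 * (b2 - a2) <= 2^-1 * `|b2 - a2|.
  by rewrite (le_trans (ler_norm _))// normrM ler_wpM2r.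
have e1 := real_normK (num_real (b1 - a1)); have e2 := real_normK (num_real (b2 - a2)).
have n1 := normr_ge0 (b1 - a1); have n2 := normr_ge0 (b2 - a2).
move: k1 k2 e1 e2 n1 n2 hd; move: `|b1 - a1| `|b2 - a2| => p q *; nra.
Qed.

Variables (eps K0 : R) (u1 u2 g1 g2 : R -> R).
Hypothesis eps0 : 0 < eps.
Hypothesis u1_prim : forall a b, 0 < a -> a <= b -> b < 1 -> primitive_on a b u1 g1.
Hypothesis u2_prim : forall a b, 0 < a -> a <= b -> b < 1 -> primitive_on a b u2 g2.
Let r x := u1 x ^+ 2 + u2 x ^+ 2.
Let e x := eps / 2 * (g1 x ^+ 2 + g2 x ^+ 2) + (4 * eps)^-1 * (r x - 1) ^+ 2.
Hypothesis continuous_r : forall t, 0 < t -> t < 1 -> {for t, continuous r}.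
Hypothesis int_e : rintegrable `]0, 1[ e.
Hypothesis e_le : \int[mu]_(x in `]0, 1[) e x <= K0.

Let e_ge0 x : 0 <= e x.
Proof.
have e4 : 0 <= (4 * eps)^-1 by rewrite invr_ge0 mulr_ge0// ltW.
have e2 : 0 <= eps / 2 by rewrite divr_ge0// ltW.
by apply: addr_ge0; apply: mulr_ge0 => //; rewrite ?addr_ge0 ?sqr_ge0.
Qed.

Let int_e_cc a b : 0 < a -> b < 1 -> rintegrable `[a, b] e.
Proof.
move=> a0 b1; apply: rintegrableS int_e => //.
by apply: subset_itv; rewrite bnd_simp.
Qed.

(** The Modica-Mortola estimate: where r < 9/16 one has (r - 1)^2 >= (7/16)^2, and completing
    squares bounds the density below by 7/32 (|u1'| + |u2'|). A variation of at least 1/4 then costs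
    7/128. *)
Let energy_transition p q : 0 < p -> p <= q -> q < 1 ->
  (forall t, p < t -> t < q -> r t < 9 / 16) ->
  4^-1 <= `|u1 q - u1 p| + `|u2 q - u2 p| ->
  7 / 128 <= \int[mu]_(x in `[p, q]) e x.
Proof.
move=> p0 pq q1 rt du.
have P1 := u1_prim p0 pq q1; have P2 := u2_prim p0 pq q1.
have d1 := primitive_on_dist P1 (lexx p) pq (lexx q).
have d2 := primitive_on_dist P2 (lexx p) pq (lexx q).
have I1 := rintegrable_norm P1.1; have I2 := rintegrable_norm P2.1.
have I12 : rintegrable `[p, q] (fun x => `|g1 x| + `|g2 x|).
  by apply: rintegrableD => //; exact: measurable_itv.
have soc : (`]p, q[%classic `<=` (`[p, q]%classic : set R)) by exact: subset_itv_oo_cc.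
have I12o : rintegrable `]p, q[ (fun x => `|g1 x| + `|g2 x|).
  by apply: rintegrableS I12.
have Ieo : rintegrable `]p, q[ e by apply: rintegrableS (int_e_cc p0 q1).
rewrite -Rintegral_oo_cc//.
apply: (@le_trans _ _ (7 / 32 * \int[mu]_(x in `]p, q[) (`|g1 x| + `|g2 x|))).
  rewrite Rintegral_oo_cc// RintegralD//.
  have := le_trans du (lerD d1 d2).
  by move: (Rintegral _ _ _) (Rintegral _ _ _) => *; lra.
rewrite -RintegralZl//; apply: le_Rintegral => //; first exact: rintegrableZ.
move=> t /=; rewrite in_itv/= => /andP[pt tq]; rewrite /e.
have := rt t pt tq; move: (r t) => s s916.
rewrite -(real_normK (num_real (g1 t))) -(real_normK (num_real (g2 t))).
have := normr_ge0 (g1 t); have := normr_ge0 (g2 t).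
move: `|g1 t| `|g2 t| => x y x0 y0.
rewrite -(ler_pM2l eps0).
have -> : eps * (eps / 2 * (x ^+ 2 + y ^+ 2) + (4 * eps)^-1 * (s - 1) ^+ 2) =
    (eps * x) ^+ 2 / 2 + (eps * y) ^+ 2 / 2 + 4^-1 * (s - 1) ^+ 2.
  by field; rewrite gt_eqF.
have h1 : 49 / 256 <= (s - 1) ^+ 2 by nra.
(* Half of these two squares uses up 49/1024, exactly a quarter of 49/256. *)
have := sqr_ge0 (eps * x - 7 / 32); have := sqr_ge0 (eps * y - 7 / 32).
nra.
Qed.

(** On an interval this long [r] cannot stay below 9/16, because the potential alone would exceed
    [K0], as 32 * 49/1024 > 1. So [r] passes between at most 1/4 at the bad end and at least 9/16,
    and [energy_transition] gives the cost. *)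
Let energy_bad_side a b x : 0 < a -> a <= b -> b < 1 -> 32 * eps * K0 < b - a ->
  x \in [:: a; b] -> r x <= 4^-1 -> 7 / 128 <= \int[mu]_(x in `[a, b]) e x.
Proof.
move=> a0 ab b1 abK xab rx.
have [y [ay yb ry]] : exists y, [/\ a <= y, y <= b & 9 / 16 <= r y].
  apply: contrapT => /forallNP nr.
  suff : 49 / 256 * (4 * eps)^-1 * (b - a) <= K0.
    rewrite invfM -(ler_pM2l eps0).
    have -> : eps * (49 / 256 * (4^-1 / eps) * (b - a)) = 49 / 1024 * (b - a).
      by field; rewrite gt_eqF.
    by move=> ?; have := eps0; nra.
  rewrite -Rintegral_cc_cst//; apply: le_trans _ e_le.
  apply: (@le_trans _ _ (\int[mu]_(x in `[a, b]) e x)).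
    apply: le_Rintegral => //.
    - exact/continuous_rintegrable/continuous_subspaceT/cst_continuous.
    - exact: int_e_cc.
    - move=> t /=; rewrite in_itv/= => /andP[at_ tb].
      have rt : r t < 9 / 16 by rewrite ltNge; apply/negP => ?; apply: (nr t).
      rewrite /e ler_wpDl//.
        by rewrite mulr_ge0 ?addr_ge0 ?sqr_ge0 ?divr_ge0 ?(ltW eps0).
      rewrite mulrC ler_wpM2l ?invr_ge0 ?mulr_ge0 ?(ltW eps0)//.
      by move: rt; move: (r t) => s ?; nra.
  apply: le_Rintegral_subset => //.
  by apply: subset_itv; rewrite bnd_simp.
have cr t : a <= t -> t <= b -> {for t, continuous r}.
  by move=> at_ tb; apply: continuous_r; [exact: lt_le_trans at_|exact: le_lt_trans b1].
move: xab; rewrite !inE => /orP[] /eqP xE; rewrite {}xE in rx.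
- have [t at_ ty|q [aq qy rq hq]] := first_hitting ay _ ry.
    by apply: cr => //; exact: le_trans yb.
  have qb := le_trans qy yb.
  apply: (@le_trans _ _ (\int[mu]_(x in `[a, q]) e x)).
    apply: energy_transition => //; first exact: le_lt_trans b1.
      by move=> t /ltW; exact: hq.
    exact: dist_transition.
  by apply: le_Rintegral_subitv => //; exact: int_e_cc.
- have [t yt tb|p [yp pb rp hp]] := last_hitting yb _ ry.
    by apply: cr => //; exact: le_trans yt.
  have ap := le_trans ay yp.
  apply: (@le_trans _ _ (\int[mu]_(x in `[p, b]) e x)).
    apply: energy_transition => //; first exact: lt_le_trans ap.
      by move=> t pt /ltW; exact: hp.
    by rewrite distrC (distrC (u2 b)); exact: dist_transition.
  by apply: le_Rintegral_subitv => //; exact: int_e_cc.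
Qed.

Variable eta : R.
Hypothesis eta_gt : 32 * eps * K0 < eta.
Hypothesis eta_lt : eta < 2^-1.
Hypothesis eta_gt0 : 0 < eta.

Let near_set (X : seq R) : set R :=
  [set t | `]0, 1[%classic t /\ (exists2 x, x \in X & `|t - x| <= eta)].

Let near_set_cons x X : near_set (x :: X) =
  (`]0, 1[%classic `&` `[x - eta, x + eta]%classic) `|` near_set X.
Proof.
apply/seteqP; split => t /=.
- move=> [t01 [y]]; rewrite in_cons => /orP[/eqP->|yX] ty.
    by left; split => //; rewrite in_itv/= -ler_distl.
  by right; split => //; exists y.
- move=> [[t01]|[t01 [y yX ty]]]; last first.
    by split => //; exists y => //; rewrite in_cons yX orbT.
  rewrite in_itv/= -ler_distl => tx; split => //; exists x => //.
  exact: mem_head.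
Qed.

Let measurable_near_set X : measurable (near_set X).
Proof.
elim: X => [|x X IH].
  rewrite (_ : near_set [::] = set0)//.
  by apply/seteqP; split => // t [_ [y]]; rewrite in_nil.
rewrite near_set_cons; apply: measurableU => //.
by apply: measurableI.
Qed.

Let near_set_sub X : near_set X `<=` `]0, 1[%classic.
Proof. by move=> t []. Qed.

Let energy_near_bad z : 0 < z -> z < 1 -> r z <= 4^-1 ->
  7 / 128 <= \int[mu]_(x in `]0, 1[ `&` `[z - eta, z + eta]) e x.
Proof.
move=> z0 z1 rz.
have mI : measurable (`]0, 1[%classic `&` `[z - eta, z + eta]%classic : set R).
  exact: measurableI.
have II : rintegrable (`]0, 1[%classic `&` `[z - eta, z + eta]%classic) e.
  by apply: rintegrableS int_e => //; exact: subIsetl.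
have main a b : 0 < a -> a <= b -> b < 1 -> b - a = eta -> z \in [:: a; b] ->
    7 / 128 <= \int[mu]_(x in `]0, 1[ `&` `[z - eta, z + eta]) e x.
  move=> a0 ab b1 ba zab.
  apply: (@le_trans _ _ (\int[mu]_(x in `[a, b]) e x)).
    by apply: energy_bad_side zab rz => //; rewrite ba.
  apply: le_Rintegral_subset => // t; rewrite /= !in_itv/= => /andP[at_ tb].
  move: zab; rewrite !inE => /orP[/eqP ->|/eqP ->]; split; apply/andP; split; lra.
have [z2|z2] := leP z 2^-1.
- apply: (main z (z + eta)) => //; rewrite ?mem_head//.
  + by rewrite lerDl ltW.
  + by move: eta_lt; lra.
  + by rewrite addrAC subrr add0r.
- apply: (main (z - eta) z) => //; rewrite ?inE ?eqxx ?orbT//.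
  + by move: eta_lt; lra.
  + by rewrite gerBl ltW.
  + by rewrite opprB addrCA subrr addr0.
Qed.

Let bad z := [/\ 0 < z, z < 1 & r z <= 4^-1].

(** Centres more than 2 eta apart have disjoint eta-neighbourhoods, each of which carries energy
    7/128. *)
Let separated_energy X : (forall x, x \in X -> bad x) ->
  pairwise (fun x y => 2 * eta < `|x - y|) X ->
  7 / 128 * (size X)%:R <= \int[mu]_(x in near_set X) e x.
Proof.
elim: X => [_ _|x X IH bX].
  by rewrite mulr0; apply: Rintegral_ge0 => t _; exact: e_ge0.
rewrite pairwise_cons => /andP[/allP sx sX].
have [x0 x1 rx] := bX x (mem_head _ _).
rewrite near_set_cons Rintegral_setU//.
- have -> : (size (x :: X))%:R = 1 + (size X)%:R :> R by rewrite addrC natr1.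
  rewrite mulrDr mulr1 lerD//; first exact: energy_near_bad.
  by apply: IH => // y yX; apply: bX; rewrite in_cons yX orbT.
- exact: measurableI.
- exact: measurable_near_set.
- rewrite -near_set_cons; apply: rintegrableS int_e => //.
- apply/disj_setPS => t /= [[_]]; rewrite in_itv/= -ler_distl => tx [_ [y yX ty]].
  have := sx y yX; rewrite ltNge => /negP; apply.
  rewrite (le_trans (ler_distD t _ _))// distrC mulr_natl mulr2n lerD//.
Qed.

(** Take a separated family of bad points of maximal size, which the energy bounds by [M]. By
    maximality no bad point is farther than 2 eta from it. *)
Lemma bad_points_cover (M : nat) : K0 < 7 / 128 * M%:R ->
  exists X : seq R, [/\ (size X <= M)%N, forall x, x \in X -> 0 < x < 1 &
    forall z, 0 < z -> z < 1 -> r z <= 4^-1 ->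
      exists2 x, x \in X & `|z - x| <= 2 * eta].
Proof.
move=> KM.
pose P n := `[< exists X : seq R, [/\ size X = n, forall x, x \in X -> bad x &
  pairwise (fun x y => 2 * eta < `|x - y|) X] >].
have PM n : P n -> (n <= M)%N.
  move=> /asboolP[X [<- bX sX]].
  have := separated_energy bX sX => h.
  have : \int[mu]_(x in near_set X) e x <= K0.
    by apply: le_trans e_le; apply: le_Rintegral_subset.
  move=> /(le_trans h)/le_lt_trans/(_ KM).
  by rewrite ltr_pM2l// ltr_nat => /ltnW.
have P0 : exists n, P n by exists 0%N; apply/asboolP; exists [::].
have [n Pn nmax] := ex_maxnP P0 PM.
have /asboolP[X [sX bX pX]] := Pn.
exists X; split; first by rewrite sX PM.
  by move=> x /bX[-> -> _].
move=> z z0 z1 rz; apply: contrapT => nX.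
suff : P n.+1 by move/nmax; rewrite ltnn.
apply/asboolP; exists (z :: X); split => /=; first by rewrite sX.
- by move=> x; rewrite in_cons => /orP[/eqP->|/bX//]; split.
- rewrite pX andbT; apply/allP => x xX; rewrite ltNge; apply/negP => zx.
  by apply: nX; exists x.
Qed.

End BadPoints.

(** Lists of at most M points give M bounded sequences of coordinates, padded with 0, so one
    diagonal extraction makes all the centres converge. Through the padding, or through centres that
    escape to the boundary, [P] may contain 0 or 1. *)
Lemma concentration_points (R : realType) (B : nat -> set R) (d : nat -> R) (M : nat) :
  (forall l, exists X : seq R, [/\ (size X <= M)%N,
    forall x, x \in X -> 0 < x < 1 &
    forall z, B l z -> exists2 x, x \in X & `|z - x| <= d l]) ->
  d @ \oo --> 0 ->
  exists (s : nat -> nat) (P : seq R), increasing_seq s /\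
    forall e : R, 0 < e -> \forall l \near \oo,
      forall z, (forall p, p \in P -> e <= `|z - p|) -> ~ B (s l) z.
Proof.
move=> hX d0; have [X {}hX] := choice hX.
have [k|s si cs] := @diagonal_subsequence R (fun k l => nth 0 (X l) k).
  exists 1; split; first exact: num_real.
  move=> x x1 l _ /=; have [sz|sz] := ltnP k (size (X l)).
    have [_ /(_ _ (mem_nth 0 sz)) /andP[h0 h1] _] := hX l.
    by rewrite gtr0_norm// (le_trans (ltW h1))// ltW.
  by rewrite nth_default// normr0 (le_trans _ (ltW x1)).
pose p k := limn (fun l => nth 0 (X (s l)) k).
exists s, [seq p k | k <- iota 0 M]; split => // e e0.
have e20 : 0 < e / 2 by rewrite divr_gt0.
have near_p K : \forall l \near \oo, forall k, (k < K)%N ->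
    `|nth 0 (X (s l)) k - p k| < e / 2.
  elim: K => [|K IH]; first exact: nearW.
  have : \forall l \near \oo, `|p K - nth 0 (X (s l)) K| < e / 2.
    by have /cvgrPdist_lt := cs K; apply.
  apply: filterS2 IH => l h1 h2 k; rewrite ltnS leq_eqVlt => /orP[/eqP->|/h1//].
  by rewrite distrC.
have near_d : \forall l \near \oo, d (s l) < e / 2.
  have [N _ hN] : \forall l \near \oo, d l < e / 2 by exact: (cvgr_lt _ d0).
  exists N => // l /= Nl; apply: hN => /=.
  exact: leq_trans Nl (increasing_seq_ge si _).
apply: filterS2 near_d (near_p M) => l hd hp z hz Bz.
have [szM _ /(_ _ Bz) [x xX zx]] := hX (s l).
have := index_mem x (X (s l)); rewrite xX; set k := index _ _ => kX.
have kM : (k < M)%N by exact: leq_trans kX szM.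
have := hz (p k) (map_f _ _); rewrite mem_iota/= add0n => /(_ kM).
rewrite leNgt => /negP; apply.
have := hp k kM; rewrite nth_index// => hxp.
by rewrite (le_lt_trans (ler_distD x _ _))// [ltRHS]splitr (le_lt_trans (lerD zx (lexx _)))// ltrD.
Qed.

(** * Liftings *)

Section Lifting.
Variable R : realType.
Implicit Types (f g F : R -> R) (a b c x y t : R).
Local Notation mu := (@lebesgue_measure R).

Lemma mean_value F F' x y : (forall t : R, is_derive t 1 F (F' t)) ->
  exists2 c, `|c - x| <= `|y - x| & F y - F x = F' c * (y - x).
Proof.
move=> dF; have cF : continuous F.
  move=> t; apply: differentiable_continuous; apply/derivable1_diffP.
  by have [] := dF t.
have [xy|/ltW yx] := leP x y.
  have [c] := MVT_segment xy (fun t _ => dF t) (continuous_subspaceT cF).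
  rewrite in_itv/= => /andP[xc cy] e; exists c => //.
  by rewrite !ger0_norm ?subr_ge0// lerD2r.
have [c] := MVT_segment yx (fun t _ => dF t) (continuous_subspaceT cF).
rewrite in_itv/= => /andP[yc cx] e; exists c.
  by rewrite !ler0_norm ?subr_le0// lerN2 lerD2r.
by rewrite -opprB e -mulrN opprB.
Qed.

Lemma lipschitz_of_derive F F' x y : (forall t : R, is_derive t 1 F (F' t)) ->
  (forall t, `|F' t| <= 1) -> `|F y - F x| <= `|y - x|.
Proof.
move=> dF F1; have [c _ ->] := mean_value x y dF.
by rewrite normrM ler_piMl.
Qed.

Lemma taylor_of_lipschitz F F' x y : (forall t : R, is_derive t 1 F (F' t)) ->
  (forall x y, `|F' y - F' x| <= `|y - x|) ->
  `|F y - F x - F' x * (y - x)| <= (y - x) ^+ 2.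
Proof.
move=> dF lF; have [c cx ->] := mean_value x y dF.
rewrite -mulrBl normrM -(real_normK (num_real (y - x))) expr2 ler_wpM2r//.
exact: le_trans (lF _ _) cx.
Qed.

Lemma sin_lipschitz x y : `|sin y - sin x| <= `|y - x|.
Proof.
apply: (lipschitz_of_derive (F' := cos)) => t; last exact: cos_max.
Qed.

Lemma cos_lipschitz x y : `|cos y - cos x| <= `|y - x|.
Proof.
apply: (lipschitz_of_derive (F' := fun t => - sin t)) => t.
by rewrite normrN sin_max.
Qed.

Lemma primitive_on_cos a b f g : a <= b -> primitive_on a b f g ->
  primitive_on a b (fun x => cos (f x)) (fun x => - sin (f x) * g x).
Proof.
move=> ab p; apply: (primitive_on_comp (F' := fun t => - sin t) ab p ler01).
move=> x y _ _ _ _; rewrite !mul1r; split.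
  apply: (taylor_of_lipschitz (F' := fun t => - sin t)) => // s t.
  by rewrite -opprD normrN sin_lipschitz.
by rewrite -opprD normrN sin_lipschitz.
Qed.

Lemma primitive_on_sin a b f g : a <= b -> primitive_on a b f g ->
  primitive_on a b (fun x => sin (f x)) (fun x => cos (f x) * g x).
Proof.
move=> ab p; apply: (primitive_on_comp (F' := cos) ab p ler01).
move=> x y _ _ _ _; rewrite !mul1r; split; last exact: cos_lipschitz.
by apply: (taylor_of_lipschitz (F' := cos)) => // s t; exact: cos_lipschitz.
Qed.

(** With p and q the square roots of two points, the Taylor estimates for t^{-1/2} become bounds on
    rational functions with an explicit common factor. The constant 32 comes from 1/p, 1/q <= 2. *)
Let rsqrt_taylor (p q : R) : 2^-1 <= p -> 2^-1 <= q ->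
  `|q^-1 - p^-1 - (- (2^-1) * p^-1 ^+ 3) * (q ^+ 2 - p ^+ 2)| <=
    32 * (q ^+ 2 - p ^+ 2) ^+ 2 /\
  `|- (2^-1) * q^-1 ^+ 3 - (- (2^-1) * p^-1 ^+ 3)| <= 32 * `|q ^+ 2 - p ^+ 2|.
Proof.
move=> p2 q2.
have p0 : 0 < p by apply: lt_le_trans p2; rewrite invr_gt0.
have q0 : 0 < q by apply: lt_le_trans q2; rewrite invr_gt0.
have ip : p^-1 <= 2 by rewrite -[leRHS]invrK lef_pV2 ?posrE.
have iq : q^-1 <= 2 by rewrite -[leRHS]invrK lef_pV2 ?posrE.
have ip0 : 0 < p^-1 by rewrite invr_gt0.
have iq0 : 0 < q^-1 by rewrite invr_gt0.
have pw (z : R) n : 0 < z -> z <= 2 -> z ^+ n <= 2 ^+ n.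
  by move=> z0 z2; rewrite lerXn2r ?nnegrE ?(ltW z0).
have pq1 : 1 <= p + q by lra.
split.
- have -> : q^-1 - p^-1 - (- (2^-1) * p^-1 ^+ 3) * (q ^+ 2 - p ^+ 2) =
    (p - q) ^+ 2 * ((p + q + p) / 2 * (p^-1 ^+ 3 * q^-1)).
    by field; rewrite !gt_eqF.
  rewrite [leRHS](_ : _ = (p - q) ^+ 2 * (32 * (p + q) ^+ 2)); last by ring.
  rewrite normrM (ger0_norm (sqr_ge0 (p - q))); apply: ler_wpM2l; first exact: sqr_ge0.
  have b3 : p^-1 ^+ 3 * q^-1 <= 2 ^+ 3 * 2.
    by apply: ler_pM; rewrite ?exprn_ge0 ?(ltW ip0) ?(ltW iq0) ?pw.
  have b30 : 0 <= p^-1 ^+ 3 * q^-1 by rewrite mulr_ge0 ?exprn_ge0 ?ltW.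
  rewrite ger0_norm; last by rewrite mulr_ge0//; lra.
  apply: (@le_trans _ _ ((p + q + p) / 2 * (2 ^+ 3 * 2))).
    by rewrite ler_wpM2l//; lra.
  by nra.
- have -> : - (2^-1) * q^-1 ^+ 3 - (- (2^-1) * p^-1 ^+ 3) =
    (q - p) * ((q ^+ 2 + p * q + p ^+ 2) / 2 * (p^-1 ^+ 3 * q^-1 ^+ 3)).
    by field; rewrite !gt_eqF.
  rewrite subr_sqr [in leRHS]normrM [leRHS]mulrCA [leLHS]normrM.
  apply: ler_wpM2l; first exact: normr_ge0.
  have i3 : 0 <= p^-1 ^+ 3 * q^-1 ^+ 3 by rewrite mulr_ge0 ?exprn_ge0 ?ltW.
  have n1 : `|q + p| = p + q by rewrite addrC ger0_norm//; lra.
  rewrite n1 ger0_norm; last by rewrite mulr_ge0//; nra.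
  have b1 : p^-1 ^+ 2 * q^-1 ^+ 3 <= 2 ^+ 2 * 2 ^+ 3.
    by apply: ler_pM; rewrite ?exprn_ge0 ?(ltW ip0) ?(ltW iq0) ?pw.
  have b2 : p^-1 ^+ 3 * q^-1 ^+ 2 <= 2 ^+ 3 * 2 ^+ 2.
    by apply: ler_pM; rewrite ?exprn_ge0 ?(ltW ip0) ?(ltW iq0) ?pw.
  apply: (@le_trans _ _ ((p + q) / 2 * (p^-1 ^+ 2 * q^-1 ^+ 3 + p^-1 ^+ 3 * q^-1 ^+ 2))).
    rewrite (_ : p^-1 ^+ 2 * q^-1 ^+ 3 + p^-1 ^+ 3 * q^-1 ^+ 2 =
      (p + q) * (p^-1 ^+ 3 * q^-1 ^+ 3)); last by field; rewrite !gt_eqF.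
    rewrite [leRHS]mulrA ler_wpM2r//; nra.
  by nra.
Qed.

Lemma primitive_on_rsqrt a b f g : a <= b -> primitive_on a b f g ->
  (forall x, a <= x -> x <= b -> 4^-1 <= f x) ->
  primitive_on a b (fun x => (Num.sqrt (f x))^-1)
    (fun x => - (2^-1) * (Num.sqrt (f x))^-1 ^+ 3 * g x).
Proof.
move=> ab p f4.
have sf x : a <= x -> x <= b -> 2^-1 <= Num.sqrt (f x).
  move=> ax xb; rewrite -[leLHS]ger0_norm ?invr_ge0// -sqrtr_sqr ler_wsqrtr//.
  by rewrite (le_trans _ (f4 x ax xb))// exprVn -natrX.
have sfK x : a <= x -> x <= b -> f x = Num.sqrt (f x) ^+ 2.
  by move=> ax xb; rewrite sqr_sqrtr// (le_trans _ (f4 x ax xb))// invr_ge0.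
apply: (primitive_on_comp (F := fun t => (Num.sqrt t)^-1)
  (F' := fun t => - (2^-1) * (Num.sqrt t)^-1 ^+ 3) (C := 32) ab p) => //.
move=> x y ax xb ay yb; have := rsqrt_taylor (sf x ax xb) (sf y ay yb).
by rewrite -(sfK x ax xb) -(sfK y ay yb).
Qed.

Lemma primitive_on_eq0 a b f g x : primitive_on a b f g ->
  (forall t, a <= t -> t <= b -> g t = 0) -> a <= x -> x <= b -> f x = f a.
Proof.
move=> p g0 ax xb; apply/eqP; rewrite -subr_eq0 p.2//.
rewrite (@eq_Rintegral _ _ _ mu _ (fun=> 0)); first by rewrite Rintegral_cc_cst// mul0r.
by move=> t; rewrite inE/= in_itv/= => /andP[at_ tx]; rewrite g0// (le_trans tx).
Qed.

Lemma eq_primitive_on a b f g h : primitive_on a b f g ->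
  (forall t, a <= t -> t <= b -> g t = h t) -> primitive_on a b f h.
Proof.
move=> [Ig p] gh; split.
  apply: eq_rintegrable Ig => // t; rewrite inE/= in_itv/= => /andP[]; exact: gh.
move=> x y ax xy yb; rewrite p//; apply: eq_Rintegral => t.
rewrite inE/= in_itv/= => /andP[xt ty]; apply: gh; first exact: le_trans xt.
exact: le_trans ty _.
Qed.

(* The unit vector [u e^{-i phi} / |u|] has zero derivative when
   [phi' = (u1 u2' - u2 u1') / |u|^2]. *)
Lemma lifting_constant a b (u1 u2 g1 g2 phi : R -> R) : a <= b ->
  primitive_on a b u1 g1 -> primitive_on a b u2 g2 ->
  (forall x, a <= x -> x <= b -> 4^-1 <= u1 x ^+ 2 + u2 x ^+ 2) ->
  primitive_on a b phi
    (fun x => (u1 x * g2 x - u2 x * g1 x) / (u1 x ^+ 2 + u2 x ^+ 2)) ->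
  forall x, a <= x -> x <= b ->
    let s t := (Num.sqrt (u1 t ^+ 2 + u2 t ^+ 2))^-1 in
    (u1 x * cos (phi x) + u2 x * sin (phi x)) * s x =
      (u1 a * cos (phi a) + u2 a * sin (phi a)) * s a /\
    (u2 x * cos (phi x) - u1 x * sin (phi x)) * s x =
      (u2 a * cos (phi a) - u1 a * sin (phi a)) * s a.
Proof.
move=> ab p1 p2 u4 pphi x ax xb s.
have pr : primitive_on a b (fun x => u1 x ^+ 2 + u2 x ^+ 2)
    (fun x => u1 x * g1 x + u1 x * g1 x + (u2 x * g2 x + u2 x * g2 x)).
  exact: (primitive_onD (primitive_onM ab p1 p1) (primitive_onM ab p2 p2)).
have ps := primitive_on_rsqrt ab pr u4.
have pc := primitive_on_cos ab pphi; have psn := primitive_on_sin ab pphi.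
have q1 := primitive_onM ab (primitive_onD (primitive_onM ab p1 pc) (primitive_onM ab p2 psn)) ps.
have q2 := primitive_onM ab (primitive_onD (primitive_onM ab p2 pc)
  (primitive_onZ (-1) (primitive_onM ab p1 psn))) ps.
(* Naming the modulus n and eliminating u1^2 = n^2 - u2^2 makes the vanishing of the derivative a
   field identity. *)
have key t : a <= t -> t <= b -> exists2 n,
    n != 0 & Num.sqrt (u1 t ^+ 2 + u2 t ^+ 2) = n /\ u1 t ^+ 2 + u2 t ^+ 2 = n ^+ 2.
  move=> at_ tb; exists (Num.sqrt (u1 t ^+ 2 + u2 t ^+ 2)).
    by rewrite gt_eqF// sqrtr_gt0 (lt_le_trans _ (u4 t at_ tb))// invr_gt0.
  by rewrite sqr_sqrtr// addr_ge0 ?sqr_ge0.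
split.
- apply: (primitive_on_eq0 q1) => // t at_ tb.
  have [n n0 [-> e]] := key t at_ tb; rewrite e.
  have {}e : u1 t ^+ 2 = n ^+ 2 - u2 t ^+ 2 by rewrite -e addrK.
  field: e => //.
- have mN t : u2 t * cos (phi t) - u1 t * sin (phi t) =
     u2 t * cos (phi t) + -1 * (u1 t * sin (phi t)) by ring.
  rewrite (mN x) (mN a).
  apply: (primitive_on_eq0 q2) => // t at_ tb.
  have [n n0 [-> e]] := key t at_ tb; rewrite e.
  have {}e : u1 t ^+ 2 = n ^+ 2 - u2 t ^+ 2 by rewrite -e addrK.
  field: e => //.
Qed.

(* The angle in [[-pi, pi]] of a unit vector; also bounded at [(0, 0)], which
   is the junk value of [u / |u|] where [u] vanishes. *)
Definition angle (c1 c2 : R) := if 0 <= c2 then acos c1 else - acos c1.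

Lemma cos_angle c1 c2 : c1 ^+ 2 + c2 ^+ 2 = 1 -> cos (angle c1 c2) = c1.
Proof.
move=> c12; have c1i : -1 <= c1 <= 1 by have := sqr_ge0 c2; nra.
by rewrite /angle; case: ifP => _; rewrite ?cosN acosK// in_itv.
Qed.

Lemma sin_angle c1 c2 : c1 ^+ 2 + c2 ^+ 2 = 1 -> sin (angle c1 c2) = c2.
Proof.
move=> c12; have c1i : -1 <= c1 <= 1 by have := sqr_ge0 c2; nra.
have e : 1 - c1 ^+ 2 = c2 ^+ 2 by rewrite -c12 addrC addKr.
rewrite /angle; case: ifPn => [c20|]; rewrite ?sinN sin_acos// e sqrtr_sqr.
  by rewrite ger0_norm.
by rewrite -ltNge => c20; rewrite ltr0_norm// opprK.
Qed.

Lemma angle_bounded c1 c2 : `|c1| <= 1 -> `|angle c1 c2| <= pi.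
Proof.
rewrite ler_norml => c1i; rewrite /angle; case: ifP => _; rewrite ?normrN.
  by rewrite ger0_norm ?acos_ge0 ?acos_lepi.
by rewrite ger0_norm ?acos_ge0 ?acos_lepi.
Qed.

End Lifting.

(** * Weak limits and Sobolev functions on the unit interval *)

Section UnitInterval.
Variable R : realType.
Implicit Types (f g h s psi : R -> R) (a c x y t : R) (U : set R).
Local Notation mu := (@lebesgue_measure R).
Local Notation D := (`]0, 1[%classic : set R).

Lemma measure_sub_unit U : measurable U -> U `<=` D -> (mu U < +oo)%E.
Proof.
move=> mU UD; apply: (@le_lt_trans _ _ (mu D)).
  by apply: le_measure; rewrite ?inE.
by rewrite lebesgue_measure_itv/= lte_fin ltr01 ltry.
Qed.

Lemma measure_unit : (mu D < +oo)%E.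
Proof. exact: measure_sub_unit. Qed.

Lemma Rintegral_indic U f E : measurable U -> measurable E -> E `<=` U ->
  \int[mu]_(x in U) (f x * \1_E x) = \int[mu]_(x in E) f x.
Proof.
move=> mU mE EU; rewrite (Rintegral_supp mE mU EU).
  by apply: eq_Rintegral => x xE; rewrite indicE xE mulr1.
by move=> x _ xE; rewrite indicE memNset// mulr0.
Qed.

(** A subsequence that stays away from [A] would, by Bolzano-Weierstrass, have a further one with a
    limit other than [A]. *)
Lemma cvg_of_subsequences (a : nat -> R) (A : R) : bounded_fun a ->
  (forall t : nat -> nat, increasing_seq t -> forall c, (a \o t) @ \oo --> c -> c = A) ->
  a @ \oo --> A.
Proof.
move=> ba ha; apply/cvgrPdist_lt => e e0; apply: contrapT => nN.
have ex N : exists n, (N <= n)%N /\ e <= `|A - a n|.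
  apply: contrapT => /forallNP nex; apply: nN; exists N => // n /= Nn.
  by rewrite ltNge; apply/negP => en; apply: (nex n).
have [F hF] := choice ex.
pose t := fix t n := if n is n'.+1 then F (t n').+1 else F 0%N.
have ti : increasing_seq t by apply: increasing_seqP => n /=; exact: (hF _).1.
have te n : e <= `|A - a (t n)| by case: n => [|n]; exact: (hF _).2.
have bat : bounded_fun (a \o t).
  by have [M [Mr hM]] := ba; exists M; split => // x /hM {}hM n _; exact: hM.
have [s si /cvg_ex[c cc]] := bolzano_weierstrass bat.
have tsi : increasing_seq (t \o s) by move=> m n /=; rewrite ti -leEnat si.
have cA := ha _ tsi _ cc; rewrite {}cA in cc.
move/cvgrPdist_lt: cc => /(_ e e0)[N _ /(_ N (leqnn _))] /=.
by rewrite ltNge te.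
Qed.

Lemma square_integrable_indic U E : measurable U -> (mu U < +oo)%E ->
  measurable E -> square_integrable U \1_E.
Proof.
move=> mU Uoo mE; apply: (@square_integrable_bounded _ _ _ 1) => // x _.
by rewrite indicE ger0_norm ?lern1 ?leq_b1.
Qed.

(** Pairing with indicators of (0, x) yields the primitives, so a weak limit is determined almost
    everywhere by [H]. To reach an arbitrary [psi], it is joined to the indicators along a
    subsequence where its pairings converge: the limit function obtained there has the same
    primitive, hence equals [h] almost everywhere, and so all such subsequences have the same
    limit. *)
Lemma L2_primitive_limit (hs : nat -> R -> R) (C : R) (H : R -> R) :
  (forall n, square_integrable D (hs n)) ->
  (forall n, \int[mu]_(x in D) (hs n x ^+ 2) <= C) ->
  (forall x, 0 <= x -> x <= 1 ->
    (fun n => \int[mu]_(t in `[0, x]) hs n t) @ \oo --> H x) ->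
  exists h, [/\ square_integrable D h,
    forall x, 0 <= x -> x <= 1 -> \int[mu]_(t in `[0, x]) h t = H x &
    forall psi, square_integrable D psi ->
      (fun n => \int[mu]_(x in D) (hs n x * psi x)) @ \oo -->
      \int[mu]_(x in D) (h x * psi x)].
Proof.
move=> shs hC hH.
have mD : measurable D by [].
have Doo := measure_unit.
have sub x : x <= 1 -> `]0, x[%classic `<=` D.
  by move=> x1; apply: subset_itvl; rewrite bnd_simp.
have indE g x : square_integrable D g -> x <= 1 ->
    \int[mu]_(t in D) (g t * \1_(`]0, x[%classic : set R) t) = \int[mu]_(t in `[0, x]) g t.
  move=> sg x1; rewrite Rintegral_indic//; last exact: sub.
  apply: Rintegral_oo_cc; apply: rintegrableS (square_integrable_rintegrable mD Doo sg) => //.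
  exact: sub.
pose psi0 (x : {x : R | 0 <= x <= 1}) : R -> R := \1_(`]0, sval x[%classic : set R).
have spsi0 i : square_integrable D (psi0 i) by exact: square_integrable_indic.
have ext (I : Type) (psi : I -> R -> R) (c : I -> R) (t : nat -> nat) : increasing_seq t ->
    (forall i, square_integrable D (psi i)) ->
    (forall i, (fun n => \int[mu]_(x in D) (hs (t n) x * psi i x)) @ \oo --> c i) ->
    exists h, [/\ square_integrable D h,
      forall x, 0 <= x -> x <= 1 -> \int[mu]_(t in `[0, x]) h t = H x &
      forall i, \int[mu]_(x in D) (h x * psi i x) = c i].
  move=> ti spsi cpsi.
  have [||h sh hh] := @weak_L2_limit R ({x : R | 0 <= x <= 1} + I)
    (fun i => match i with inl x => psi0 x | inr i => psi i end)
    (fun i => match i with inl x => H (sval x) | inr i => c i end)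
    (hs \o t) C D mD Doo (fun n => shs (t n)) (fun n => hC (t n)).
  - by case.
  - case=> [[x x01]|i] /=; last exact: cpsi.
    have /andP[x0 x1] := x01; have /cvgrPdist_le cx := hH x x0 x1.
    apply/cvgrPdist_le => e /cx[N _ hN]; exists N => // n /= Nn.
    rewrite /psi0/= indE//; apply: hN => /=.
    exact: leq_trans Nn (increasing_seq_ge ti _).
  exists h; split => // [x x0 x1|i]; last exact: (hh (inr i)).
  have x01 : 0 <= x <= 1 by rewrite x0.
  by have := hh (inl (exist _ x x01)); rewrite /psi0/= indE.
have idi : increasing_seq (id : nat -> nat) by [].
(* The indicators alone fix [h]; the limits obtained later with [psi] added are compared with it. *)
have [|//|h [sh hh _]] := ext void (fun _ _ => 0) (fun=> 0) id idi; first by case.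
exists h; split => // psi spsi.
apply: cvg_of_subsequences => [|t ti c cc].
  pose B := \int[mu]_(x in D) (psi x ^+ 2).
  exists (C + B); split; first exact: num_real.
  move=> M CM n _ /=; rewrite (le_trans _ (ltW CM))//.
  apply: (le_trans (Rintegral_mul_le mD ltr01 (shs n) spsi)).
  by rewrite invr1 !mul1r lerD.
have [//||h' [sh' hh' hc]] := ext unit (fun=> psi) (fun=> c) t ti; first by [].
rewrite -(hc tt).
have ae0 : {ae mu, forall x, D x -> h' x - h x = 0}.
  apply: int_itv_eq0_ae.
  - exact: interval_open.
  - by apply: rintegrableB => //; exact: square_integrable_rintegrable.
  - move=> x y xy xyD.
    have [x0 _] : 0 < x /\ x < 1.
      by apply/andP; have := xyD x; rewrite /= !in_itv/= lexx (ltW xy); apply.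
    have [y0 y1] : 0 < y /\ y < 1.
      by apply/andP; have := xyD y; rewrite /= !in_itv/= lexx (ltW xy); apply.
    have I01 g : square_integrable D g -> rintegrable `[0, y] g.
      move=> sg; apply: (@rintegrable_subitv _ 0 1) => //; first exact: ltW.
      exact/rintegrable_oo_cc/square_integrable_rintegrable.
    have e g : square_integrable D g ->
        (forall x, 0 <= x -> x <= 1 -> \int[mu]_(t in `[0, x]) g t = H x) ->
        \int[mu]_(t in `[x, y]) g t = H y - H x.
      move=> sg gH; rewrite -(gH y) ?(ltW y0) ?(ltW y1)// -(gH x) ?(ltW x0)//.
        by rewrite (Rintegral_cc_split (ltW x0) (ltW xy) (I01 _ sg)) addrC addKr.
      by rewrite (le_trans (ltW xy)) ?ltW.
    rewrite RintegralB//; last 2 first.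
    + by apply: (rintegrable_subitv (ltW x0) (lexx y)); exact: I01.
    + by apply: (rintegrable_subitv (ltW x0) (lexx y)); exact: I01.
    by rewrite !e// subrr.
rewrite /Rintegral; congr fine; apply: ae_eq_integral => //.
- exact: (measurable_EFin (measurable_funM sh'.1 spsi.1)).
- exact: (measurable_EFin (measurable_funM sh.1 spsi.1)).
- case: ae0 => N1 [mN1 N10 sN1]; exists N1; split => // x /= nP.
  apply: sN1 => /= e; apply: nP => Dx.
  by move: (e Dx) => /eqP; rewrite subr_eq0 => /eqP ->.
Qed.

Lemma locally_constant_measurable U s : open U -> locally_constant U s ->
  measurable_fun U s.
Proof.
move=> oU lc; apply: open_continuous_measurable_fun => // x.
rewrite inE; exact: locally_constant_continuous.
Qed.

(** A locally constant shift adds nothing to the weak derivative, although it may jump between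
    components of [U]. The addition formulas separate it from [H] in the cosine and the sine. *)
Lemma phase_H1 U H h s c : open U -> U `<=` D -> primitive_on 0 1 H h ->
  square_integrable D h -> locally_constant U s -> (forall x, U x -> `|s x| <= c) ->
  [/\ H1 U (fun x => H x + s x), H1 U (fun x => cos (H x + s x)),
      H1 U (fun x => sin (H x + s x)) &
      {ae mu, forall x, U x -> wderiv U (fun x => H x + s x) x = h x}].
Proof.
move=> oU UD pH sh ls sc.
have mU := open_measurable oU.
have Uoo := measure_sub_unit mU UD.
have UI : U `<=` `[0, 1]%classic by apply: subset_trans UD _; exact: subset_itv_oo_cc.
have shU : square_integrable U h by exact: square_integrableS sh.
have cH := primitive_on_continuous ler01 pH.
have [M M0 hM] := continuous_bounded_itv cH.
have mH : measurable_fun U H.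
  by apply: measurable_funS (continuous_measurable_itv cH).
have ms := locally_constant_measurable oU ls.
have bH x : U x -> `|H x| <= M by move=> /UI/=; rewrite in_itv/= => /andP[]; exact: hM.
have mt : measurable_fun U (fun x => H x + s x) by exact: measurable_funD.
have st : square_integrable U (fun x => H x + s x).
  apply: (@square_integrable_bounded _ _ _ (M + c)) => // x Ux.
  by rewrite (le_trans (ler_normD _ _))// lerD ?bH ?sc.
have mcos : measurable_fun U (fun x => cos (H x + s x)).
  apply: measurableT_comp mt => //.
  exact: continuous_measurable (@continuous_cos R).
have msin : measurable_fun U (fun x => sin (H x + s x)).
  apply: measurableT_comp mt => //.
  exact: continuous_measurable (@continuous_sin R).
have lcst : locally_constant U (fun=> 1 : R) by move=> x _; near=> y.
have wt : weak_derivative U (fun x => H x + s x) h.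
  have := weak_derivative_combination ler01 pH lcst (primitive_on_cst 0 1 1) ls oU UD.
  under [X in weak_derivative _ X _ -> _]eq_fun do rewrite mulr1 mul1r.
  by under [X in weak_derivative _ _ X -> _]eq_fun do rewrite mulr1 mul0r addr0.
have lcos := @locally_constant_comp R U s cos ls.
have lsin := @locally_constant_comp R U s sin ls.
have pc := primitive_on_cos ler01 pH; have ps := primitive_on_sin ler01 pH.
have wcos : weak_derivative U (fun x => cos (H x + s x))
    (fun x => - sin (H x + s x) * h x).
  have := weak_derivative_combination ler01 pc lcos (primitive_onZ (-1) ps) lsin oU UD.
  rewrite (_ : (fun x => cos (H x) * (cos \o s) x + -1 * sin (H x) * (sin \o s) x) =
    (fun x => cos (H x + s x))); last first.
    by apply/funext => x; rewrite cosD /= mulN1r mulNr.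
  rewrite (_ : (fun x => _ + _) = (fun x => - sin (H x + s x) * h x))//.
  by apply/funext => x; rewrite sinD /=; ring.
have wsin : weak_derivative U (fun x => sin (H x + s x))
    (fun x => cos (H x + s x) * h x).
  have := weak_derivative_combination ler01 ps lcos pc lsin oU UD.
  rewrite (_ : (fun x => sin (H x) * (cos \o s) x + cos (H x) * (sin \o s) x) =
    (fun x => sin (H x + s x))); last first.
    by apply/funext => x; rewrite sinD.
  rewrite (_ : (fun x => _ + _) = (fun x => cos (H x + s x) * h x))//.
  by apply/funext => x; rewrite cosD /=; ring.
split.
- by split => //; exists h.
- split.
    by apply: (@square_integrable_bounded _ _ _ 1) => // x _; exact: cos_max.
  exists (fun x => - sin (H x + s x) * h x); split => //.
  apply: (@square_integrableM_bounded _ _ _ _ 1) => //.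
    exact: measurableT_comp.
  by move=> x _; rewrite normrN sin_max.
- split.
    by apply: (@square_integrable_bounded _ _ _ 1) => // x _; exact: sin_max.
  exists (fun x => cos (H x + s x) * h x); split => //.
  by apply: (@square_integrableM_bounded _ _ _ _ 1) => // x _; exact: cos_max.
- exact: wderiv_ae.
Unshelve. all: by end_near. Qed.

Lemma cvg_of_approx (a : nat -> R) :
  (forall e : R, 0 < e -> exists2 b : nat -> R, cvgn b & forall n, `|a n - b n| <= e) ->
  cvgn a.
Proof.
move=> hab; apply/cauchy_cvgP/cauchyP => e e0.
have e40 : 0 < e / 4 by rewrite divr_gt0.
have [b /cvg_ex[l bl] ab] := hab _ e40.
exists l; move/cvgrPdist_lt: bl => /(_ _ e40); apply: filterS => n /= bn.
rewrite /ball/= (le_lt_trans (ler_distD (b n) _ _))//.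
have := ab n; rewrite (distrC (a n)) distrC => abn.
by rewrite (le_lt_trans (lerD (ltW bn) abn))//; lra.
Qed.

End UnitInterval.

(** * The phase of a map *)

Section Phase.
Variable R : realType.
Implicit Types (f g h u v : R -> R) (a b c n x y t : R).
Local Notation mu := (@lebesgue_measure R).
Local Notation D := (`]0, 1[%classic : set R).

(** The derivative of the phase of (u + i v) e^{-i n x}, replaced by 0 where the modulus is too
    small to divide by. *)
Definition phase_density u v u' v' n x :=
  if 4^-1 < u x ^+ 2 + v x ^+ 2 then
    (u x * v' x - v x * u' x) / (u x ^+ 2 + v x ^+ 2) - n
  else 0.

Definition phase_integral u v u' v' n x :=
  \int[mu]_(t in `[0, x]) phase_density u v u' v' n t.

(* The argument of [(u + i v) e^{- i (H + n x)}], where [H] is the phase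
   integral; it is constant on the intervals where [|u + i v|^2 > 1 / 4]. *)
Definition phase_shift u v u' v' n x :=
  let phi := phase_integral u v u' v' n x + n * x in
  let s := (Num.sqrt (u x ^+ 2 + v x ^+ 2))^-1 in
  angle ((u x * cos phi + v x * sin phi) * s)
        ((v x * cos phi - u x * sin phi) * s).

Let unit_vector (p q phi : R) : let s := (Num.sqrt (p ^+ 2 + q ^+ 2))^-1 in
  p ^+ 2 + q ^+ 2 != 0 ->
  ((p * cos phi + q * sin phi) * s) ^+ 2 +
    ((q * cos phi - p * sin phi) * s) ^+ 2 = 1.
Proof.
move=> s r0.
have -> : ((p * cos phi + q * sin phi) * s) ^+ 2 + ((q * cos phi - p * sin phi) * s) ^+ 2
  = (p ^+ 2 + q ^+ 2) * s ^+ 2 * (cos phi ^+ 2 + sin phi ^+ 2) by ring.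
rewrite cos2Dsin2 mulr1 exprVn sqr_sqrtr ?divff//.
by rewrite addr_ge0 ?sqr_ge0.
Qed.

Lemma phase_shift_bounded u v u' v' n x : `|phase_shift u v u' v' n x| <= pi.
Proof.
rewrite /phase_shift; set phi := phase_integral _ _ _ _ _ _ + _.
apply: angle_bounded.
(* At a zero of u + i v the inverse of 0 is 0, so [angle] receives 0, which is in the range of its
   bound. *)
have [r0|r0] := eqVneq (u x ^+ 2 + v x ^+ 2) 0.
  by rewrite r0 sqrtr0 invr0 mulr0 normr0.
have sq1 (p q : R) : p ^+ 2 + q ^+ 2 = 1 -> `|p| <= 1.
  move=> pq; rewrite ler_norml; have q0 := sqr_ge0 q.
  by apply/andP; split; nra.
exact: sq1 (unit_vector phi r0).
Qed.

(** This holds wherever u + i v is nonzero, even where the density is cut off, because the shift is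
    the argument left over at that point. *)
Lemma phase_polar u v u' v' n x : u x ^+ 2 + v x ^+ 2 != 0 ->
  let t := phase_integral u v u' v' n x + phase_shift u v u' v' n x + n * x in
  u x = Num.sqrt (u x ^+ 2 + v x ^+ 2) * cos t /\
  v x = Num.sqrt (u x ^+ 2 + v x ^+ 2) * sin t.
Proof.
move=> r0 t; set phi := phase_integral u v u' v' n x + n * x.
have -> : t = phi + phase_shift u v u' v' n x by rewrite /t addrAC.
have e := unit_vector phi r0.
rewrite /phase_shift -/phi; clearbody phi; clear t.
rewrite cosD sinD cos_angle// sin_angle//.
set rho := Num.sqrt _.
have rho0 : rho != 0.
  by rewrite gt_eqF// sqrtr_gt0 lt_def r0 addr_ge0 ?sqr_ge0.
have c2 := cos2Dsin2 phi.
have {}c2 : cos phi ^+ 2 = 1 - sin phi ^+ 2 by rewrite -c2 addrK.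
by split; field: c2.
Qed.

(** Integrate |h| <= t h^2 + 1/t. Optimising in [t] would give the exponent 1/2; for equicontinuity
    a small fixed [t] is enough. *)
Lemma primitive_Hoelder h C : square_integrable D h ->
  \int[mu]_(x in D) (h x ^+ 2) <= C ->
  forall x y t, 0 < t -> 0 <= x -> x <= y -> y <= 1 ->
    `|\int[mu]_(s in `[0, y]) h s - \int[mu]_(s in `[0, x]) h s| <=
      t * C + t^-1 * (y - x).
Proof.
move=> sh hC x y t t0 x0 xy y1.
have mD : measurable D by [].
have Ih := rintegrable_oo_cc (square_integrable_rintegrable mD (measure_unit R) sh).
have Ih2 := rintegrable_oo_cc (square_integrable_sqr mD sh).
rewrite (primitive_on_int Ih).2//.
have I1 := rintegrable_subitv x0 y1 Ih.
have I2 := rintegrable_subitv x0 y1 Ih2.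
have Ic : rintegrable `[x, y] (fun=> t^-1).
  exact/continuous_rintegrable/continuous_subspaceT/cst_continuous.
have mI : measurable (`[x, y]%classic : set R) by exact: measurable_itv.
apply: (@le_trans _ _ (\int[mu]_(s in `[x, y]) (t * h s ^+ 2 + t^-1))).
  apply: le_norm_Rintegral => //.
    by apply: rintegrableD => //; exact: rintegrableZ.
  move=> s _; rewrite -(real_normK (num_real (h s))) -(ler_pM2l t0) mulrDr divff ?gt_eqF//.
  have := sqr_ge0 (t * `|h s| - 1); have := normr_ge0 (h s).
  by move: `|h s| => z z0 ?; nra.
rewrite RintegralD//; last exact: rintegrableZ.
rewrite RintegralZl// Rintegral_cc_cst// lerD2r ler_wpM2l ?(ltW t0)//.
apply: le_trans hC; rewrite [leRHS]Rintegral_oo_cc; last exact: square_integrable_sqr.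
by apply: le_Rintegral_subitv => // s; exact: sqr_ge0.
Qed.

Section OneMap.
Variables (u v u' v' : R -> R) (n om eps C0 C1 c c2 : R).
Let r x := u x ^+ 2 + v x ^+ 2.
Let e x := eps / 2 * (u' x ^+ 2 + v' x ^+ 2) + (4 * eps)^-1 * (r x - 1) ^+ 2.
Let j x := u x * v' x - v x * u' x.
Hypothesis eps_gt0 : 0 < eps.
Hypothesis u_prim : forall a b, 0 < a -> a <= b -> b < 1 -> primitive_on a b u u'.
Hypothesis v_prim : forall a b, 0 < a -> a <= b -> b < 1 -> primitive_on a b v v'.
Hypothesis continuous_u : forall t, 0 < t -> t < 1 -> {for t, continuous u}.
Hypothesis continuous_v : forall t, 0 < t -> t < 1 -> {for t, continuous v}.
Hypothesis measurable_u' : measurable_fun D u'.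
Hypothesis measurable_v' : measurable_fun D v'.
Hypothesis int_e : rintegrable D e.
Hypothesis e_le : \int[mu]_(x in D) e x <= C0.
Hypothesis int_j : rintegrable D (fun x => (j x - om) ^+ 2).
Hypothesis j_le : \int[mu]_(x in D) ((j x - om) ^+ 2) <= C1.
Hypothesis om_n : `|om - n| <= c.
Hypothesis om_eps : om ^+ 2 * eps <= c2.

Lemma continuous_measurable_unit f :
  (forall t, 0 < t -> t < 1 -> {for t, continuous f}) -> measurable_fun D f.
Proof.
move=> cf; apply: open_continuous_measurable_fun; first exact: interval_open.
by move=> x; rewrite inE/= in_itv/= => /andP[]; exact: cf.
Qed.

Let mu_ : measurable_fun D u := continuous_measurable_unit continuous_u.
Let mv_ : measurable_fun D v := continuous_measurable_unit continuous_v.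

Let mr : measurable_fun D r.
Proof. by apply: measurable_funD; exact: measurable_funX. Qed.

Lemma int_potential : rintegrable D (fun x => (r x - 1) ^+ 2) /\
  \int[mu]_(x in D) ((r x - 1) ^+ 2) <= 4 * eps * C0.
Proof.
have re x : (r x - 1) ^+ 2 <= 4 * eps * e x.
  have -> : 4 * eps * e x = 4 * eps * (eps / 2 * (u' x ^+ 2 + v' x ^+ 2)) + (r x - 1) ^+ 2.
    by rewrite /e; field; rewrite gt_eqF.
  have e2 : 0 <= eps / 2 by rewrite divr_ge0// ltW.
  rewrite lerDr; apply: mulr_ge0; first by rewrite mulr_ge0// ltW.
  by apply: mulr_ge0 => //; rewrite addr_ge0 ?sqr_ge0.
have Ir : rintegrable D (fun x => (r x - 1) ^+ 2).
  apply: (@le_rintegrable _ _ _ (fun x => 4 * eps * e x)) => //.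
  - by apply: measurable_funX; exact: measurable_funB.
  - by move=> x _; rewrite ger0_norm ?sqr_ge0.
  - exact: rintegrableZ.
split => //; apply: (@le_trans _ _ (\int[mu]_(x in D) (4 * eps * e x))).
  by apply: le_Rintegral => //; exact: rintegrableZ.
by rewrite RintegralZl// ler_wpM2l// mulr_ge0// ltW.
Qed.

Local Notation h := (phase_density u v u' v' n).
Local Notation H := (phase_integral u v u' v' n).
Local Notation S := (phase_shift u v u' v' n).

(** Off the cut-off, h = (j - om) / r + om (1 - r) / r + (om - n), where 1 / r <= 4. The factor 3
    for the square of a sum of three terms and 16 for 1 / r^2 make 48. The potential has integral at
    most 4 eps C0, so that the middle term gives 48 * 4 = 192 once om^2 eps is bounded by [c2]. *)
Lemma phase_density_L2 : square_integrable D h /\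
  \int[mu]_(x in D) (h x ^+ 2) <= 48 * C1 + 192 * c2 * C0 + 3 * c ^+ 2.
Proof.
have mD : measurable D by [].
have [Ir r_le] := int_potential.
pose B x := 48 * (j x - om) ^+ 2 + (48 * om ^+ 2 * (r x - 1) ^+ 2 + 3 * c ^+ 2).
have Ic : rintegrable D (fun=> 3 * c ^+ 2).
  by apply: (@rintegrable_bounded _ _ _ `|3 * c ^+ 2|) => //; exact: measure_unit.
have Irz : rintegrable D (fun x => 48 * om ^+ 2 * (r x - 1) ^+ 2) by exact: rintegrableZ.
have Ijz : rintegrable D (fun x => 48 * (j x - om) ^+ 2) by exact: rintegrableZ.
have IB : rintegrable D B by do 2 apply: rintegrableD => //.
have mh : measurable_fun D h.
  apply: measurable_fun_if_on => //.
  - by apply: measurable_fun_ltr.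
  - apply: measurable_funB => //; apply: measurable_funM.
      by apply: measurable_funB; exact: measurable_funM.
    rewrite (_ : (fun x => _) = fun x => r x `^ (-1)); last first.
      by apply/funext => x; rewrite powR_inv1// addr_ge0 ?sqr_ge0.
    exact: measurableT_comp (measurable_powR (-1)) mr.
have hB x : h x ^+ 2 <= B x.
  rewrite /h /B -/(r x) -/(j x); case: ifPn => [r4|_]; last first.
    rewrite expr0n/=; have s1 := sqr_ge0 (j x - om); have s2 := sqr_ge0 c.
    have s3 : 0 <= om ^+ 2 * (r x - 1) ^+ 2 by rewrite mulr_ge0 ?sqr_ge0.
    by rewrite -(mulrA 48); lra.
  have r0 : 0 < r x by rewrite (lt_trans _ r4)// invr_gt0.
  have -> : j x / r x - n = (j x - om) / r x + om * (1 - r x) / r x + (om - n).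
    by field; rewrite gt_eqF.
  have sq3 (p q w : R) : (p + q + w) ^+ 2 <= 3 * (p ^+ 2 + q ^+ 2 + w ^+ 2).
    by have := sqr_ge0 (p - q); have := sqr_ge0 (q - w); have := sqr_ge0 (p - w); nra.
  apply: (le_trans (sq3 _ _ _)).
  have ir : (r x)^-1 ^+ 2 <= 16.
    have : (r x)^-1 <= 4 by rewrite -[leRHS]invrK lef_pV2 ?posrE ?invr_gt0// ltW.
    have : 0 < (r x)^-1 by rewrite invr_gt0.
    by move: (r x)^-1 => z *; nra.
  have k1 : ((j x - om) / r x) ^+ 2 <= 16 * (j x - om) ^+ 2.
    by rewrite exprMn mulrC ler_wpM2r ?sqr_ge0.
  have k2 : (om * (1 - r x) / r x) ^+ 2 <= 16 * (om ^+ 2 * (r x - 1) ^+ 2).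
    rewrite [X in X <= _](_ : _ = (r x)^-1 ^+ 2 * (om ^+ 2 * (r x - 1) ^+ 2)); last by ring.
    by apply: ler_wpM2r => //; rewrite mulr_ge0 ?sqr_ge0.
  have k3 : (om - n) ^+ 2 <= c ^+ 2.
    by rewrite -(real_normK (num_real _)) lerXn2r ?nnegrE// (le_trans _ om_n).
  by lra.
have sh : square_integrable D h by exact: le_square_integrable IB.
split => //; apply: (@le_trans _ _ (\int[mu]_(x in D) B x)).
  by apply: le_Rintegral => //; exact: square_integrable_sqr.
have cstE : \int[mu]_(x in D) (3 * c ^+ 2) = 3 * c ^+ 2.
  by rewrite Rintegral_oo_cc// Rintegral_cc_cst// subr0 mulr1.
have I2 : rintegrable D (fun x => 48 * om ^+ 2 * (r x - 1) ^+ 2 + 3 * c ^+ 2).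
  exact: rintegrableD.
rewrite (RintegralD _ Ijz I2)// (RintegralD _ Irz Ic)// cstE.
rewrite (RintegralZl (mu := mu) _ mD int_j) (RintegralZl (mu := mu) _ mD Ir).
rewrite addrA lerD2r lerD ?ler_wpM2l//.
apply: (@le_trans _ _ (48 * om ^+ 2 * (4 * eps * C0))).
  by rewrite ler_wpM2l// mulr_ge0 ?sqr_ge0.
have C00 : 0 <= C0.
  apply: le_trans e_le; apply: Rintegral_ge0 => x _.
  have e4 : 0 <= (4 * eps)^-1 by rewrite invr_ge0 mulr_ge0// ltW.
  have e2 : 0 <= eps / 2 by rewrite divr_ge0// ltW.
  by apply: addr_ge0; apply: mulr_ge0 => //; rewrite ?addr_ge0 ?sqr_ge0.
have -> : 48 * om ^+ 2 * (4 * eps * C0) = 192 * (om ^+ 2 * eps) * C0 by ring.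
by rewrite ler_wpM2r// ler_pM2l.
Qed.

Lemma phase_integral_prim : primitive_on 0 1 H h.
Proof.
apply: primitive_on_int; apply: rintegrable_oo_cc.
apply: square_integrable_rintegrable => //; first exact: measure_unit.
exact: phase_density_L2.1.
Qed.

(** On such an interval the density is never cut off, so H + n x has derivative j / r and
    [lifting_constant] applies. *)
Lemma phase_shift_constant a b : 0 < a -> a <= b -> b < 1 ->
  (forall x, a <= x -> x <= b -> 4^-1 < r x) -> S b = S a.
Proof.
move=> a0 ab b1 rab.
have pH : primitive_on a b H h.
  by apply: primitive_on_sub phase_integral_prim; exact: ltW.
have pn : primitive_on a b (fun x => n * x) (fun=> n).
  apply: primitive_on_C1; first exact: cst_continuous.
  by move=> x; apply: is_derive_eq; rewrite /GRing.scale/=; ring.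
have pphi := eq_primitive_on (primitive_onD pH pn) (h := fun x => j x / r x).
have {}pphi : primitive_on a b (fun x => H x + n * x) (fun x => j x / r x).
  by apply: pphi => t at_ tb; rewrite /phase_density -/(r t) rab// subrK.
have r4 x : a <= x -> x <= b -> 4^-1 <= u x ^+ 2 + v x ^+ 2.
  by move=> ax xb; exact/ltW/rab.
have [e1 e2] := lifting_constant ab (u_prim a0 ab b1) (v_prim a0 ab b1) r4 pphi ab (lexx b).
by rewrite /phase_shift e1 e2.
Qed.

End OneMap.
End Phase.

(** * Compactness of the phases *)

Section PhaseLimit.
Variable R : realType.
Implicit Types (f g h : R -> R) (a b x y z t e : R) (P : seq R).
Local Notation mu := (@lebesgue_measure R).
Local Notation D := (`]0, 1[%classic : set R).

Definition far_from P e : set R :=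
  [set z | [/\ 0 < z, z < 1 & forall p, p \in P -> e < `|z - p|]].

Lemma open_far_from P e : open (far_from P e).
Proof.
have -> : far_from P e = D `&` [set z | forall p, p \in P -> e < `|z - p|].
  apply/seteqP; split => z /=; rewrite in_itv/=; first by move=> [-> ->].
  by move=> [/andP[]].
apply: openI; first exact: interval_open.
elim: P => [|p P IH].
  rewrite (_ : [set z | _] = setT); first exact: openT.
  by apply/seteqP; split.
rewrite (_ : [set z | _] = [set z | e < `|z - p|] `&`
    [set z | forall p, p \in P -> e < `|z - p|]); last first.
  apply/seteqP; split => z /=.
    move=> hz; split; first by apply: hz; exact: mem_head.
    by move=> q qP; apply: hz; rewrite in_cons qP orbT.
  by move=> [hp hP] q; rewrite in_cons => /orP[/eqP->|/hP].
apply: openI => //.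
rewrite (_ : [set z | e < `|z - p|] = (fun z => `|z - p|) @^-1` [set x | e < x])//.
apply: open_comp; last exact: open_gt.
move=> z _; apply: cvg_norm; apply: cvgB; [exact: cvg_id|exact: cvg_cst].
Qed.

(** A finite set that misses a closed set is at positive distance from it. Points of [P] outside (0,
    1) are missed as well, because [K] lies inside. *)
Lemma closed_far_from P (K : set R) : closed K ->
  K `<=` D `\` ([set` P] `&` D) -> exists2 e, 0 < e & K `<=` far_from P e.
Proof.
move=> cK KP.
have {}KP z : K z -> [/\ 0 < z, z < 1 & z \notin P].
  move=> /KP[/=]; rewrite in_itv/= => /andP[z0 z1] h; split => //.
  by apply/negP => zP; apply: h; split; [exact: zP|apply/andP; rewrite z0].
suff [e e0 he] : exists2 e, 0 < e & forall z p, K z -> p \in P -> e < `|z - p|.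
  by exists e => // z Kz; have [z0 z1 _] := KP z Kz; split => // p; exact: he.
have {KP} : forall p, p \in P -> ~ K p by move=> p pP /KP[_ _]; rewrite pP.
elim: P => [|p P IH] hP; first by exists 1.
have [|e e0 he] := IH; first by move=> q qP; apply: hP; rewrite in_cons qP orbT.
have : nbhs p (~` K).
  by apply: open_nbhs_nbhs; split; [exact: closed_openC|apply: hP; exact: mem_head].
move=> /nbhs_ballP[d /= d0 hd].
exists (Num.min e (d / 2)); first by rewrite lt_min e0 divr_gt0.
move=> z q Kz; rewrite in_cons gt_min => /orP[/eqP->|qP]; last by rewrite he.
apply/orP; right; rewrite ltNge; apply/negP => zp.
apply: (hd z) Kz; rewrite /ball/= distrC (le_lt_trans zp)//.
by rewrite ltr_pdivrMr// ltr_pMr// ltr1n.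
Qed.

Lemma finite_compl_far_from P x : (D `\` ([set` P] `&` D)) x ->
  exists2 e, 0 < e & far_from P e x.
Proof.
move=> Dx; have [||e e0 he] := @closed_far_from P [set x].
- by apply: compact_closed; [exact: Rhausdorff|exact: compact_set1].
- by move=> z ->.
by exists e => //; exact: he.
Qed.

Lemma rational_near x e : 0 <= x -> x <= 1 -> 0 < e ->
  exists q : rat, [/\ 0 < ratr q :> R, ratr q < 1 :> R & `|x - ratr q| < e].
Proof.
move=> x0 x1 e0.
have [|q] := @rat_in_itvoo R (Num.max 0 (x - e)) (Num.min 1 (x + e)).
  by rewrite gt_max !lt_min; apply/andP; split; apply/andP; split; lra.
rewrite in_itv/= gt_max lt_min => /andP[/andP[q0 qe] /andP[q1 qe']].
by exists q; split => //; rewrite ltr_distlC qe.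
Qed.

(** The pairs of a boolean and a rational are countable, so one extraction serves two families: the
    phase integrals and the shifts. *)
Lemma rational_subsequence (f : bool -> rat -> nat -> R) :
  (forall (b : bool) q, bounded_fun (f b q)) ->
  exists2 s : nat -> nat, increasing_seq s & forall (b : bool) q, cvgn (f b q \o s).
Proof.
move=> bf.
pose g k := if unpickle k is Some (b, q) then f b q else fun=> 0.
have [k|s si cs] := @diagonal_subsequence R g.
  rewrite /g; case: unpickle => [[b q]|]; first exact: bf.
  exists 0; split; first exact: num_real.
  by move=> M M0 n _ /=; rewrite normr0 ltW.
by exists s => // b q; have := cs (pickle (b, q)); rewrite /g pickleK.
Qed.

Lemma near_subseq (s : nat -> nat) (Q : nat -> Prop) : increasing_seq s ->
  (\forall l \near \oo, Q l) -> \forall l \near \oo, Q (s l).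
Proof.
move=> si [N _ hN]; exists N => // l /= Nl.
by apply: hN => /=; exact: leq_trans Nl (increasing_seq_ge si l).
Qed.

Lemma cvg_subseq (s : nat -> nat) (a : nat -> R) (c : R) : increasing_seq s ->
  a @ \oo --> c -> (a \o s) @ \oo --> c.
Proof.
move=> si /cvgrPdist_lt ac; apply/cvgrPdist_lt => e /ac.
exact: (near_subseq si).
Qed.

Lemma square_integrable_patch U E f : measurable U -> (mu U < +oo)%E ->
  measurable E -> square_integrable U f -> square_integrable E (f \_ U).
Proof.
move=> mU Uoo mE sf; apply: sqr_square_integrable.
  apply: rintegrable_measurable.
  apply: (@rintegrableS _ _ setT) => //.
  exact/rintegrable_patch/square_integrable_rintegrable.
have -> : (fun x => (f \_ U) x ^+ 2) = (fun x => f x ^+ 2) \_ U.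
  by apply/funext => x; rewrite !patchE; case: ifP => // _; rewrite expr0n.
apply: (@rintegrableS _ _ setT) => //.
exact/rintegrable_patch/square_integrable_sqr.
Qed.

Lemma measurable_fun_finite (N : set R) f : finite_set N -> measurable_fun N f.
Proof.
move=> fN _ Y mY; apply: countable_measurable; first by move=> t; exact: measurable_set1.
by apply/finite_set_countable; apply: sub_finite_set fN; exact: subIsetl.
Qed.

Lemma ge0_integral_finite_compl U N f : measurable U -> finite_set N ->
  measurable_fun (U `\` N) f -> (forall x, 0 <= f x) ->
  (\int[mu]_(x in U) (f x)%:E = \int[mu]_(x in U `\` N) (f x)%:E)%E.
Proof.
move=> mU fN mf f0.
have mN : measurable N.
  apply: countable_measurable; first by move=> t; exact: measurable_set1.
  exact: finite_set_countable.
apply: ge0_negligible_integral => //.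
- apply: measurable_EFin; rewrite -(setDUK (@subIsetl _ U N)) setUC.
  have mI : measurable (U `&` N) by exact: measurableI.
  have mDI : measurable (U `\` (U `&` N)) by exact: measurableD.
  rewrite measurable_funU//; split; first by rewrite setDIr setDv set0U.
  by apply: measurable_fun_finite; apply: sub_finite_set fN; exact: subIsetr.
- by move=> x _; rewrite lee_fin.
- exact/countable_lebesgue_measure0/finite_set_countable.
Qed.

Lemma locally_constantS (U V : set R) s : U `<=` V -> locally_constant V s ->
  locally_constant U s.
Proof. by move=> UV lc x /UV; exact: lc. Qed.

Lemma dominated_Rintegral_near U (f_ : nat -> R -> R) f g : measurable U ->
  (\forall n \near \oo, measurable_fun U (f_ n)) -> measurable_fun U f ->
  (forall x, U x -> (f_ ^~ x) @ \oo --> f x) ->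
  rintegrable U g ->
  (\forall n \near \oo, forall x, U x -> `|f_ n x| <= g x) ->
  (fun n => \int[mu]_(x in U) f_ n x) @ \oo --> \int[mu]_(x in U) f x.
Proof.
move=> mU [N1 _ h1] mf ff Ig [N2 _ h2].
rewrite -(cvg_shiftn (maxn N1 N2)).
apply: (dominated_Rintegral (f_ := fun n => f_ (n + maxn N1 N2)%N) (g := g)) => //.
- by move=> n; apply: h1 => /=; rewrite (leq_trans (leq_maxl N1 N2))// leq_addl.
- by move=> x Ux; have := ff x Ux; rewrite -(cvg_shiftn (maxn N1 N2)).
- by move=> n x Ux; apply: h2 => //=; rewrite (leq_trans (leq_maxr N1 _))// leq_addl.
Qed.

(** Extending the derivative of [psi] by 0 makes the derivative term a pairing on all of (0, 1),
    where the weak L^2 convergence of the densities is available. *)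
Lemma H1_inner_split U f k psi : open U -> U `<=` D ->
  H1 U f -> square_integrable D k -> H1 U psi ->
  {ae mu, forall x, U x -> wderiv U f x = k x} ->
  H1_inner U f psi = \int[mu]_(x in U) (f x * psi x) +
    \int[mu]_(x in D) (k x * (wderiv U psi \_ U) x).
Proof.
move=> oU UD Hf sk Hpsi ae.
have mU := open_measurable oU.
have [sw _] := wderivP Hpsi; have [sf' _] := wderivP Hf.
have skU : square_integrable U k by exact: square_integrableS sk.
have I1 := square_integrableM_rintegrable mU Hf.1 Hpsi.1.
have I2 := square_integrableM_rintegrable mU skU sw.
have I3 := square_integrableM_rintegrable mU sf' sw.
transitivity (\int[mu]_(x in U) (f x * psi x + k x * wderiv U psi x)).
  rewrite /H1_inner /Rintegral; congr fine; apply: ae_eq_integral => //.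
  - exact: (measurable_EFin (rintegrable_measurable (rintegrableD mU I1 I3))).
  - exact: (measurable_EFin (rintegrable_measurable (rintegrableD mU I1 I2))).
  - case: ae => N1 [mN1 N10 sN1]; exists N1; split => // x /= nP.
    by apply: sN1 => /= e; apply: nP => Ux; rewrite (e Ux).
rewrite RintegralD//; congr (_ + _).
rewrite (@Rintegral_supp _ U D)//.
  by apply: eq_Rintegral => x xU; rewrite patchE xU.
by move=> x _ Ux; rewrite patchE memNset// mulr0.
Qed.

End PhaseLimit.

(** * Extraction of a subsequence and identification of its limits *)

Section Compactness.
Variable R : realType.
Implicit Types (f g h : R -> R) (a b x y z t : R).
Local Notation mu := (@lebesgue_measure R).
Local Notation D := (`]0, 1[%classic : set R).

Variables (u v u' v' : nat -> R -> R) (eps n om : nat -> R) (C0 C1 c c2 : R).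
Local Notation r l x := (u l x ^+ 2 + v l x ^+ 2).
Hypothesis eps_gt0 : forall l, 0 < eps l.
Hypothesis eps_cvg0 : eps @ \oo --> 0.
Hypothesis u_prim : forall l a b, 0 < a -> a <= b -> b < 1 ->
  primitive_on a b (u l) (u' l).
Hypothesis v_prim : forall l a b, 0 < a -> a <= b -> b < 1 ->
  primitive_on a b (v l) (v' l).
Hypothesis continuous_u : forall l t, 0 < t -> t < 1 -> {for t, continuous (u l)}.
Hypothesis continuous_v : forall l t, 0 < t -> t < 1 -> {for t, continuous (v l)}.
Hypothesis measurable_u' : forall l, measurable_fun D (u' l).
Hypothesis measurable_v' : forall l, measurable_fun D (v' l).
Hypothesis int_e : forall l, rintegrable D (fun x =>
  eps l / 2 * (u' l x ^+ 2 + v' l x ^+ 2) + (4 * eps l)^-1 * (r l x - 1) ^+ 2).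
Hypothesis e_le : forall l, \int[mu]_(x in D) (eps l / 2 * (u' l x ^+ 2 + v' l x ^+ 2)
  + (4 * eps l)^-1 * (r l x - 1) ^+ 2) <= C0.
Hypothesis int_j : forall l, rintegrable D (fun x =>
  (u l x * v' l x - v l x * u' l x - om l) ^+ 2).
Hypothesis j_le : forall l, \int[mu]_(x in D)
  ((u l x * v' l x - v l x * u' l x - om l) ^+ 2) <= C1.
Hypothesis om_n : forall l, `|om l - n l| <= c.
Hypothesis om_eps : forall l, om l ^+ 2 * eps l <= c2.
Variable P : seq R.
Hypothesis good : forall e : R, 0 < e -> \forall l \near \oo,
  forall z, 0 < z -> z < 1 -> (forall p, p \in P -> e <= `|z - p|) -> 4^-1 < r l z.

Local Notation h := (fun l => phase_density (u l) (v l) (u' l) (v' l) (n l)).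
Local Notation H := (fun l => phase_integral (u l) (v l) (u' l) (v' l) (n l)).
Local Notation S := (fun l => phase_shift (u l) (v l) (u' l) (v' l) (n l)).
Local Notation Om := (D `\` ([set` P] `&` D)).

Let Ch := 48 * C1 + 192 * c2 * C0 + 3 * c ^+ 2.

Let sh l : square_integrable D (h l) /\ \int[mu]_(x in D) (h l x ^+ 2) <= Ch.
Proof.
exact: (phase_density_L2 (eps_gt0 l) (@continuous_u l) (@continuous_v l) (measurable_u' l)
    (measurable_v' l) (int_e l) (e_le l) (int_j l) (j_le l) (om_n l) (om_eps l)).
Qed.

Let Ch0 : 0 <= Ch.
Proof.
by apply: le_trans (sh 0%N).2; apply: Rintegral_ge0 => x _; exact: sqr_ge0.
Qed.

Let pH l : primitive_on 0 1 (H l) (h l).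
Proof.
exact: (phase_integral_prim (eps_gt0 l) (@continuous_u l) (@continuous_v l) (measurable_u' l)
    (measurable_v' l) (int_e l) (e_le l) (int_j l) (j_le l) (om_n l) (om_eps l)).
Qed.

Let H_bounded l x : 0 <= x -> x <= 1 -> `|H l x| <= Ch + 1.
Proof.
move=> x0 x1; have := primitive_Hoelder (sh l).1 (sh l).2 ltr01 (lexx 0) x0 x1.
rewrite invr1 !mul1r set_itv1 Rintegral_set1 !subr0 => /le_trans; apply.
by rewrite lerD2l.
Qed.

Let H_equicontinuous (e : R) : 0 < e -> exists2 d : R, 0 < d &
  forall l x y, 0 <= x -> x <= 1 -> 0 <= y -> y <= 1 -> `|x - y| < d ->
    `|H l x - H l y| <= e.
Proof.
(* Half of [e] goes to t Ch and half to (y - x) / t; the + 1 covers Ch = 0. *)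
move=> e0; pose t := e / (2 * (Ch + 1)).
have C10 : 0 < 2 * (Ch + 1) by rewrite mulr_gt0// ltr_wpDl.
have t0 : 0 < t by rewrite divr_gt0.
exists (t * (e / 2)) => [|l]; first by rewrite mulr_gt0// divr_gt0.
have main x y : 0 <= x -> x <= y -> y <= 1 -> y - x < t * (e / 2) ->
    `|H l y - H l x| <= e.
  move=> x0 xy y1 d.
  have := primitive_Hoelder (sh l).1 (sh l).2 t0 x0 xy y1.
  move=> /le_trans; apply; rewrite [leRHS]splitr lerD//.
    rewrite /t mulrAC ler_pdivrMr// -mulrA ler_pM2l//.
    by rewrite mulrA mulVf// mul1r lerDl.
  by rewrite ler_pdivrMl// ltW.
move=> x y x0 x1 y0 y1 xy; have [le_xy|/ltW le_yx] := leP x y.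
  by rewrite distrC main//; rewrite distrC ger0_norm ?subr_ge0 in xy.
by rewrite main//; rewrite ger0_norm ?subr_ge0 in xy.
Qed.

Let S_near_constant (e : R) : 0 < e -> \forall l \near \oo,
  forall x y, 0 < x -> x <= y -> y < 1 ->
    (forall z p, x <= z -> z <= y -> p \in P -> e <= `|z - p|) -> S l y = S l x.
Proof.
move=> e0; apply: filterS (good e0) => l gl x y x0 xy y1 far.
apply: (phase_shift_constant (eps_gt0 l) (@u_prim l) (@v_prim l) (@continuous_u l)
  (@continuous_v l) (measurable_u' l) (measurable_v' l) (int_e l) (e_le l)
  (int_j l) (j_le l) (om_n l) (om_eps l)) => // z xz zy.
apply: gl; first exact: lt_le_trans xz.
- exact: le_lt_trans y1.
- by move=> p; exact: far.
Qed.

(** A ball contains the segment from its centre to any of its points, and the shift is constant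
    along it. The rank depends on [e] alone, not on the ball. *)
Let S_ball (e : R) : 0 < e -> \forall l \near \oo,
  forall x d, ball x d `<=` far_from P e -> forall y, ball x d y -> S l y = S l x.
Proof.
move=> e0; apply: filterS (S_near_constant e0) => l hl x d hd y xy.
have [y0 y1 _] := hd _ xy; rewrite /ball/= in xy.
have [x0 x1 _] : far_from P e x.
  by apply: hd; apply: ballxx; rewrite (le_lt_trans _ xy).
have [le_xy|/ltW le_yx] := leP x y; last apply/esym; apply: hl => //.
  move=> z p xz zy pP; have [|_ _ /(_ p pP)/ltW//] := hd z.
  rewrite /ball/= distrC ger0_norm ?subr_ge0// (le_lt_trans _ xy)//.
  by rewrite distrC ger0_norm ?subr_ge0// lerD2r.
move=> z p yz zx pP; have [|_ _ /(_ p pP)/ltW//] := hd z.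
rewrite /ball/= ger0_norm ?subr_ge0// (le_lt_trans _ xy)//.
by rewrite ger0_norm ?subr_ge0// lerD2l lerN2.
Qed.

Let far_from_ball e x : far_from P e x ->
  exists2 d, 0 < d & ball x d `<=` far_from P e.
Proof.
move=> fx; apply/nbhs_ballP/open_nbhs_nbhs; split => //; exact: open_far_from.
Qed.

Let S_locally_constant (e : R) : 0 < e -> \forall l \near \oo,
  locally_constant (far_from P e) (S l).
Proof.
move=> e0; apply: filterS (S_ball e0) => l hl x /far_from_ball[d d0 hd].
by apply/nbhs_ballP; exists d => //= y xy; exact: hl xy.
Qed.

(** Convergence at the rationals spreads to every point: by equicontinuity for [H], and for [S]
    because off [P] it eventually equals its value at a nearby rational. *)
Let convergent_subsequence : exists s : nat -> nat, [/\ increasing_seq s,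
  forall x, 0 <= x -> x <= 1 -> cvgn (fun l => H (s l) x) &
  forall x, Om x -> cvgn (fun l => S (s l) x)].
Proof.
(* [H] is bounded on [0, 1], so the other rationals get the constant 0; [S] is bounded
   everywhere. *)
pose f (b : bool) (q : rat) l : R := if b then
  (if (0 <= (ratr q : R)) && ((ratr q : R) <= 1) then H l (ratr q) else 0) else S l (ratr q).
have [b q|s si cs] := @rational_subsequence R f.
  exists (Ch + 1 + pi); split; first exact: num_real.
  move=> M CM l _ /=; apply: le_trans (ltW CM); have pi0 := pi_ge0 R.
  rewrite /f; case: b; last first.
    apply: (le_trans (phase_shift_bounded _ _ _ _ _ _)).
    by rewrite lerDr addr_ge0.
  case: ifP => [/andP[q0 q1]|_]; last first.
    rewrite normr0; apply: addr_ge0 => //; exact: addr_ge0.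
  by apply: (le_trans (H_bounded l q0 q1)); rewrite lerDl.
exists s; split => // x.
- move=> x0 x1; apply: cvg_of_approx => e e0.
  have [d d0 hd] := H_equicontinuous e0.
  have [q [q0 q1 xq]] := rational_near x0 x1 d0.
  exists (fun l => H (s l) (ratr q)).
    have := cs true q; rewrite /f /comp.
    by rewrite (ltW q0) (ltW q1).
  by move=> l; apply: hd => //; exact: ltW.
- move=> /finite_compl_far_from[e e0 fx]; have [d d0 hd] := far_from_ball fx.
  have [x0 x1 _] := fx.
  have [q [q0 q1 xq]] := rational_near (ltW x0) (ltW x1) d0.
  have /cvg_ex[k ck] := cs false q; apply/cvg_ex; exists k.
  apply: cvg_trans ck; apply: near_eq_cvg.
  apply: filterS (near_subseq si (S_ball e0)) => l hl.
  by rewrite /f/=; exact: hl xq.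
Qed.

Let open_Om : open Om.
Proof.
rewrite openE => x /finite_compl_far_from[e e0 fx].
have : nbhs x (far_from P e).
  by apply: open_nbhs_nbhs; split; [exact: open_far_from|exact: fx].
apply: filterS => z [z0 z1 hz]; split; first by rewrite /= in_itv/= z0.
by case=> zP _; have := hz z zP; rewrite subrr normr0 ltNge ltW.
Qed.

Let Om_unit : Om `<=` D.
Proof. by move=> x []. Qed.

Let Om_near x : Om x -> \forall l \near \oo, 4^-1 < r l x.
Proof.
move=> /finite_compl_far_from[e e0 [x0 x1 fx]]; apply: filterS (good e0) => l; apply => //.
by move=> p pP; exact/ltW/fx.
Qed.

Section Subsequence.
Variables (s : nat -> nat) (k : R -> R).
Hypothesis s_incr : increasing_seq s.
Hypothesis cvg_H : forall x, 0 <= x -> x <= 1 ->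
  (fun l => H (s l) x) @ \oo --> \int[mu]_(t in `[0, x]) k t.
Hypothesis cvg_S : forall x, Om x -> cvgn (fun l => S (s l) x).
Hypothesis k_L2 : square_integrable D k.
Hypothesis cvg_h : forall psi, square_integrable D psi ->
  (fun l => \int[mu]_(x in D) (h (s l) x * psi x)) @ \oo -->
  \int[mu]_(x in D) (k x * psi x).

Let Hlim x := \int[mu]_(t in `[0, x]) k t.
Let Slim x := limn (fun l => S (s l) x).
Let theta x := Hlim x + Slim x.
Let theta_ l x := H (s l) x + S (s l) x.

(** Near a point of [Om] the shifts at two points agree from some rank on, so they have the same
    limit. *)
Let Slim_locally_constant : locally_constant Om Slim.
Proof.
move=> x /finite_compl_far_from[e e0 fx]; have [d d0 hd] := far_from_ball fx.
apply/nbhs_ballP; exists d => //= y xy; rewrite /Slim; congr (lim _).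
have E : \forall l \near \oo, S (s l) y = S (s l) x.
  by apply: filterS (near_subseq s_incr (S_ball e0)) => l hl; exact: hl xy.
apply/seteqP; split; apply: near_eq_cvg => //.
by apply: filterS E.
Qed.

Let Slim_bounded x : Om x -> `|Slim x| <= pi.
Proof.
move=> Omx; have cS := cvg_S Omx.
rewrite ler_norml; apply/andP; split.
  apply: limr_ge => //; apply: nearW => l.
  by have := phase_shift_bounded (u (s l)) (v (s l)) (u' (s l)) (v' (s l)) (n (s l)) x;
    rewrite ler_norml => /andP[].
apply: limr_le => //; apply: nearW => l.
by have := phase_shift_bounded (u (s l)) (v (s l)) (u' (s l)) (v' (s l)) (n (s l)) x;
  rewrite ler_norml => /andP[].
Qed.

Let pK : primitive_on 0 1 Hlim k.
Proof.
apply/primitive_on_int/rintegrable_oo_cc/square_integrable_rintegrable => //.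
exact: measure_unit.
Qed.

Let cvg_theta x : Om x -> (theta_ ^~ x) @ \oo --> theta x.
Proof.
move=> Omx; have /Om_unit := Omx; rewrite /= in_itv/= => /andP[x0 x1].
by apply: cvgD; [apply: cvg_H; exact: ltW|exact: cvg_S].
Qed.

Lemma theta_H1 U : open U -> U `<=` Om ->
  [/\ H1 U theta, H1 U (fun x => cos (theta x)), H1 U (fun x => sin (theta x)) &
    {ae mu, forall x, U x -> wderiv U theta x = k x}].
Proof.
move=> oU UO; apply: (phase_H1 (c := pi) oU _ pK k_L2).
- exact: subset_trans UO Om_unit.
- exact: locally_constantS Slim_locally_constant.
- by move=> x /UO; exact: Slim_bounded.
Qed.

Lemma theta_continuous K : compact K -> K `<=` Om -> \forall l \near \oo,
  {within K, continuous (theta_ l)} /\ forall x, K x -> 4^-1 < r (s l) x.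
Proof.
move=> cK KO.
have [|e e0 he] := @closed_far_from R P K _ KO.
  by apply: compact_closed cK; exact: Rhausdorff.
apply: filterS2 (near_subseq s_incr (good e0))
  (near_subseq s_incr (S_locally_constant e0)) => l gl lc.
split => [|x /he[x0 x1 fx]]; last by apply: gl => // p pP; exact/ltW/fx.
apply: continuous_in_subspaceT => x; rewrite inE => /he fx.
apply: cvgD; last exact: locally_constant_continuous lc _ fx.
have [x0 x1 _] := fx.
have := primitive_on_continuous ler01 (pH (s l)).
move=> /(continuous_within_itvP _ ltr01)[+ _ _]; apply.
by rewrite in_itv/= x0.
Qed.

(** The zero-order part of the pairing converges by dominated convergence, the phases being
    uniformly bounded and pointwise convergent. On [U] the derivative of the phase is eventually [h]
    almost everywhere, so the other part is the weak convergence of [h]. *)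
Lemma theta_weak_cvg : weak_cvg_H1loc Om theta_ theta.
Proof.
move=> U oU cU UO; have [e e0 he] := closed_far_from (@closed_closure _ U) UO.
have {}he := subset_trans (@subset_closure _ U) he.
have {}UO := subset_trans (@subset_closure _ U) UO.
have UD := subset_trans UO Om_unit.
have mU := open_measurable oU; have Uoo := measure_sub_unit mU UD.
have nearU : \forall l \near \oo, H1 U (theta_ l) /\
    {ae mu, forall x, U x -> wderiv U (theta_ l) x = h (s l) x}.
  apply: filterS (near_subseq s_incr (S_locally_constant e0)) => l lc.
  have [||? _ _ ?] := @phase_H1 R U (H (s l)) (h (s l)) (S (s l)) pi oU UD (pH (s l)) (sh (s l)).1.
  - exact: locally_constantS lc.
  - by move=> x _; exact: phase_shift_bounded.
  - by [].
have [Ht _ _ wt] := theta_H1 oU UO.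
split => //; first by apply: filterS nearU => l [].
move=> psi Hpsi; have [sw _] := wderivP Hpsi.
have sp : square_integrable D (wderiv U psi \_ U).
  exact: square_integrable_patch.
rewrite (H1_inner_split oU UD Ht k_L2 Hpsi wt).
have E : \forall l \near \oo, \int[mu]_(x in U) (theta_ l x * psi x) +
    \int[mu]_(x in D) (h (s l) x * (wderiv U psi \_ U) x) = H1_inner U (theta_ l) psi.
  apply: filterS nearU => l [Hl wl].
  by rewrite (H1_inner_split oU UD Hl (sh (s l)).1 Hpsi wl).
apply: cvg_trans; first by apply: near_eq_cvg; exact: E.
apply: cvgD; last exact: cvg_h.
apply: (dominated_Rintegral_near (g := fun x => (Ch + 1 + pi) * `|psi x|)) => //.
- apply: filterS nearU => l [[[mt _] _] _].
  exact: measurable_funM mt Hpsi.1.1.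
- exact: measurable_funM Ht.1.1 Hpsi.1.1.
- by move=> x /UO Ox; apply: cvgM; [exact: cvg_theta|exact: cvg_cst].
- apply/rintegrableZ/rintegrable_norm/square_integrable_rintegrable => //.
  exact: Hpsi.1.
- apply: nearW => l x /UD; rewrite /= in_itv/= => /andP[x0 x1].
  rewrite normrM ler_wpM2r// (le_trans (ler_normD _ _))// lerD//.
    by apply: H_bounded; exact: ltW.
  exact: phase_shift_bounded.
Qed.

Let dist l x := (u (s l) x - cos (theta x + n (s l) * x)) ^+ 2 +
  (v (s l) x - sin (theta x + n (s l) * x)) ^+ 2.

Let dist_ge0 l x : 0 <= dist l x.
Proof. by rewrite addr_ge0 ?sqr_ge0. Qed.

(** The squared distance to a unit vector is at most 2 r + 2, which (r - 2)^2 >= 0 bounds by (r -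
    1)^2 + 5. *)
Let dist_le l x : dist l x <= (r (s l) x - 1) ^+ 2 + 5.
Proof.
have := cos2Dsin2 (theta x + n (s l) * x); rewrite /dist.
move: (cos _) (sin _) (u _ x) (v _ x) => b d p q cd.
have := sqr_ge0 (p + b); have := sqr_ge0 (q + d).
have := sqr_ge0 (p ^+ 2 + q ^+ 2 - 2).
by nra.
Qed.

(* With [rho = |u|] and [d] the phase difference, the distance is
   [(rho - 1)^2 + 2 rho (1 - cos d)]. *)
Let dist_phase l x : r (s l) x != 0 ->
  dist l x <= 4 * (r (s l) x - 1) ^+ 2 + (2 * (1 - cos (theta_ l x - theta x)) +
    (1 - cos (theta_ l x - theta x)) ^+ 2).
Proof.
move=> r0; have [] := @phase_polar R (u (s l)) (v (s l)) (u' (s l)) (v' (s l)) (n (s l)) x r0.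
have -> : theta_ l x - theta x = (theta_ l x + n (s l) * x) - (theta x + n (s l) * x).
  by ring.
rewrite -/(theta_ l x) /dist cosB.
move: (theta_ l x + _) (theta x + _) => a b.
have rge : 0 <= r (s l) x by rewrite addr_ge0 ?sqr_ge0.
have := sqr_sqrtr rge; have := sqrtr_ge0 (r (s l) x).
move: (Num.sqrt _) => rho rho0 rE; rewrite -rE => -> ->.
have a1 := cos2Dsin2 a; have b1 := cos2Dsin2 b.
have -> : (rho * cos a - cos b) ^+ 2 + (rho * sin a - sin b) ^+ 2 =
    rho ^+ 2 * (cos a ^+ 2 + sin a ^+ 2) + (cos b ^+ 2 + sin b ^+ 2) -
    2 * rho * (cos a * cos b + sin a * sin b) by ring.
rewrite a1 b1; move: (_ + sin a * sin b) => t.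
have h1 := sqr_ge0 (rho - 1 - (1 - t)).
have h2 : (rho - 1) ^+ 2 <= (rho ^+ 2 - 1) ^+ 2.
  have -> : (rho ^+ 2 - 1) ^+ 2 = (rho - 1) ^+ 2 * (rho + 1) ^+ 2 by ring.
  rewrite ler_peMr ?sqr_ge0//; nra.
by have := sqr_ge0 (rho - 1); nra.
Qed.

(** The part of the error that the potential does not absorb. It is at most 5 and tends to 0 on
    [Om], whereas the potential tends to 0 only in the integral. *)
Let G l x := Num.max 0 (dist l x - 4 * (r (s l) x - 1) ^+ 2).

Let cvg_G x : Om x -> (G ^~ x) @ \oo --> (0 : R).
Proof.
move=> Ox; have cd : (fun l => theta_ l x - theta x) @ \oo --> (0 : R).
  by rewrite -(subrr (theta x)); apply: cvgB; [exact: cvg_theta|exact: cvg_cst].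
have c1 : (fun l => 1 - cos (theta_ l x - theta x)) @ \oo --> (0 : R).
  have -> : (0 : R) = 1 - cos 0 by rewrite cos0 subrr.
  apply: cvgB; first exact: cvg_cst.
  by apply: continuous_cvg cd; exact: continuous_cos.
have c2' : (fun l => 2 * (1 - cos (theta_ l x - theta x)) +
    (1 - cos (theta_ l x - theta x)) ^+ 2) @ \oo --> (0 : R).
  rewrite [X in _ --> X](_ : 0 = 2 * 0 + 0 * 0 :> R); last by rewrite !mulr0 addr0.
  by apply: cvgD; [apply: cvgM => //; exact: cvg_cst|exact: cvgM].
apply: (squeeze_cvgr _ (cvg_cst 0) c2').
apply: filterS (near_subseq s_incr (Om_near Ox)) => l rl.
rewrite /G le_max lexx/= ge_max lerBlDl.
have r0 : r (s l) x != 0 by rewrite gt_eqF// (lt_trans _ rl)// invr_gt0.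
rewrite dist_phase// andbT addr_ge0 ?sqr_ge0// mulr_ge0// subr_ge0.

Qed.

Lemma theta_L2 : (fun l => \int[mu]_(x in D) (dist l x)%:E)%E @ \oo --> (0 : \bar R).
Proof.
have mOm := open_measurable open_Om.
have mD : measurable D by [].
have Omoo := measure_sub_unit mOm Om_unit.
have [Ht _ _ _] := theta_H1 open_Om (@subset_refl _ Om).
have mr l : measurable_fun D (fun x => r (s l) x).
  by apply: measurable_funD; apply: measurable_funX; apply: continuous_measurable_unit;
    [exact: continuous_u|exact: continuous_v].
have mdist l : measurable_fun Om (dist l).
  have mt : measurable_fun Om (fun x => theta x + n (s l) * x).
    by apply: measurable_funD; [exact: Ht.1.1|exact: measurable_funM].
  apply: measurable_funD; apply: measurable_funX; apply: measurable_funB.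
  - apply: measurable_funS (continuous_measurable_unit (@continuous_u (s l))) => //.
  - by apply: measurableT_comp mt; apply: continuous_measurable => //; exact: continuous_cos.
  - apply: measurable_funS (continuous_measurable_unit (@continuous_v (s l))) => //.
  - by apply: measurableT_comp mt; apply: continuous_measurable => //; exact: continuous_sin.
have pot l := int_potential (eps_gt0 (s l)) (@continuous_u (s l)) (@continuous_v (s l))
  (int_e (s l)) (e_le (s l)).
have Ir l : rintegrable Om (fun x => (r (s l) x - 1) ^+ 2).
  by apply: rintegrableS (pot l).1.
have mG l : measurable_fun Om (G l).
  apply: measurable_maxr => //; apply: measurable_funB => //.
  exact: rintegrable_measurable (rintegrableZ _ mOm (Ir l)).
have bG l x : `|G l x| <= 5.
  rewrite ger0_norm ?le_max ?lexx// ge_max ler0n/= lerBlDl.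
  by rewrite (le_trans (dist_le l x))// lerD2r ler_peMl ?sqr_ge0// ler1n.
have IG l : rintegrable Om (G l) by apply: rintegrable_bounded (mG l) (fun x _ => bG l x).
have IF l : rintegrable Om (fun x => G l x + 4 * (r (s l) x - 1) ^+ 2).
  by apply: rintegrableD => //; exact: rintegrableZ.
have dF l x : dist l x <= G l x + 4 * (r (s l) x - 1) ^+ 2.
  by rewrite -lerBlDr le_max lexx orbT.
have Id l : rintegrable Om (dist l).
  apply: le_rintegrable (IF l) => // x _.
  by rewrite ger0_norm.
(* [theta] is controlled on [Om] alone, so measurability of the integrand is known off the finite
   set only. *)
have E l : (\int[mu]_(x in D) (dist l x)%:E = (\int[mu]_(x in Om) dist l x)%:E)%E.
  rewrite (ge0_integral_finite_compl (N := [set` P] `&` D))//; last first.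
    by apply: sub_finite_set (finite_seq P); exact: subIsetl.
  by rewrite /Rintegral fineK//; apply: integrable_fin_num; [exact: mOm|exact: Id].
under eq_cvg do rewrite E.
apply: cvg_EFin; first exact: nearW.
have cG : (fun l => \int[mu]_(x in Om) G l x) @ \oo --> \int[mu]_(x in Om) (cst 0 x : R).
  have I5 : rintegrable Om (fun=> 5 : R).
    by apply: (rintegrable_bounded (c := 5)) => // x _; rewrite ger0_norm.
  apply: dominated_Rintegral I5 _ => //.
rewrite Rintegral_cst// mul0r in cG.
have ce : (fun l => \int[mu]_(x in Om) G l x + 16 * C0 * eps (s l)) @ \oo --> (0 : R).
  rewrite -[X in _ --> X](addr0 0) -[X in _ --> _ + X](mulr0 (16 * C0)); apply: cvgD => //.
  by apply: cvgM; [exact: cvg_cst|exact: cvg_subseq].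
apply: (squeeze_cvgr _ (cvg_cst 0) ce); apply: nearW => l.
rewrite Rintegral_ge0//=.
apply: (@le_trans _ _ (\int[mu]_(x in Om) (G l x + 4 * (r (s l) x - 1) ^+ 2))).
  by apply: le_Rintegral => // x _; exact: dF.
rewrite RintegralD//; last exact: rintegrableZ.
rewrite RintegralZl// lerD2l.
have -> : 16 * C0 * eps (s l) = 4 * (4 * eps (s l) * C0) by ring.
rewrite ler_pM2l//; apply: le_trans (pot l).2.
apply: le_Rintegral_subset => //; first exact: (pot l).1.
by move=> x _; exact: sqr_ge0.
Qed.

End Subsequence.

Theorem phase_compactness : exists (s : nat -> nat) (theta : R -> R) (theta' : nat -> R -> R),
  [/\ increasing_seq s,
    [/\ H1 Om theta, H1 Om (fun x => cos (theta x)) & H1 Om (fun x => sin (theta x))],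
    forall K, compact K -> K `<=` Om -> \forall l \near \oo,
      {within K, continuous (theta' l)} /\ forall x, K x -> 4^-1 < r (s l) x,
    forall l x, r (s l) x != 0 ->
      u (s l) x = Num.sqrt (r (s l) x) * cos (theta' l x + n (s l) * x) /\
      v (s l) x = Num.sqrt (r (s l) x) * sin (theta' l x + n (s l) * x) &
    weak_cvg_H1loc Om theta' theta /\
    (fun l => \int[mu]_(x in D) ((u (s l) x - cos (theta x + n (s l) * x)) ^+ 2 +
      (v (s l) x - sin (theta x + n (s l) * x)) ^+ 2)%:E)%E @ \oo --> (0 : \bar R)].
Proof.
have [s [si cH cS]] := convergent_subsequence.
pose Hlim x := limn (fun l => H (s l) x).
have [|||k [sk kH kw]] := @L2_primitive_limit R (fun l => h (s l)) Ch Hlim.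
- by move=> l; exact: (sh (s l)).1.
- by move=> l; exact: (sh (s l)).2.
- by move=> x x0 x1; exact: cH.
have cvg_H x : 0 <= x -> x <= 1 ->
    (fun l => H (s l) x) @ \oo --> \int[mu]_(t in `[0, x]) k t.
  by move=> x0 x1; rewrite kH//; exact: cH.
exists s, (fun x => \int[mu]_(t in `[0, x]) k t + limn (fun l => S (s l) x)),
  (fun l x => H (s l) x + S (s l) x); split => //.
- by have [] := theta_H1 si cS sk open_Om (@subset_refl _ Om).
- by move=> K; exact: theta_continuous.
- by move=> l x r0; exact: phase_polar.
- by split; [exact: theta_weak_cvg|exact: theta_L2].
Qed.

End Compactness.

(** * Energy bounds *)

Section EnergyBounds.
Variable R : realType.
Implicit Types (f : R -> R) (a b e t x : R) (z : R[i]) (u : R -> R[i]).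
Local Notation mu := (@lebesgue_measure R).
Local Notation D := (`]0, 1[%classic : set R).

Lemma modulusE z : modulus z = Num.sqrt (complex.Re z ^+ 2 + complex.Im z ^+ 2).
Proof. by case: z. Qed.

Lemma modulus_sqr z : modulus z ^+ 2 = complex.Re z ^+ 2 + complex.Im z ^+ 2.
Proof. by rewrite modulusE sqr_sqrtr// addr_ge0 ?sqr_ge0. Qed.

Lemma modulus_expi t : modulus (expi t) = 1.
Proof. by rewrite modulusE/= cos2Dsin2 sqrtr1. Qed.

Lemma modulus_unwind z t : modulus (z * expi t) = modulus z.
Proof. by rewrite /modulus Normc.normcM [X in _ * X]modulus_expi mulr1. Qed.

Lemma unwind_polar z (rho : R) t a :
  complex.Re z = rho * cos (a + t) -> complex.Im z = rho * sin (a + t) ->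
  z * expi (- t) = rho%:C%C * expi a.
Proof.
case: z => p q /= -> ->; rewrite /expi cosN sinN cosD sinD.
have c2 : cos t ^+ 2 = 1 - sin t ^+ 2 by rewrite -(cos2Dsin2 t) addrK.
by apply/eqP; rewrite eq_complex/=; apply/andP; split; apply/eqP; ring: c2.
Qed.

(** A rotation preserves the modulus, so the distance from w to its limit is computed on u, where
    the phase estimates are stated. *)
Lemma unwind_dist z t a : modulus (z * expi (- t) - expi a) ^+ 2 =
  (complex.Re z - cos (a + t)) ^+ 2 + (complex.Im z - sin (a + t)) ^+ 2.
Proof.
have <- : modulus (z - expi (a + t)) ^+ 2 =
  (complex.Re z - cos (a + t)) ^+ 2 + (complex.Im z - sin (a + t)) ^+ 2.
  by rewrite modulus_sqr; case: z.
rewrite -(modulus_unwind (z - _) (- t)) mulrBl; congr (modulus (_ - _) ^+ 2).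
by rewrite (@unwind_polar (expi (a + t)) 1 t a) ?mul1r.
Qed.

Lemma continuous_within_unit f : {within `[0, 1], continuous f} ->
  forall t, 0 < t -> t < 1 -> {for t, continuous f}.
Proof.
move=> /(continuous_within_itvP _ ltr01)[cf _ _] t t0 t1.
by apply: cf; rewrite in_itv/= t0.
Qed.

(** The interval stays inside (0, 1), where continuity within [0, 1] is continuity on the line, as
    the cut-off argument at the endpoints requires. *)
Lemma H1_primitive_on f : H1 D f -> {within `[0, 1], continuous f} ->
  forall a b, 0 < a -> a <= b -> b < 1 -> primitive_on a b f (wderiv D f).
Proof.
move=> Hf cf a b a0 ab b1; have [sg wg] := wderivP Hf.
have mD : measurable D by [].
have If := square_integrable_rintegrable mD (measure_unit R) Hf.1.
have Ig := square_integrable_rintegrable mD (measure_unit R) sg.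
have sub x y : a <= x -> y <= b -> `[x, y]%classic `<=` D.
  by move=> ax yb; apply: subset_itv; rewrite bnd_simp ?(lt_le_trans a0)// (le_lt_trans yb).
split; first by apply: rintegrableS Ig => //; exact: sub.
move=> x y ax + yb; rewrite le_eqVlt => /predU1P[<-|xy].
  by rewrite subrr set_itv1 Rintegral_set1.
apply: (weak_derivative_primitive mD If Ig wg xy (sub _ _ ax yb)).
- apply: continuous_within_unit => //; first exact: lt_le_trans ax.
  by rewrite (lt_le_trans xy)// (le_trans yb)// ltW.
- apply: continuous_within_unit => //; last exact: le_lt_trans b1.
  by rewrite (lt_trans _ xy)// (lt_le_trans a0).
Qed.

(** All parts of the density are nonnegative, so each is dominated by the whole; integrability comes
    from the finite total. *)
Lemma energy_bounds L beta e C0 u : 0 < L -> 0 < e -> H1C D u ->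
  (energy L beta e u <= C0%:E)%E ->
  let u1 := re_part u in let u2 := im_part u in
  let g1 := wderiv D u1 in let g2 := wderiv D u2 in
  let E x := e / 2 * (g1 x ^+ 2 + g2 x ^+ 2) +
    (4 * e)^-1 * (u1 x ^+ 2 + u2 x ^+ 2 - 1) ^+ 2 in
  let J x := (u1 x * g2 x - u2 x * g1 x - 2 * pi * e `^ (- beta)) ^+ 2 in
  [/\ rintegrable D E, \int[mu]_(x in D) E x <= C0,
      rintegrable D J & \int[mu]_(x in D) J x <= 2 * C0 / L].
Proof.
move=> L0 e0 [H1u H2u] en u1 u2 g1 g2 E J.
have mD : measurable D by [].
have [[mg1 _] _] := wderivP H1u; have [[mg2 _] _] := wderivP H2u.
have mu1 := H1u.1.1; have mu2 := H2u.1.1.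
have E0 x : 0 <= E x.
  have e4 : 0 <= (4 * e)^-1 by rewrite invr_ge0 mulr_ge0// ltW.
  have e2 : 0 <= e / 2 by rewrite divr_ge0// ltW.
  by apply: addr_ge0; apply: mulr_ge0 => //; rewrite ?addr_ge0 ?sqr_ge0.
have J0 x : 0 <= J x by exact: sqr_ge0.
have L20 : 0 < L / 2 by rewrite divr_gt0.
have mE : measurable_fun D E.
  apply: measurable_funD; apply: measurable_funM => //.
    by apply: measurable_funD; exact: measurable_funX.
  apply: measurable_funX; apply: measurable_funB => //.
  by apply: measurable_funD; exact: measurable_funX.
have mJ : measurable_fun D J.
  apply: measurable_funX; apply: measurable_funB => //.
  by apply: measurable_funB; exact: measurable_funM.
have enE : energy L beta e u = (\int[mu]_(x in D) (E x + L / 2 * J x)%:E)%E.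
  by apply: eq_integral => x _; rewrite /E /J modulus_sqr.
rewrite {}enE in en.
have F0 x : 0 <= E x + L / 2 * J x by rewrite addr_ge0// mulr_ge0// ltW.
have IF : rintegrable D (fun x => E x + L / 2 * J x).
  apply/integrableP; split.
    apply: measurable_EFin; apply: measurable_funD => //.
    exact: measurable_funM.
  under eq_integral do rewrite /= ger0_norm//.
  exact: le_lt_trans en (ltry _).
have Fle : \int[mu]_(x in D) (E x + L / 2 * J x) <= C0.
  by rewrite -lee_fin /Rintegral fineK//; exact: integrable_fin_num.
have IE : rintegrable D E.
  apply: le_rintegrable IF => // x _; rewrite ger0_norm// lerDl.
  by rewrite mulr_ge0// ltW.
have IJ' : rintegrable D (fun x => L / 2 * J x).
  apply: le_rintegrable IF => //; first exact: measurable_funM.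
  by move=> x _; rewrite ger0_norm ?lerDr// mulr_ge0// ltW.
have IJ : rintegrable D J.
  apply: eq_rintegrable (rintegrableZ (L / 2)^-1 mD IJ') => // x _.
  by rewrite mulKf// gt_eqF.
split => //.
- apply: le_trans Fle; apply: le_Rintegral => // x _.
  by rewrite lerDl mulr_ge0// ltW.
- have : \int[mu]_(x in D) (L / 2 * J x) <= C0.
    by apply: le_trans Fle; apply: le_Rintegral => // x _; rewrite lerDr.
  rewrite RintegralZl// mulrC -ler_pdivlMr// invf_div mulrA.
  by rewrite (mulrC C0).
Qed.

(** The first bound is 2 pi times a fractional part. The second reduces to e^{1 - 2 beta} <= 1,
    which is where beta < 1/2 enters. *)
Lemma winding_bounds beta e : 0 < beta -> beta < 2^-1 -> 0 < e -> e <= 1 ->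
  `|2 * pi * e `^ (- beta) - 2 * pi * winding beta e| <= 2 * pi /\
  (2 * pi * e `^ (- beta)) ^+ 2 * e <= (2 * pi) ^+ 2.
Proof.
move=> b0 b1 e0 e1; have pi0 := pi_gt0 R; split.
  rewrite -mulrBr normrM ger0_norm ?mulr_ge0 ?(ltW pi0)//.
  rewrite ler_piMr ?mulr_ge0 ?(ltW pi0)// ger0_norm ?subr_ge0 ?floor_le//.
  rewrite lerBlDl; have := lt_succ_floor (e `^ (- beta)).
  by rewrite intrD1 addrC => /ltW.
rewrite exprMn -mulrA ler_piMr ?sqr_ge0//.
have -> : (e `^ (- beta)) ^+ 2 * e = e `^ (1 - 2 * beta).
  rewrite -powR_mulrn ?powR_ge0// -powRrM -{2}(powRr1 (ltW e0)) -powRD.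
    by congr (_ `^ _); ring.
  by apply/implyP => _; rewrite gt_eqF.
rewrite -[leRHS](powRr0 e); apply: ger_powR; first by rewrite e0.
lra.
Qed.

End EnergyBounds.

(** Converts a condition on the rank into one on the size of eps. The sequence may fail to be
    monotone, but its first [N] terms have a positive lower bound. *)
Lemma small_index (R : realType) (a : nat -> R) (N : nat) : (forall l, 0 < a l) ->
  exists2 d : R, 0 < d & forall l, a l < d -> (N <= l)%N.
Proof.
move=> a0; elim: N => [|N [d d0 hd]]; first by exists 1.
exists (Num.min d (a N)) => [|l]; first by rewrite lt_min d0 a0.
rewrite lt_min => /andP[/hd Nl al]; rewrite ltn_neqAle Nl andbT.
by apply/eqP => Nl'; rewrite -Nl' ltxx in al.
Qed.

Theorem theorem5p4 (R : realType) (L alpha beta C0 A : R)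
    (u : R -> R -> R[i]) (eps : nat -> R) :
  0 < L ->
  0 <= alpha < 2 * pi ->
  0 < beta < 2^-1 ->
  (forall e : R, 0 < e -> admissible alpha (u e)) ->
  (\forall e \near 0^'+, (energy L beta e (u e) <= C0%:E)%E) ->
  (forall l : nat, 0 < eps l) ->
  eps @ \oo --> 0 ->
  (fun l => eps l `^ (- beta) - winding beta (eps l)) @ \oo --> A ->
  exists (w : R -> R[i]) (J : set R) (s : nat -> nat),
    let Om := `]0, 1[ `\` J in
    let eps' := fun l : nat => eps (s l) in
    let w' := fun l : nat => unwind beta (eps' l) (u (eps' l)) in
    [/\ finite_set J /\ J `<=` `]0, 1[,
        H1S1 Om w,
        increasing_seq s,
        cvg_L2C `]0, 1[ w' w &
        exists (theta : R -> R) (theta' : nat -> R -> R),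
          [/\ H1 Om theta,
              forall x : R, Om x -> w x = expi (theta x),
              forall K : set R, compact K -> K `<=` Om ->
                exists2 eps0 : R, 0 < eps0 &
                  forall l : nat, eps' l < eps0 ->
                    {within K, continuous (theta' l)} /\
                    forall x : R, K x ->
                      [/\ modulus (u (eps' l) x) = modulus (w' l x),
                          0 < modulus (w' l x) &
                          w' l x = (modulus (w' l x))%:C%C * expi (theta' l x)] &
              weak_cvg_H1loc Om theta' theta]].
Proof.
move=> L0 _ /andP[b0 b1] adm en eps0 epsc _.
have H1u e : 0 < e -> H1C `]0, 1[ (u e) by move=> /adm[].
have c1 e : 0 < e -> {within `[0, 1], continuous (re_part (u e))} by move=> /adm[].
have c2 e : 0 < e -> {within `[0, 1], continuous (im_part (u e))} by move=> /adm[].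
(* The energy bound holds for small eps, so the sequence is shifted to start where it holds, where
   eps <= 1 as the winding bounds need, and where eta < 1/2 as the cover of the bad points needs. *)
have [N0 hN0] : exists N0, forall l, (N0 <= l)%N ->
    [/\ (energy L beta (eps l) (u (eps l)) <= C0%:E)%E, eps l <= 1 &
      (32 * C0 + 1) * eps l < 2^-1].
  have n1 : \forall l \near \oo, (energy L beta (eps l) (u (eps l)) <= C0%:E)%E.
    have [d /= d0 hd] := en; move/cvgrPdist_lt: epsc => /(_ d d0).
    by apply: filterS => l hl; apply: hd.
  have n2 : \forall l \near \oo, eps l <= 1 by exact: cvgr_le epsc _ ltr01.
  have n3 : \forall l \near \oo, (32 * C0 + 1) * eps l < 2^-1.
    have cm : (fun l => (32 * C0 + 1) * eps l) @ \oo --> (32 * C0 + 1) * 0.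
      by apply: cvgM => //; exact: cvg_cst.
    by rewrite mulr0 in cm; apply: cvgr_lt cm _ _; rewrite invr_gt0.
  have [N _ hN] := filterI n1 (filterI n2 n3).
  by exists N => l /hN[? []].
pose e1 l := eps (l + N0)%N.
have e10 l : 0 < e1 l by exact: eps0.
have e1c : e1 @ \oo --> 0 by rewrite (cvg_shiftn N0 eps).
have hN1 l := hN0 (l + N0)%N (leq_addl _ _).
have en1 l : (energy L beta (e1 l) (u (e1 l)) <= C0%:E)%E by have [] := hN1 l.
have bnd l := energy_bounds L0 (e10 l) (H1u _ (e10 l)) (en1 l).
have C00 : 0 <= C0.
  have [_ + _ _] := bnd 0%N; apply: le_trans; apply: Rintegral_ge0 => x _.
  have e4 : 0 <= (4 * e1 0%N)^-1 by rewrite invr_ge0 mulr_ge0// ltW.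
  have e2 : 0 <= e1 0%N / 2 by rewrite divr_ge0// ltW.
  by apply: addr_ge0; apply: mulr_ge0 => //; rewrite ?addr_ge0 ?sqr_ge0.
have prim1 l := H1_primitive_on (H1u _ (e10 l)).1 (c1 _ (e10 l)).
have prim2 l := H1_primitive_on (H1u _ (e10 l)).2 (c2 _ (e10 l)).
have cont1 l := continuous_within_unit (c1 _ (e10 l)).
have cont2 l := continuous_within_unit (c2 _ (e10 l)).
pose r l x := re_part (u (e1 l)) x ^+ 2 + im_part (u (e1 l)) x ^+ 2.
(* Each separated bad point costs 7/128, so M exceeds their possible number. *)
pose M := (Num.bound (128 / 7 * C0)).
have KM : C0 < 7 / 128 * M%:R.
  rewrite -ltr_pdivrMl// invf_div.
  by apply: archi_boundP; rewrite mulr_ge0.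
(* A multiple of eps above 32 eps C0; the + 1 makes the inequality strict also when C0 = 0. *)
pose eta l := (32 * C0 + 1) * e1 l.
have C1 : 0 < 32 * C0 + 1 by rewrite ltr_wpDl// mulr_ge0.
have cover l : exists X : seq R, [/\ (size X <= M)%N,
    forall x, x \in X -> 0 < x < 1 &
    forall z, [/\ 0 < z, z < 1 & r l z <= 4^-1] ->
      exists2 x, x \in X & `|z - x| <= 2 * eta l].
  have [Ie E_le _ _] := bnd l.
  have [||||X [sX X01 hX]] := bad_points_cover (e10 l) (prim1 l) (prim2 l) _ Ie E_le
    (eta := eta l) _ _ _ KM.
  - by move=> t t0 t1; apply: cvgD; apply: cvgM; [exact: cont1..|exact: cont2|exact: cont2].
  - have -> : eta l = 32 * e1 l * C0 + e1 l by rewrite /eta; ring.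
    by rewrite ltrDl.
  - by have [] := hN1 l.
  - by rewrite mulr_gt0.
  - by exists X; split => // z [z0 z1 rz]; exact: hX.
have etac : (fun l => 2 * eta l) @ \oo --> 0.
  rewrite [X in _ --> X](_ : 0 = 2 * ((32 * C0 + 1) * 0) :> R); last by rewrite !mulr0.
  by apply: cvgM; [exact: cvg_cst|apply: cvgM => //; exact: cvg_cst].
have [s1 [P [s1i hP]]] := concentration_points cover etac.
pose e2 l := e1 (s1 l).
have e20 l : 0 < e2 l by exact: e10.
have wb l := winding_bounds b0 b1 (e20 l) (let: And3 _ h _ := hN1 (s1 l) in h).
(* The target current [om] is 2 pi eps^{-beta} and the subtracted frequency [n] is 2 pi times its
   integer winding, at most 2 pi away. *)
have [|l|l|l|l|l|l|l|l|e e_gt0|s2 [theta [theta' [s2i [Ht Hc Hs] hK hpol [hw hL2]]]]] :=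
  @phase_compactness R
  (fun l => re_part (u (e2 l))) (fun l => im_part (u (e2 l)))
  (fun l => wderiv `]0, 1[ (re_part (u (e2 l))))
  (fun l => wderiv `]0, 1[ (im_part (u (e2 l))))
  e2 (fun l => 2 * pi * winding beta (e2 l)) (fun l => 2 * pi * e2 l `^ (- beta))
  C0 (2 * C0 / L) (2 * pi) ((2 * pi) ^+ 2) e20 _ (fun l => prim1 (s1 l)) (fun l => prim2 (s1 l))
  (fun l => cont1 (s1 l)) (fun l => cont2 (s1 l)) _ _ _ _ _ _ _ _ P _.
- exact: cvg_subseq s1i e1c.
- by have [[]] := wderivP (H1u _ (e20 l)).1.
- by have [[]] := wderivP (H1u _ (e20 l)).2.
- by have [] := bnd (s1 l).
- by have [] := bnd (s1 l).
- by have [] := bnd (s1 l).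
- by have [] := bnd (s1 l).
- exact: (wb l).1.
- exact: (wb l).2.
- apply: filterS (hP _ e_gt0) => l hl z z0 z1 far.
  rewrite ltNge; apply/negP => rz; apply: (hl z) => //.
(* Adding N0 undoes the initial shift after the two extractions. *)
pose s l := (s1 (s2 l) + N0)%N.
(* [P] may reach the boundary; only its points inside (0, 1) can be jumps of the limit. *)
pose J := [set` P] `&` (`]0, 1[%classic : set R).
exists (fun x => expi (theta x)), J, s => Om eps' w'.
split.
- by split; [apply: sub_finite_set (finite_seq P); exact: subIsetl|exact: subIsetr].
- split; first by split.
  by apply: aeW => x _; exact: modulus_expi.
- by move=> m n; rewrite /s leEnat leq_add2r -leEnat s1i -leEnat s2i.
- rewrite /cvg_L2C; under eq_cvg do under eq_integral do rewrite unwind_dist.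
  exact: hL2.
- exists theta, theta'; split => //.
  move=> K cK KO; have [N _ hN] := hK K cK KO.
  have [d d0 hd] := small_index N (fun l => eps0 (s l)).
  exists d => // l /hd /hN[ct rl]; split => // x /rl rx.
  have ri : 0 < re_part (u (eps' l)) x ^+ 2 + im_part (u (eps' l)) x ^+ 2.
    by apply: lt_trans rx; rewrite invr_gt0.
  rewrite modulus_unwind; split => //; first by rewrite modulusE sqrtr_gt0.
  rewrite modulusE; have [] := hpol l x; first by rewrite gt_eqF.
  exact: unwind_polar.
Qed.
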